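(* Let $K$ be a simplicial set. The quotient morphism of crossed complexes $p:\Pi^{\Upsilon}K\to \Pi K$ is a homotopy equivalence with a section $q:\Pi K\to\Pi^{\Upsilon}K$ (i.e. $pq=1$). Further, $\Pi K$ is a free crossed complex, with free generators given by the images of the non-degenerate elements of $K$.
   Context: **Crossed complexes.** All groupoid and group compositions are written additively; if $a:p\to q$ and $b:q\to r$ are arrows of a groupoid then $a+b:p\to r$; $0_p$ is the identity at $p$. A crossed complex $C$ consists of a set $C_0$; a groupoid $C_1$ with object set $C_0$ and source and target maps $s,t$; for each $n\ge 2$ a family of groups $C_n(p)$, $p\in C_0$ (for $x\in C_n(p)$ put $sx=tx=p$; also $tv=v$ for $v\in C_0$); a right action of $C_1$ on each $C_n$, $n\ge2$, so that $x\in C_n(p)$ and $a\in C_1(p,q)$ give $x^a\in C_n(q)$ with the usual rules; and families of homomorphisms $\delta_n:C_n(p)\to C_{n-1}(p)$ for $n\ge3$ and $\delta_2:C_2(p)\to C_1(p,p)$, such that: $\delta_{n-1}\delta_n=0$; the $\delta_n$ preserve the actions, where $C_1$ acts on its vertex groups by conjugation, so $\delta_2(x^a)=-a+\delta_2x+a$; $-y+x+y=x^{\delta_2y}$ for $x,y\in C_2(p)$; for $n\ge3$, $C_n$ is abelian and $\delta_2C_2$ acts trivially on $C_n$. Morphisms preserve all the structure. The fundamental groupoid is $\pi_1C=C_1/\delta_2(C_2)$. **Free crossed complexes.** $C$ is free on a family of subsets $R_n\subseteq C_n$ ($n\ge0$) if $R_0=C_0$, $C_1$ is the free groupoid on the graph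 $(R_1,R_0,s,t)$, $C_2$ is the free crossed $C_1$-module on $\delta_2|:R_2\to C_1$, and for $n\ge3$, $C_n$ is the free $\pi_1C$-module on $R_n$. **Homotopies.** A homotopy $(h,f):f^0\simeq f$ of morphisms $C\to D$ consists of functions $h_n:C_n\to D_{n+1}$ ($n\ge0$) with $th_n(x)=tf(x)$; $h_1(x+y)=h_1(x)^{fy}+h_1(y)$ for composable $x,y\in C_1$; $h_n(x+y)=h_n(x)+h_n(y)$ and $h_n(x^c)=(h_nx)^{fc}$ for $n\ge2$, $c\in C_1$; such that $f^0(x)=sh_0x$ for $x\in C_0$; $f^0(x)=h_0sx+fx+\delta_2h_1x-h_0tx$ for $x\in C_1$; $f^0(x)=\{fx+h_{n-1}\delta_nx+\delta_{n+1}h_nx\}^{-(h_0tx)}$ for $x\in C_n$, $n\ge2$. A morphism $f:C\to D$ is a homotopy equivalence if there is a morphism $g:D\to C$ with $gf\simeq1$ and $fg\simeq 1$. **Normal subcrossed complexes and quotients.** A subcrossed complex $A$ of $C$ is normal if $A_0=C_0$; $A_1$ is a totally disconnected normal subgroupoid of $C_1$; for $n\ge2$, $a\in A_n$ and $x\in C_1$ with $a^x$ defined imply $a^x\in A_n$; and for $n\ge2$, $a\in A_1$ and $x\in C_n$ with $x^a$ defined imply $x-x^a\in A_n$. Then the quotients $C_n/A_n$, $n\ge1$ (with $C_0$ as set of objects) form the quotient crossed complex $C/A$. A family of subsets normally generates the smallest normal subcrossed complex containing it. **The crossed complexes of a simplicial set.** Let $K$ have face maps $\partial_i$ and degeneracies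 $\varepsilon_i$. $\Pi^{\Upsilon}K$ is the free crossed complex with the elements of $K_n$ as free generators in dimension $n$ for all $n\ge 0$: $(\Pi^\Upsilon K)_0=K_0$; $x\in K_1$ is an arrow $x:\partial_1x\to\partial_0x$; $x\in K_n$, $n\ge 2$, has base point $tx=\partial_0^nx$; and, with $u_nx=\partial_0^{n-1}x\in K_1$, $\delta_2x=-\partial_1x+\partial_2x+\partial_0x$; $\delta_3x=(\partial_3x)^{u_3x}-\partial_0x-\partial_2x+\partial_1x$; $\delta_nx=(\partial_nx)^{u_nx}+\sum_{i=0}^{n-1}(-1)^{n-i}\partial_ix$ for $n\ge4$. $\Pi^{0N}K=(\Pi^{\Upsilon}K)/E_0K$, where $E_0K$ is the normal subcrossed complex of $\Pi^\Upsilon K$ (equal to $K_0$ in dimension $0$) normally generated by all elements $\varepsilon_0y$, $y\in K$. The image in $\Pi^{0N}K$ of $x\in K_n$ is again written $x$. For $k\ge0$, $D_kK\subseteq\Pi^{0N}K$ is the subcrossed complex with $(D_kK)_0=K_0$, $(D_kK)_1$ consisting only of identities, and $(D_kK)_n$ for $n\geq 2$ normally generated by the $\varepsilon_iy$ with $y\in K_{n-1}$, $i\le k$, $i\le n-1$. $DK=\bigcup_kD_kK$, and $\Pi K=\Pi^{0N}K/DK$. The quotient morphism $p:\Pi^\Upsilon K\to\Pi K$ is the composite of the quotient morphisms $\Pi^\Upsilon K\to\Pi^{0N}K\to\Pi K$. *)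

(* Defs.v *)
From mathcomp Require Import all_boot generic_quotient.
From mathcomp Require Import boolp classical_sets.

Set Implicit Arguments.
Unset Strict Implicit.
Unset Printing Implicit Defensive.

Local Open Scope classical_set_scope.
Local Open Scope quotient_scope.

(* Conventions.  Partial operations (composition of arrows, the action of a
   groupoid, out-of-range faces and degeneracies) are total functions whose
   values outside the domain of definition are arbitrary: every law, and every
   preservation property of morphisms, is restricted to that domain. *)

Declare Scope gpd_scope.
Delimit Scope gpd_scope with gpd.
Local Open Scope gpd_scope.

(** * Groupoids *)

(* Groupoids with object set [O], as a set of arrows with source and target;
   for [a : p -> q] and [b : q -> r], [a + b : p -> r].  A family of groups
   indexed by [O] is a groupoid in which [src = tgt]. *)
Record groupoid (O : Type) := Groupoid {
  arr :> Type;
  src : arr -> O;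
  tgt : arr -> O;
  idn : O -> arr;
  add : arr -> arr -> arr;
  opp : arr -> arr;
  src_idn : forall p, src (idn p) = p;
  tgt_idn : forall p, tgt (idn p) = p;
  src_add : forall x y, tgt x = src y -> src (add x y) = src x;
  tgt_add : forall x y, tgt x = src y -> tgt (add x y) = tgt y;
  src_opp : forall x, src (opp x) = tgt x;
  tgt_opp : forall x, tgt (opp x) = src x;
  addA : forall x y z, tgt x = src y -> tgt y = src z ->
    add x (add y z) = add (add x y) z;
  add0 : forall x, add (idn (src x)) x = x;
  addr0 : forall x, add x (idn (tgt x)) = x;
  addN : forall x, add (opp x) x = idn (tgt x);
  addrN : forall x, add x (opp x) = idn (src x)
}.

Arguments idn {O g} p.

Notation "x + y" := (add x y) : gpd_scope.
Notation "- x" := (opp x) : gpd_scope.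
Notation "x - y" := (add x (opp y)) : gpd_scope.

(* Preservation of identities and inverses follows. *)
Record is_functor (O O' : Type) (G : groupoid O) (H : groupoid O')
    (F0 : O -> O') (F : G -> H) : Prop := IsFunctor {
  functor_src : forall x, src (F x) = F0 (src x);
  functor_tgt : forall x, tgt (F x) = F0 (tgt x);
  functor_add : forall x y, tgt x = src y -> F (x + y) = F x + F y
}.

(* [G] is the free groupoid on the graph formed by [O] and [R].
   Only the values of [phi] on [R] matter. *)
Definition free_groupoid (O : Type) (G : groupoid O) (R : set G) : Prop :=
  forall (O' : Type) (H : groupoid O') (F0 : O -> O') (phi : G -> H),
    (forall r, R r -> src (phi r) = F0 (src r) /\ tgt (phi r) = F0 (tgt r)) ->
  let extends (F : G -> H) :=
    is_functor F0 F /\ (forall r, R r -> F r = phi r) in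
  (exists F, extends F) /\ (forall F F', extends F -> extends F' -> F =1 F').

(* Totally disconnected normal subgroupoids containing every identity. *)
Record td_normal (O : Type) (G : groupoid O) (N : set G) : Prop := TdNormal {
  td_loop : forall x, N x -> src x = tgt x;
  td_idn : forall p, N (idn p);
  td_add : forall x y, N x -> N y -> tgt x = src y -> N (x + y);
  td_opp : forall x, N x -> N (- x);
  td_conj : forall x c, N x -> tgt x = src c -> N (- c + x + c)
}.

Section GroupoidTheory.
Variables (O : Type) (G : groupoid O).
Implicit Types x y z : G.

Lemma idn_idem x : x + x = x -> src x = tgt x -> x = idn (tgt x).
Proof.
move=> xx st; rewrite -(addN x) -{3}xx addA ?tgt_opp //.
by rewrite addN -st add0.
Qed.

Lemma addNKl x y : tgt x = src y -> - x + (x + y) = y.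
Proof.
by move=> e; rewrite addA ?src_opp ?tgt_opp // addN e add0.
Qed.

Lemma addrK x y : tgt x = src y -> x + y - y = x.
Proof.
by move=> e; rewrite -addA ?src_opp ?tgt_opp // addrN -e addr0.
Qed.

Lemma addrNK x y : tgt x = tgt y -> x - y + y = x.
Proof.
by move=> e; rewrite -addA ?src_opp ?tgt_opp // addN -e addr0.
Qed.

Lemma addI x y z : tgt x = src y -> tgt x = src z -> x + y = x + z -> y = z.
Proof. by move=> e e' h; rewrite -(addNKl e) h addNKl. Qed.

Lemma opp_eq x y : tgt x = src y -> tgt y = src x -> x + y = idn (src x) ->
  y = - x.
Proof.
move=> e e' h; apply: (@addI x); rewrite ?src_opp //.
by rewrite h addrN.
Qed.

Lemma oppK x : - - x = x.
Proof.
by rewrite -(@opp_eq (- x) x) ?src_opp ?tgt_opp ?addN.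
Qed.

Lemma oppD x y : tgt x = src y -> - (x + y) = - y - x.
Proof.
move=> e; rewrite -(@opp_eq (x + y) (- y - x)) //.
- by rewrite tgt_add // src_add ?src_opp ?tgt_opp.
- by rewrite src_add // tgt_add ?src_opp ?tgt_opp.
rewrite addA ?src_opp ?tgt_opp ?tgt_add //.
by rewrite addrK // addrN src_add.
Qed.

End GroupoidTheory.

Section FunctorTheory.
Variables (O O' : Type) (G : groupoid O) (H : groupoid O').
Variables (F0 : O -> O') (F : G -> H).
Hypothesis hF : is_functor F0 F.

Lemma functor_idn p : F (idn p) = idn (F0 p).
Proof.
case: hF => fs ft fa.
rewrite (@idn_idem _ _ (F (idn p))) ?ft ?fs ?src_idn ?tgt_idn //.
rewrite -fa ?src_idn ?tgt_idn //.
by rewrite -{1}(src_idn G p) add0.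
Qed.

Lemma functor_opp x : F (- x) = - F x.
Proof.
case: (hF) => fs ft fa.
apply: opp_eq; rewrite ?fs ?ft ?src_opp ?tgt_opp //.
by rewrite -fa ?src_opp // addrN functor_idn.
Qed.

End FunctorTheory.

(* The quotient of [G] by a totally disconnected normal subgroupoid. *)
Section GroupoidQuotient.
Variables (O : Type) (G : groupoid O) (N : set G) (hN : td_normal N).
Implicit Types x y z : G.

Definition geqv x y := [/\ src x = src y, tgt x = tgt y & N (x - y)].

Lemma geqv_refl x : geqv x x.
Proof. by split=> //; rewrite addrN; apply: td_idn. Qed.

Lemma geqv_sym x y : geqv x y -> geqv y x.
Proof.
case=> s t n; split=> //.
rewrite -(oppK y) -oppD ?src_opp ?tgt_opp ?oppK //.
exact: td_opp.
Qed.

Lemma geqv_trans x y z : geqv x y -> geqv y z -> geqv x z.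
Proof.
case=> s t n [s' t' n']; split; [congruence|congruence|].
have -> : x - z = (x - y) + (y - z).
  rewrite addA ?src_opp ?tgt_opp ?tgt_add ?src_opp ?tgt_opp //.
  by rewrite addrNK.
by apply: td_add=> //; rewrite tgt_add ?src_add ?src_opp ?tgt_opp.
Qed.

Lemma geqv_add x x' y y' : tgt x = src y -> geqv x x' -> geqv y y' ->
  geqv (x + y) (x' + y').
Proof.
move=> e [s t n] [s' t' n'].
have e' : tgt x' = src y' by congruence.
split; rewrite ?src_add ?tgt_add //.
have sy : src (y - y') = src y by rewrite src_add ?src_opp.
have ty : tgt (y - y') = src y by rewrite tgt_add ?tgt_opp ?src_opp.
have -> : x + y - (x' + y') = (x + (y - y') - x) + (x - x').
  rewrite oppD // addA ?src_add ?src_opp ?tgt_opp //; last by rewrite tgt_add.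
  rewrite [RHS]addA ?src_opp ?tgt_opp ?tgt_add ?src_add ?src_opp ?tgt_opp //;
    try congruence.
  rewrite addrNK ?tgt_add ?src_opp ?tgt_opp //; try congruence.
  by rewrite addA ?src_opp ?tgt_opp.
apply: td_add=> //; last first.
  rewrite tgt_add ?src_add ?src_opp ?tgt_opp ?tgt_add ?src_opp ?tgt_opp //;
  congruence.
rewrite -{1}(oppK x); apply: td_conj=> //; rewrite ?src_opp ?tgt_opp //.
congruence.
Qed.

Lemma geqv_opp x y : geqv x y -> geqv (- x) (- y).
Proof.
move=> h; case: (h) => s t _; have [_ _ n] := geqv_sym h.
split; rewrite ?src_opp ?tgt_opp // oppK.
have -> : - x + y = - x + (y - x) + x.
  rewrite addA ?src_opp ?tgt_opp //.
  by rewrite addrNK // tgt_add ?tgt_opp.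
by apply: td_conj=> //; rewrite tgt_add ?src_opp ?tgt_opp.
Qed.

Definition geqvb : rel {classic G} := fun x y => `[< geqv x y >].

Lemma geqvb_refl : reflexive geqvb.
Proof. by move=> x; apply/asboolP/geqv_refl. Qed.

Lemma geqvb_sym : symmetric geqvb.
Proof. by move=> x y; apply/asboolP/asboolP; apply: geqv_sym. Qed.

Lemma geqvb_trans : transitive geqvb.
Proof.
by move=> y x z /asboolP h /asboolP h'; apply/asboolP/(geqv_trans h h').
Qed.

Definition geqv_equiv := EquivRel geqvb geqvb_refl geqvb_sym geqvb_trans.

Definition gcosets : Type := {eq_quot geqv_equiv}.

Definition gproj (x : G) : gcosets := \pi_{eq_quot geqv_equiv} (x : {classic G}).

Definition grepr (u : gcosets) : G := repr (u : {eq_quot geqv_equiv}).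

Lemma greprK u : gproj (grepr u) = u.
Proof. exact: reprK. Qed.

Lemma gprojP x y : gproj x = gproj y <-> geqv x y.
Proof.
split=> [h|h]; last by apply/eqmodP/asboolP.
by move/eqmodP: h => /asboolP.
Qed.

Lemma grepr_proj x : geqv (grepr (gproj x)) x.
Proof. by apply/gprojP; rewrite greprK. Qed.

Definition gq_src u := src (grepr u).
Definition gq_tgt u := tgt (grepr u).
Definition gq_idn p := gproj (idn p).
Definition gq_add u v := gproj (grepr u + grepr v).
Definition gq_opp u := gproj (- grepr u).

Lemma gq_srcE x : gq_src (gproj x) = src x.
Proof. by have [] := grepr_proj x. Qed.

Lemma gq_tgtE x : gq_tgt (gproj x) = tgt x.
Proof. by have [] := grepr_proj x. Qed.

Lemma gq_addE x y : tgt x = src y -> gq_add (gproj x) (gproj y) = gproj (x + y).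
Proof.
move=> e; apply/gprojP/geqv_add; [|exact: grepr_proj|exact: grepr_proj].
by rewrite -/(gq_src _) -/(gq_tgt _) gq_srcE gq_tgtE.
Qed.

Lemma gq_oppE x : gq_opp (gproj x) = gproj (- x).
Proof. exact/gprojP/geqv_opp/grepr_proj. Qed.

Lemma gq_ind (P : gcosets -> Prop) : (forall x, P (gproj x)) -> forall u, P u.
Proof. by move=> h u; rewrite -(greprK u). Qed.

#[local] Obligation Tactic := idtac.

Program Definition gquot : groupoid O :=
  @Groupoid O gcosets gq_src gq_tgt gq_idn gq_add gq_opp
    _ _ _ _ _ _ _ _ _ _ _.
Next Obligation. by move=> p; rewrite gq_srcE src_idn. Qed.
Next Obligation. by move=> p; rewrite gq_tgtE tgt_idn. Qed.
Next Obligation. by move=> u v e; rewrite gq_srcE src_add. Qed.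
Next Obligation. by move=> u v e; rewrite gq_tgtE tgt_add. Qed.
Next Obligation. by move=> u; rewrite gq_srcE src_opp. Qed.
Next Obligation. by move=> u; rewrite gq_tgtE tgt_opp. Qed.
Next Obligation.
elim/gq_ind=> x; elim/gq_ind=> y; elim/gq_ind=> z.
rewrite !gq_srcE !gq_tgtE => e e'.
by rewrite !gq_addE ?src_add ?tgt_add // addA.
Qed.
Next Obligation.
by elim/gq_ind=> x; rewrite gq_srcE gq_addE ?tgt_idn // add0.
Qed.
Next Obligation.
by elim/gq_ind=> x; rewrite gq_tgtE gq_addE ?src_idn // addr0.
Qed.
Next Obligation.
by elim/gq_ind=> x; rewrite gq_tgtE gq_oppE gq_addE ?tgt_opp // addN.
Qed.
Next Obligation.
by elim/gq_ind=> x; rewrite gq_srcE gq_oppE gq_addE ?src_opp // addrN.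
Qed.

Lemma gproj_functor : is_functor id (gproj : G -> gquot).
Proof.
by split=> *; rewrite /= ?gq_srcE ?gq_tgtE // gq_addE.
Qed.

End GroupoidQuotient.

(** * Crossed modules and modules over a groupoid *)

Record is_action (O : Type) (G M : groupoid O) (act : M -> G -> M) : Prop :=
    IsAction {
  action_loop : forall x : M, src x = tgt x;
  action_tgt : forall x a, tgt x = src a -> tgt (act x a) = tgt a;
  action_idn : forall x, act x (idn (tgt x)) = x;
  action_comp : forall x a b, tgt x = src a -> tgt a = src b ->
    act x (a + b) = act (act x a) b;
  action_add : forall (x y : M) a, tgt x = tgt y -> tgt x = src a ->
    act (x + y) a = act x a + act y a
}.

Record is_equivariant (O : Type) (G M M' : groupoid O)
    (act : M -> G -> M) (act' : M' -> G -> M') (F : M -> M') : Prop :=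
    IsEquivariant {
  equivariant_functor : is_functor id F;
  equivariant_act : forall x a, tgt x = src a -> F (act x a) = act' (F x) a
}.

Record is_crossed_module (O : Type) (G M : groupoid O)
    (act : M -> G -> M) (mu : M -> G) : Prop := IsCrossedModule {
  crossed_action : is_action act;
  crossed_functor : is_functor id mu;
  crossed_act : forall x a, tgt x = src a -> mu (act x a) = - a + mu x + a;
  crossed_peiffer : forall x y : M, tgt x = tgt y -> - y + x + y = act x (mu y)
}.

Record is_module (O : Type) (G M : groupoid O) (act : M -> G -> M) : Prop :=
    IsModule {
  module_action : is_action act;
  module_comm : forall x y : M, tgt x = tgt y -> x + y = y + x
}.

(* The crossed [G]-module [mu : M -> G] is free on the restriction of [mu] to
   [R]; the morphisms of crossed [G]-modules are over the identity of [G]. *)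
Definition free_crossed_module (O : Type) (G M : groupoid O)
    (act : M -> G -> M) (mu : M -> G) (R : set M) : Prop :=
  forall (M' : groupoid O) (act' : M' -> G -> M') (mu' : M' -> G),
    is_crossed_module act' mu' ->
  forall phi : M -> M',
    (forall r, R r -> tgt (phi r) = tgt r /\ mu' (phi r) = mu r) ->
  let extends (F : M -> M') :=
    [/\ is_equivariant act act' F, (forall x, mu' (F x) = mu x)
      & (forall r, R r -> F r = phi r)] in
  (exists F, extends F) /\ (forall F F', extends F -> extends F' -> F =1 F').

Definition free_module (O : Type) (G M : groupoid O) (act : M -> G -> M)
    (R : set M) : Prop :=
  forall (M' : groupoid O) (act' : M' -> G -> M'), is_module act' ->
  forall phi : M -> M', (forall r, R r -> tgt (phi r) = tgt r) ->
  let extends (F : M -> M') :=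
    is_equivariant act act' F /\ (forall r, R r -> F r = phi r) in
  (exists F, extends F) /\ (forall F F', extends F -> extends F' -> F =1 F').

(** * Crossed complexes *)

(* [gpd C n] is the part of [C] of dimension [n.+1]: the groupoid C_1 for
   [n = 0], and the family of groups C_(n+1) otherwise.  [@bd C n] is
   delta_(n+2) : C_(n+2) -> C_(n+1), and [@act C n] is the action of C_1 on
   C_(n+2).  [cell C n] is C_n. *)
Record crossedComplex := CrossedComplex {
  ob : Type;
  gpd : nat -> groupoid ob;
  act : forall n, gpd n.+1 -> gpd 0 -> gpd n.+1;
  bd : forall n, gpd n.+1 -> gpd n;
  cc_crossed : is_crossed_module (@act 0) (@bd 0);
  cc_module : forall n, is_module (@act n.+1);
  cc_bd : forall n, is_equivariant (@act n.+1) (@act n) (@bd n.+1);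
  cc_bdbd : forall n (x : gpd n.+2), bd (bd x) = idn (tgt x);
  cc_triv : forall n (x : gpd n.+2) (y : gpd 1), tgt x = tgt y ->
    act x (bd y) = x
}.

Definition cell (C : crossedComplex) (n : nat) : Type :=
  if n is m.+1 then gpd C m else ob C.

Definition base (C : crossedComplex) (n : nat) : cell C n -> ob C :=
  match n with 0 => id | m.+1 => @tgt _ (gpd C m) end.

Record morphism (C D : crossedComplex) := Morphism {
  mor :> forall n, cell C n -> cell D n;
  mor_functor : forall n,
    is_functor (mor (n := 0)) (mor (n := n.+1) : gpd C n -> gpd D n);
  mor_act : forall n (x : gpd C n.+1) (a : gpd C 0), tgt x = src a ->
    mor (n := n.+2) (act x a) = act (mor (n := n.+2) x) (mor (n := 1) a);
  mor_bd : forall n (x : gpd C n.+1),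
    mor (n := n.+1) (bd x) = bd (mor (n := n.+2) x)
}.

Definition morphism_id (C : crossedComplex) : morphism C C.
Proof. by exists (fun n => id); [split|..]. Defined.

Definition morphism_comp (C D E : crossedComplex)
  (g : morphism D E) (f : morphism C D) : morphism C E.
Proof.
exists (fun n x => g n (f n x)).
- move=> n; have [fs ft fa] := mor_functor f n.
  have [gs gt ga] := mor_functor g n.
  split=> [x|x|x y e]; rewrite ?gs ?fs ?gt ?ft // fa // ga // ft fs e //.
- move=> n x a e; rewrite (mor_act f) // (mor_act g) //.
  have [_ -> _] := mor_functor f n.+1; have [-> _ _] := mor_functor f 0.
  by rewrite e.
- by move=> n x; rewrite (mor_bd f) (mor_bd g).
Defined.

(** * Homotopies *)

Record is_homotopy (C D : crossedComplex) (f0 f : morphism C D)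
    (h : forall n, cell C n -> gpd D n) : Prop := IsHomotopy {
  homotopy_tgt : forall n (x : cell C n), tgt (h n x) = base (f n x);
  homotopy_add1 : forall x y : gpd C 0, tgt x = src y ->
    h 1 (x + y) = act (h 1 x) (f 1 y) + h 1 y;
  homotopy_add : forall n (x y : gpd C n.+1), tgt x = tgt y ->
    h n.+2 (x + y) = h n.+2 x + h n.+2 y;
  homotopy_act : forall n (x : gpd C n.+1) (c : gpd C 0), tgt x = src c ->
    h n.+2 (act x c) = act (h n.+2 x) (f 1 c);
  homotopy0 : forall x : ob C, f0 0 x = src (h 0 x);
  homotopy1 : forall x : gpd C 0,
    f0 1 x = h 0 (src x) + f 1 x + bd (h 1 x) - h 0 (tgt x);
  homotopy2 : forall n (x : gpd C n.+1),
    f0 n.+2 x =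
    act ((f n.+2 x : gpd D n.+1) + h n.+1 (bd x) + bd (h n.+2 x))
        (- h 0 (tgt x))
}.

Definition homotopic (C D : crossedComplex) (f0 f : morphism C D) : Prop :=
  exists h, is_homotopy f0 f h.

Definition homotopy_equivalence (C D : crossedComplex) (f : morphism C D) :
    Prop :=
  exists g : morphism D C,
    homotopic (morphism_comp g f) (morphism_id C) /\
    homotopic (morphism_comp f g) (morphism_id D).

(** * Free crossed complexes *)

Section FundamentalGroupoid.
Variable C : crossedComplex.

Lemma bd_functor n : is_functor id (@bd C n).
Proof.
by case: n => [|n]; [case: (cc_crossed C)|case: (cc_bd C n)].
Qed.

Lemma act_action n : is_action (@act C n).
Proof.
by case: n => [|n]; [case: (cc_crossed C)|case: (cc_module C n)].
Qed.

Lemma act_idn n (p : ob C) (a : gpd C 0) : p = src a ->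
  act (idn p : gpd C n.+1) a = idn (tgt a).
Proof.
have [al at_ _ _ aa] := act_action n; move=> e.
have e' : tgt (idn p : gpd C n.+1) = src a by rewrite tgt_idn.
rewrite -(at_ _ _ e'); apply: idn_idem; last exact: al.
by rewrite -aa // -{1}(src_idn (gpd C n.+1) p) add0.
Qed.

Lemma act_opp n (x : gpd C n.+1) (a : gpd C 0) : tgt x = src a ->
  act (- x) a = - act x a.
Proof.
have [al at_ _ _ aa] := act_action n; move=> e.
have e' : tgt (- x) = src a by rewrite tgt_opp al.
apply: opp_eq; rewrite ?al ?at_ //.
by rewrite -aa ?tgt_opp ?al // addrN al act_idn.
Qed.

Lemma bd_range_normal : td_normal (range (@bd C 0)).
Proof.
have [bs bt ba] := bd_functor 0; have [al at_ _ _ _] := act_action 0.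
split.
- by move=> _ [x _ <-]; rewrite bs bt; apply: al.
- by move=> p; exists (idn p); rewrite ?(functor_idn (bd_functor 0)).
- move=> _ _ [x _ <-] [y _ <-]; rewrite bs bt => e.
  by exists (x + y); rewrite ?ba.
- move=> _ [x _ <-]; exists (- x) => //.
  by rewrite (functor_opp (bd_functor 0)).
- move=> _ c [x _ <-]; rewrite bt => e.
  by exists (act x c); rewrite // (crossed_act (cc_crossed C)).
Qed.

Definition pi1 : groupoid (ob C) := gquot bd_range_normal.

(* The action of [pi1] on C_(n+3) induced by that of C_1. *)
Definition pi1_act n (x : gpd C n.+2) (a : pi1) : gpd C n.+2 :=
  act x (grepr a).

Lemma pi1_actE n (x : gpd C n.+2) (a : gpd C 0) : tgt x = src a ->
  pi1_act x (gproj bd_range_normal a) = act x a.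
Proof.
move=> e; rewrite /pi1_act.
have [s t [y _ yE]] := grepr_proj bd_range_normal a.
move: (grepr _) s t yE => b s t yE.
have [bs bt _] := bd_functor 0.
have ey : tgt x = tgt y.
  rewrite e -bt yE tgt_add ?tgt_opp //.
  by rewrite src_opp.
have -> : b = bd y + a by rewrite yE addrNK.
have [al _ _ ac _] := act_action n.+1.
have ly : src y = tgt y := action_loop (act_action 0) y.
by rewrite ac ?cc_triv // ?bs ?bt ?ly -?ey.
Qed.

Lemma pi1_module n : is_module (@pi1_act n).
Proof.
have [al at_ ai ac aa] := act_action n.+1.
split; last exact: (module_comm (cc_module C n)).
split.
- exact: al.
- move=> x; elim/gq_ind=> a /=; rewrite gq_srcE gq_tgtE => e.
  by rewrite pi1_actE // at_.
- by move=> x; rewrite [idn _]/(gproj _ _) pi1_actE ?src_idn.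
- move=> x; elim/gq_ind=> a; elim/gq_ind=> b /=.
  rewrite !gq_srcE !gq_tgtE => e e'.
  by rewrite gq_addE // !pi1_actE ?src_add ?at_ // ac.
- move=> x y; elim/gq_ind=> a /=; rewrite gq_srcE => e e'.
  have ey : tgt y = src a by rewrite -e.
  have exy : tgt (x + y) = src a by rewrite tgt_add // al.
  by rewrite !pi1_actE // aa.
Qed.

Definition free_crossed_complex (R : forall n, set (cell C n)) : Prop :=
  [/\ R 0 = setT,
      free_groupoid (R 1),
      free_crossed_module (@act C 0) (@bd C 0) (R 2)
    & forall n, free_module (@pi1_act n) (R n.+3)].

(* The images under [g] of the elements of [X] are free generators of [C], and
   distinct elements of [X] give distinct generators. *)
Definition free_generators (T : nat -> Type) (X : forall n, set (T n))
    (g : forall n, T n -> cell C n) : Prop :=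
  (forall n x y, X n x -> X n y -> g n x = g n y -> x = y) /\
  free_crossed_complex (fun n => g n @` X n).

End FundamentalGroupoid.

(** * Normal subcrossed complexes and quotients *)

Record is_subcrossed (C : crossedComplex) (A : forall n, set (cell C n)) :
    Prop := IsSubcrossed {
  sub_src : forall n (x : gpd C n), A n.+1 x -> A 0 (src x);
  sub_tgt : forall n (x : gpd C n), A n.+1 x -> A 0 (tgt x);
  sub_idn : forall n p, A 0 p -> A n.+1 (idn p : gpd C n);
  sub_add : forall n (x y : gpd C n), A n.+1 x -> A n.+1 y -> tgt x = src y ->
    A n.+1 (x + y);
  sub_opp : forall n (x : gpd C n), A n.+1 x -> A n.+1 (- x);
  sub_act : forall n (x : gpd C n.+1) (a : gpd C 0), A n.+2 x -> A 1 a ->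
    tgt x = src a -> A n.+2 (act x a);
  sub_bd : forall n (x : gpd C n.+1), A n.+2 x -> A n.+1 (bd x)
}.

Record is_normal (C : crossedComplex) (A : forall n, set (cell C n)) : Prop :=
    IsNormal {
  normal_sub : is_subcrossed A;
  normal_ob : A 0 = setT;
  normal_loop : forall x : gpd C 0, A 1 x -> src x = tgt x;
  normal_conj : forall x c : gpd C 0, A 1 x -> tgt x = src c ->
    A 1 (- c + x + c);
  normal_act : forall n (a : gpd C n.+1) (x : gpd C 0), A n.+2 a ->
    tgt a = src x -> A n.+2 (act a x);
  normal_diff : forall n (x : gpd C n.+1) (a : gpd C 0), A 1 a ->
    tgt x = src a -> A n.+2 (x - act x a)
}.

(* The smallest normal subcrossed complex containing [X].  One exists as soon
   as [X 1] consists of loops, see [normal_closureP]. *)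
Definition normal_closure (C : crossedComplex) (X : forall n, set (cell C n))
    (n : nat) : set (cell C n) :=
  [set x | forall A, is_normal A -> (forall m, X m `<=` A m) -> A n x].

Arguments normal_closure {C} X n.

Lemma normal_closure_sub (C : crossedComplex) (X : forall n, set (cell C n)) n :
  X n `<=` normal_closure X n.
Proof. by move=> x Xx A _; apply. Qed.

Lemma normal_closureP (C : crossedComplex) (X : forall n, set (cell C n)) :
  (forall x : gpd C 0, X 1 x -> src x = tgt x) -> is_normal (normal_closure X).
Proof.
move=> X1; have loops : forall x : gpd C 0, normal_closure X 1 x -> src x = tgt x.
  pose B n : set (cell C n) :=
    match n with 1 => [set x : gpd C 0 | src x = tgt x] | _ => setT end.
  move=> x /(_ B); apply; last by case=> [|[|n]].
  have [bs bt _] := bd_functor C 0.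
  have [al _ _ _ _] := act_action C 0.
  split=> //=; last first.
    move=> y c /= ey e; have e1 : tgt (- c) = src y by rewrite tgt_opp ey e.
    have e2 : tgt (- c + y) = src c by rewrite tgt_add.
    by rewrite src_add // tgt_add // src_add // src_opp.
  split=> //=.
  - by case=> [|n] // p _; rewrite /= src_idn tgt_idn.
  - by case=> [|n] //= y z ey ez e; rewrite src_add // tgt_add // ey e ez.
  - by case=> [|n] //= y ey; rewrite src_opp tgt_opp.
  - by case=> [|n] //= y _; rewrite bs bt al.
split=> //; [split| | | |].
- by move=> n x _ A hA _; rewrite (normal_ob hA).
- by move=> n x _ A hA _; rewrite (normal_ob hA).
- move=> n p _ A hA _; apply: (sub_idn (normal_sub hA)).
  by rewrite (normal_ob hA).
- move=> n x y hx hy e A hA sA; apply: (sub_add (normal_sub hA)) => //.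
    exact: hx.
  exact: hy.
- by move=> n x hx A hA sA; apply: (sub_opp (normal_sub hA)); apply: hx.
- move=> n x a hx ha e A hA sA; apply: (sub_act (normal_sub hA)) => //.
    exact: hx.
  exact: ha.
- by move=> n x hx A hA sA; apply: (sub_bd (normal_sub hA)); apply: hx.
- by apply/seteqP; split=> // p _ A hA _; rewrite (normal_ob hA).
- by move=> x c hx e A hA sA; apply: (normal_conj hA) => //; apply: hx.
- by move=> n a x ha e A hA sA; apply: (normal_act hA) => //; apply: ha.
- by move=> n x a ha e A hA sA; apply: (normal_diff hA) => //; apply: ha.
Qed.


Section Quotient.
Variables (C : crossedComplex) (A : forall n, set (cell C n)).
Arguments A : clear implicits.
Hypothesis hA : is_normal A.

Lemma normal_td n : td_normal (A n.+1).
Proof.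
split.
- case: n => [|n] x; first exact: (normal_loop hA).
  by move=> _; apply: (action_loop (act_action C n)).
- by move=> p; apply: (sub_idn (normal_sub hA)); rewrite (normal_ob hA).
- by move=> x y; apply: (sub_add (normal_sub hA)).
- by move=> x; apply: (sub_opp (normal_sub hA)).
- case: n => [|[|n]] x c hx e; first exact: (normal_conj hA).
    have lc : src c = tgt c := action_loop (act_action C 0) c.
    have [bs bt _] := bd_functor C 0.
    rewrite (crossed_peiffer (cc_crossed C)) -?lc //.
    by apply: (normal_act hA); rewrite // bs.
  have lc : src c = tgt c := action_loop (act_action C n.+1) c.
  have lx : src x = tgt x := action_loop (act_action C n.+1) x.
  rewrite -addA ?tgt_opp ?lx ?e //.
  rewrite (module_comm (cc_module C n)) ?tgt_opp ?tgt_add -?lc //.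
  by rewrite addrK.
Qed.

Definition qgpd n : groupoid (ob C) := gquot (normal_td n).

Definition qproj n (x : gpd C n) : qgpd n := gproj (normal_td n) x.

Definition qact n (x : qgpd n.+1) (a : qgpd 0) : qgpd n.+1 :=
  qproj (act (grepr x) (grepr a)).

Definition qbd n (x : qgpd n.+1) : qgpd n := qproj (bd (grepr x)).

Lemma qind n (P : qgpd n -> Prop) : (forall x, P (qproj x)) -> forall u, P u.
Proof. exact: gq_ind. Qed.

Lemma qproj_functor n : is_functor id (@qproj n).
Proof. exact: gproj_functor. Qed.

Lemma qprojP n (x y : gpd C n) :
  qproj x = qproj y <-> [/\ src x = src y, tgt x = tgt y & A n.+1 (x - y)].
Proof. exact: gprojP. Qed.

Lemma qbdE n (x : gpd C n.+1) : qbd (qproj x) = qproj (bd x).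
Proof.
apply/qprojP; have [s t h] := grepr_proj (normal_td n.+1) x.
have [bs bt ba] := bd_functor C n.
rewrite !bs !bt; split=> //.
rewrite -(functor_opp (bd_functor C n)) -ba; last by rewrite src_opp.
exact: (sub_bd (normal_sub hA)).
Qed.

Lemma qactE n (x : gpd C n.+1) (a : gpd C 0) : tgt x = src a ->
  qact (qproj x) (qproj a) = qproj (act x a).
Proof.
move=> e; rewrite /qact.
have := grepr_proj (normal_td n.+1) x; have := grepr_proj (normal_td 0) a.
rewrite -/(qproj a) -/(qproj x).
move: (grepr (qproj a)) (grepr (qproj x)) => b y [sb tb hb] [sy ty hy].
have [al at_ ai ac aa] := act_action C n.
have eb : tgt x = src b by rewrite sb.
transitivity (qproj (act x b)); apply/qprojP.
  split; [by rewrite !al !at_ // ty|by rewrite !at_ // ty|].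
  rewrite -act_opp ?ty //.
  rewrite -aa ?tgt_opp ?al ?ty //.
  by apply: (normal_act hA); rewrite // tgt_add ?src_opp // tgt_opp al.
split; [by rewrite !al !at_|by rewrite !at_|].
have la := normal_loop hA hb.
have e1 : tgt b = src (- a) by rewrite src_opp.
have hc : A 1 (a - b).
  by have := td_opp (normal_td 0) hb; rewrite oppD // oppK.
have e2 : tgt a = src (- b) by rewrite src_opp tb.
have -> : act x a = act (act x (a - b)) b.
  by rewrite -ac ?src_add ?tgt_add ?tgt_opp // addrNK // tb.
have e3 : tgt x = src (a - b) by rewrite src_add.
have e4 : tgt (act x (a - b)) = src b by rewrite at_ // tgt_add ?tgt_opp.
have ce : tgt (act x (a - b)) = tgt x by rewrite e4.
rewrite -act_opp //.
rewrite -aa ?tgt_opp ?al ?ce //.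
apply: (normal_act hA); first exact: (normal_diff hA).
by rewrite tgt_add ?src_opp ?ce // tgt_opp al ce.
Qed.

Lemma q_crossed : is_crossed_module (@qact 0) (@qbd 0).
Proof.
have [bs bt ba] := bd_functor C 0; have [al at_ ai ac aa] := act_action C 0.
split; first split.
- by elim/qind=> x; rewrite /= gq_srcE gq_tgtE al.
- elim/qind=> x; elim/qind=> a; rewrite /= gq_srcE gq_tgtE => e.
  by rewrite qactE //= !gq_tgtE at_.
- elim/qind=> x; rewrite /= gq_tgtE [gq_idn _ _]/(qproj (idn _)).
  by rewrite qactE ?src_idn // ai.
- elim/qind=> x; elim/qind=> a; elim/qind=> b.
  rewrite /= !gq_srcE !gq_tgtE => e e'.
  by rewrite gq_addE // !qactE ?src_add ?at_ // ac.
- elim/qind=> x; elim/qind=> y; elim/qind=> a.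
  rewrite /= !gq_srcE !gq_tgtE => e e'.
  have lxy : tgt x = src y by rewrite al.
  have exy : tgt (x + y) = src a by rewrite tgt_add // -e.
  have ey : tgt y = src a by rewrite -e.
  have lact : tgt (act x a) = src (act y a) by rewrite al !at_.
  by rewrite gq_addE // !qactE // gq_addE // aa.
- split; [by elim/qind=> x; rewrite qbdE /= !gq_srcE bs
         |by elim/qind=> x; rewrite qbdE /= !gq_tgtE bt|].
  elim/qind=> x; elim/qind=> y; rewrite /= !gq_srcE !gq_tgtE => e.
  by rewrite gq_addE // !qbdE gq_addE ?bs ?bt // ba.
- elim/qind=> x; elim/qind=> a; rewrite /= !gq_srcE !gq_tgtE => e.
  have e1 : tgt (- a) = src (bd x) by rewrite tgt_opp bs al.
  have e2 : tgt (- a + bd x) = src a by rewrite tgt_add // bt.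
  rewrite qactE // !qbdE gq_oppE (gq_addE _ e1) (gq_addE _ e2).
  by rewrite (crossed_act (cc_crossed C)).
- elim/qind=> x; elim/qind=> y; rewrite /= !gq_tgtE => e.
  have e1 : tgt (- y) = src x by rewrite tgt_opp !al.
  have e2 : tgt (- y + x) = src y by rewrite tgt_add // al.
  rewrite gq_oppE (gq_addE _ e1) (gq_addE _ e2) qbdE qactE ?bs ?al //.
  by rewrite (crossed_peiffer (cc_crossed C)).
Qed.

Lemma q_module n : is_module (@qact n.+1).
Proof.
have [al at_ ai ac aa] := act_action C n.+1.
split; first split.
- by elim/qind=> x; rewrite /= gq_srcE gq_tgtE al.
- elim/qind=> x; elim/qind=> a; rewrite /= gq_srcE gq_tgtE => e.
  by rewrite qactE //= !gq_tgtE at_.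
- elim/qind=> x; rewrite /= gq_tgtE [gq_idn _ _]/(qproj (idn _)).
  by rewrite qactE ?src_idn // ai.
- elim/qind=> x; elim/qind=> a; elim/qind=> b.
  rewrite /= !gq_srcE !gq_tgtE => e e'.
  by rewrite gq_addE // !qactE ?src_add ?at_ // ac.
- elim/qind=> x; elim/qind=> y; elim/qind=> a.
  rewrite /= !gq_srcE !gq_tgtE => e e'.
  have lxy : tgt x = src y by rewrite al.
  have exy : tgt (x + y) = src a by rewrite tgt_add // -e.
  have ey : tgt y = src a by rewrite -e.
  have lact : tgt (act x a) = src (act y a) by rewrite al !at_.
  by rewrite gq_addE // !qactE // gq_addE // aa.
- elim/qind=> x; elim/qind=> y; rewrite /= !gq_tgtE => e.
  by rewrite !gq_addE ?al // (module_comm (cc_module C n)).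
Qed.

Lemma q_equivariant n : is_equivariant (@qact n.+1) (@qact n) (@qbd n.+1).
Proof.
have [[bs bt ba] be] := cc_bd C n.
split; first split.
- by elim/qind=> x; rewrite qbdE /= !gq_srcE bs.
- by elim/qind=> x; rewrite qbdE /= !gq_tgtE bt.
- elim/qind=> x; elim/qind=> y; rewrite /= !gq_srcE !gq_tgtE => e.
  by rewrite gq_addE // !qbdE gq_addE ?bs ?bt // ba.
- elim/qind=> x; elim/qind=> a; rewrite /= !gq_srcE !gq_tgtE => e.
  by rewrite qactE // !qbdE qactE ?bt // be.
Qed.

Lemma q_bdbd n (x : qgpd n.+2) : qbd (qbd x) = idn (tgt x).
Proof.
move: x.
by elim/qind=> x; rewrite !qbdE /= gq_tgtE cc_bdbd.
Qed.

Lemma q_triv n (x : qgpd n.+2) (y : qgpd 1) : tgt x = tgt y ->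
  qact x (qbd y) = x.
Proof.
move: x y.
elim/qind=> x; elim/qind=> y; rewrite /= !gq_tgtE => e.
have [bs _ _] := bd_functor C 0.
by rewrite qbdE qactE ?bs ?(action_loop (act_action C 0)) // cc_triv.
Qed.

Definition quotient : crossedComplex :=
  CrossedComplex q_crossed q_module q_equivariant q_bdbd q_triv.

Lemma qproj_idn n (x : gpd C n) : A n.+1 x -> qproj x = idn (tgt x) :> qgpd n.
Proof.
move=> Ax; have lx := td_loop (normal_td n) Ax.
apply/qprojP; rewrite src_idn tgt_idn; split=> //.
apply: (sub_add (normal_sub hA)) => //; last by rewrite src_opp tgt_idn.
apply: (sub_opp (normal_sub hA)); apply: (td_idn (normal_td n)).
Qed.

Definition quotient_morphism : morphism C quotient.
Proof.
exists (fun n => match n return cell C n -> cell quotient n with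
                 | 0 => id | m.+1 => @qproj m end).
- exact: qproj_functor.
- by move=> n x a e; rewrite /= qactE.
- by move=> n x; rewrite /= qbdE.
Defined.

End Quotient.

(** * Simplicial sets *)

(* [face i : K n.+1 -> K n] is meaningful for [i <= n.+1], and
   [degen i : K n -> K n.+1] for [i <= n]. *)
Record simplicialSet := SimplicialSet {
  simplex :> nat -> Type;
  face : forall n, nat -> simplex n.+1 -> simplex n;
  degen : forall n, nat -> simplex n -> simplex n.+1;
  face_face : forall n i j (x : simplex n.+2), i < j -> j <= n.+2 ->
    face i (face j x) = face j.-1 (face i x);
  degen_degen : forall n i j (x : simplex n), i <= j -> j <= n ->
    degen i (degen j x) = degen j.+1 (degen i x);
  face_degen_lt : forall n i j (x : simplex n.+1), i < j -> j <= n.+1 ->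
    face i (degen j x) = degen j.-1 (face i x);
  face_degen_eq : forall n j (x : simplex n), j <= n ->
    face j (degen j x) = x;
  face_degen_succ : forall n j (x : simplex n), j <= n ->
    face j.+1 (degen j x) = x;
  face_degen_gt : forall n i j (x : simplex n.+1), j.+1 < i -> i <= n.+2 ->
    face i (degen j x) = degen j (face i.-1 x)
}.

Definition nondegenerate (K : simplicialSet) (n : nat) : set (K n) :=
  match n with
  | 0 => setT
  | m.+1 => [set x | ~ exists i (y : K m), i <= m /\ x = degen i y]
  end.

Fixpoint last_vertex (K : simplicialSet) (n : nat) : K n -> K 0 :=
  match n with 0 => id | m.+1 => fun x => last_vertex (face 0 x) end.

Fixpoint last_edge (K : simplicialSet) (n : nat) : K n.+1 -> K 1 :=
  match n with 0 => id | m.+1 => fun x => last_edge (face 0 x) end.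

(** * The crossed complexes of a simplicial set *)

Definition signed (O : Type) (G : groupoid O) (m : nat) (x : G) : G :=
  if odd m then - x else x.

(* Models of the free crossed complex on [K] with the prescribed boundaries:
   freeness of [gen] determines it up to isomorphism. *)
Record PiUpsilon (K : simplicialSet) := MkPiUpsilon {
  PiUpsilon_complex :> crossedComplex;
  gen : forall n, K n -> cell PiUpsilon_complex n;
  gen_free : free_generators (fun n => [set: K n]) gen;
  gen_src1 : forall x : K 1,
    src (gen x : gpd PiUpsilon_complex 0) = gen (face 1 x);
  gen_tgt1 : forall x : K 1,
    tgt (gen x : gpd PiUpsilon_complex 0) = gen (face 0 x);
  gen_base : forall n (x : K n.+2),
    tgt (gen x : gpd PiUpsilon_complex n.+1) = gen (last_vertex x);
  gen_bd2 : forall x : K 2,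
    bd (gen x : gpd PiUpsilon_complex 1) =
    - gen (face 1 x) + gen (face 2 x) + gen (face 0 x);
  gen_bd3 : forall x : K 3,
    bd (gen x : gpd PiUpsilon_complex 2) =
    act (gen (face 3 x)) (gen (last_edge x))
      - gen (face 0 x) - gen (face 2 x) + gen (face 1 x);
  gen_bd : forall n (x : K n.+4),
    bd (gen x : gpd PiUpsilon_complex n.+3) =
    act (gen (face n.+4 x)) (gen (last_edge x))
      + \big[@add _ _/idn (gen (last_vertex x))]_(i < n.+4)
          signed (n.+4 - i) (gen (face i x))
}.

(* An auxiliary normal subcrossed complex, for [D_sub1]. *)
Definition kernel (C : crossedComplex) (n : nat) : set (cell C n) :=
  match n with
  | 1 => [set x : gpd C 0 | x = idn (tgt x)]
  | 2 => [set x : gpd C 1 | bd x = idn (tgt x)]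
  | _ => setT
  end.

Lemma kernel_normal (C : crossedComplex) : is_normal (@kernel C).
Proof.
have idnD (p : ob C) : idn p + idn p = idn p :> gpd C 0.
  by rewrite -{1}(src_idn (gpd C 0) p) add0.
have idnN (p : ob C) : - idn p = idn p :> gpd C 0.
  by apply/esym/opp_eq; rewrite ?src_idn ?tgt_idn.
have fb := bd_functor C 0; have [bs bt ba] := fb.
have [al at_ ai ac aa] := act_action C 0.
have idnC (c : gpd C 0) p : p = src c -> - c + idn p + c = idn (tgt c).
  move=> ->; rewrite -{1}(tgt_opp c) addr0; exact: addN.
split=> //=.
- split=> //=.
  + case=> [|[|n]] // p _ /=; first by rewrite tgt_idn.
    by rewrite (functor_idn fb) tgt_idn.
  + case=> [|[|n]] //= y z ey ez e.
      rewrite tgt_add // {1}ey {1}ez e.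
      have -> : src z = tgt z by rewrite ez src_idn tgt_idn.
      exact: idnD.
    by rewrite ba // ey ez tgt_add // e al idnD.
  + case=> [|[|n]] //= y ey; first by rewrite tgt_opp ey idnN src_idn.
    by rewrite (functor_opp fb) ey idnN tgt_opp al.
  + case=> [|n] //= y a ey ea e.
    by rewrite (crossed_act (cc_crossed C)) // ey idnC // at_.
  + case=> [|[|n]] //= y; first by rewrite bt.
    by rewrite cc_bdbd (functor_tgt (bd_functor C 1)).
- by move=> x ->; rewrite src_idn tgt_idn.
- move=> y c ey e; rewrite ey idnC //.
  by rewrite tgt_idn.
- case=> [|n] //= a x ea e.
  by rewrite (crossed_act (cc_crossed C)) // ea idnC // at_.
- case=> [|n] //= x a ea e.
  have ta : tgt x = tgt a by rewrite e ea src_idn tgt_idn.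
  by rewrite ea -ta ai addrN (functor_idn fb) tgt_idn.
Qed.

Section PiComplex.
Variables (K : simplicialSet) (P : PiUpsilon K).

Definition E0_gens n : set (cell P n) :=
  match n with
  | 0 => set0
  | m.+1 => [set gen P (degen 0 y) | y in [set: K m]]
  end.

Definition E0 : forall n, set (cell P n) := normal_closure E0_gens.
Arguments E0 : clear implicits.

Lemma E0_normal : is_normal E0.
Proof.
apply: normal_closureP => _ [y _ <-].
by rewrite gen_src1 gen_tgt1 face_degen_eq ?face_degen_succ.
Qed.

Definition Pi0N : crossedComplex := quotient E0_normal.

Definition gen0N n (x : K n) : cell Pi0N n :=
  quotient_morphism E0_normal n (gen P x).

Definition D_gens k n : set (cell Pi0N n) :=
  match n with
  | m.+2 => [set u | exists i (y : K m.+1),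
                       [/\ i <= k, i <= m.+1 & u = gen0N (degen i y)]]
  | _ => set0
  end.

(* By [D_sub1], [D k 1] consists only of identities. *)
Definition D k : forall n, set (cell Pi0N n) := normal_closure (@D_gens k).
Arguments D : clear implicits.

Lemma D_normal k : is_normal (D k).
Proof. exact: normal_closureP. Qed.

Lemma gen0N_degen0 n (y : K n) :
  (gen0N (degen 0 y) : gpd Pi0N n) = idn (tgt (gen P (degen 0 y) : gpd P n)).
Proof.
by apply: (qproj_idn E0_normal); apply: normal_closure_sub; exists y.
Qed.

Lemma gen0N_bd2 (x : K 2) :
  bd (gen0N x : gpd Pi0N 1) =
  - gen0N (face 1 x) + gen0N (face 2 x) + gen0N (face 0 x).
Proof.
have e1 : tgt (- (gen P (face 1 x) : gpd P 0)) = src (gen P (face 2 x) : gpd P 0).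
  by rewrite tgt_opp !gen_src1 (@face_face _ _ 1 2).
have e2 : tgt (gen P (face 2 x) : gpd P 0) = src (gen P (face 0 x) : gpd P 0).
  by rewrite gen_tgt1 gen_src1 face_face.
have fq := mor_functor (quotient_morphism E0_normal) 0.
rewrite /gen0N -(mor_bd (quotient_morphism E0_normal)) gen_bd2.
rewrite !(functor_add fq) ?(functor_opp fq) // tgt_add //.
Qed.

Lemma D_sub1 k (x : gpd Pi0N 0) : D k 1 x -> x = idn (tgt x).
Proof.
move=> /(_ _ (kernel_normal Pi0N)); apply=> -[//|[//|[|//]]].
move=> _ [i [y [_ ile ->]]]; have fb := bd_functor Pi0N 0.
have tq n (z : K n.+1) :
    tgt (gen0N z : gpd Pi0N n) = tgt (gen P z : gpd P n).
  exact: functor_tgt (mor_functor (quotient_morphism E0_normal) n) _.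
case: i ile => [|[|//]] _.
  change (bd (gen0N (degen 0 y) : gpd Pi0N 1) =
          idn (tgt (gen0N (degen 0 y) : gpd Pi0N 1))).
  by rewrite gen0N_degen0 (functor_idn fb) tgt_idn.
change (bd (gen0N (degen 1 y) : gpd Pi0N 1) =
        idn (tgt (gen0N (degen 1 y) : gpd Pi0N 1))).
rewrite gen0N_bd2 tq gen_base (face_degen_eq (j := 1)) //.
rewrite (face_degen_succ (j := 1)) // /last_vertex face_degen_lt //.
rewrite face_degen_eq // gen0N_degen0 addN tq !gen_tgt1 face_degen_eq //.
by rewrite -{1}(src_idn (gpd Pi0N 0) (gen P (face 0 y))) add0.
Qed.

Definition DK n : set (cell Pi0N n) := \bigcup_k D k n.
Arguments DK : clear implicits.

Lemma D_mono k l n : k <= l -> D k n `<=` D l n.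
Proof.
move=> kl x xD A hA sA; apply: xD => // -[//|[//|m]] u [i [y [ik im ->]]].
by apply: sA; exists i, y; split=> //; apply: leq_trans kl.
Qed.

Lemma DK_normal : is_normal DK.
Proof.
split; first split.
- by move=> n x [k _ h]; exists k => //; apply: (sub_src (normal_sub (D_normal k)) h).
- by move=> n x [k _ h]; exists k => //; apply: (sub_tgt (normal_sub (D_normal k)) h).
- by move=> n p [k _ h]; exists k => //; apply: (sub_idn (normal_sub (D_normal k)) n h).
- move=> n x y [k _ hx] [l _ hy] e; exists (maxn k l) => //.
  apply: (sub_add (normal_sub (D_normal _))) => //.
    exact: (D_mono (leq_maxl k l)).
  exact: (D_mono (leq_maxr k l)).
- by move=> n x [k _ h]; exists k => //; apply: (sub_opp (normal_sub (D_normal k)) h).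
- move=> n x a [k _ hx] [l _ hy] e; exists (maxn k l) => //.
  apply: (sub_act (normal_sub (D_normal _))) => //.
    exact: (D_mono (leq_maxl k l)).
  exact: (D_mono (leq_maxr k l)).
- by move=> n x [k _ h]; exists k => //; apply: (sub_bd (normal_sub (D_normal k)) h).
- by apply/seteqP; split=> // p _; exists 0 => //; rewrite (normal_ob (D_normal 0)).
- by move=> x [k _ h]; apply: (normal_loop (D_normal k) h).
- by move=> x c [k _ h] e; exists k => //; apply: (normal_conj (D_normal k)).
- by move=> n a x [k _ h] e; exists k => //; apply: (normal_act (D_normal k)).
- by move=> n x a [k _ h] e; exists k => //; apply: (normal_diff (D_normal k)).
Qed.

Definition Pi : crossedComplex := quotient DK_normal.

Definition Pi_proj : morphism P Pi :=
  morphism_comp (quotient_morphism DK_normal) (quotient_morphism E0_normal).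

End PiComplex.

(* Main.v *)
(* Let [A] be the normal subcrossed complex of [P] generated by all degenerate
   generators; it is the kernel of [Pi_proj P].  It is filtered by the [G k],
   generated by the [eps_i y] with [i < k].  Let [h] be the map of degree one,
   defined on the free generators, that sends [x = eps_k z] of dimension [n],
   with [k] minimal, to [(-1)^(n - k) eps_k x], and nondegenerate generators to
   identities.  Then [1 + h bd + bd h] is an endomorphism of [P] that maps
   [G (k + 1)] into [G k], so every cycle of [A] bounds in [A].

   Acyclicity of [A] allows one to choose, by recursion on the dimension, a map
   [H : P -> A] of degree one for which [r = 1 + H bd + bd H] is trivial on the
   degenerate generators.  Then [r] factors through [Pi_proj P], which gives the
   section [q], and [H] is a homotopy [q p ~ 1].

   For the freeness of [Pi P], a map prescribed on the nondegenerate generators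
   is extended to [P] by identities on the degenerate ones.  It kills [A], since
   the boundary of a degenerate generator consists of degenerate generators and
   of a pair that cancels up to the action of a degenerate edge. *)

From HB Require Import structures.
Require Import Defs.
From mathcomp Require Import all_boot ssralg.
From mathcomp Require Import boolp classical_sets.

Set Implicit Arguments.
Unset Strict Implicit.
Unset Printing Implicit Defensive.

Local Open Scope classical_set_scope.
Local Open Scope gpd_scope.

(** The sign of [h] is forced. If [x = eps_k z] has dimension [n], faces [k] and [k + 1] of
    [eps_k x] are both [x] and cancel, while face [k + 2] is again [x], with sign
    [(-1)^(n - k - 1)]; so [bd h x] contributes [- x]. Faces below [k] are degenerate of smaller
    index, and those above [k + 2] cancel against [h bd x]. For [k = n - 1] face [k + 2] is the top
    one and carries the action of the last edge, which is then degenerate.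

    Two obstacles shape the rest. [P] is not abelian in dimensions one and two, where [h] is at
    first only a derivation, and freeness provides only functors, morphisms of crossed modules and
    maps of modules over the fundamental groupoid; derivations and linear maps out of dimension two
    must be encoded as such. And a generated normal subcrossed complex is an intersection taken over
    all dimensions at once, so a property of its elements in one dimension must be completed to a
    normal subcrossed complex, at the price of a condition on boundaries from the next dimension. *)

Ltac gside := repeat first
  [ rewrite src_idn | rewrite tgt_idn | rewrite src_opp | rewrite tgt_opp
  | match goal with |- context [src (add ?x ?y)] =>
      rewrite (@src_add _ _ x y); [|by gside] end
  | match goal with |- context [tgt (add ?x ?y)] =>
      rewrite (@tgt_add _ _ x y); [|by gside] end ];
  try congruence.

(** * Groupoids cut out of a type by a predicate *)

Section SubGroupoid.
Variables (O T : Type) (Q : T -> Prop).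
Variables (s t : T -> O) (e : O -> T) (a : T -> T -> T) (o : T -> T).

(** Groupoid axioms relative to [Q]. They serve for the semidirect product, for related pairs and
    for the vertex groups of a module. *)
Record groupoid_on : Prop := GroupoidOn {
  on_idn : forall p, [/\ Q (e p), s (e p) = p & t (e p) = p];
  on_add : forall x y, Q x -> Q y -> t x = s y ->
    [/\ Q (a x y), s (a x y) = s x & t (a x y) = t y];
  on_opp : forall x, Q x -> [/\ Q (o x), s (o x) = t x & t (o x) = s x];
  on_addA : forall x y z, Q x -> Q y -> Q z -> t x = s y -> t y = s z ->
    a x (a y z) = a (a x y) z;
  on_add0 : forall x, Q x -> a (e (s x)) x = x /\ a x (e (t x)) = x;
  on_addN : forall x, Q x -> a (o x) x = e (t x) /\ a x (o x) = e (s x)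
}.

(* Total, with value [d] outside [Q]: the operations of a groupoid are total but
   need only preserve [Q] where they are meaningful. *)
Definition restrict (d : sig Q) (x : T) : sig Q :=
  if pselect (Q x) is left h then exist Q x h else d.

Lemma restrictE d x : Q x -> sval (restrict d x) = x.
Proof. by rewrite /restrict; case: pselect. Qed.

Lemma sval_inj (x y : sig Q) : sval x = sval y -> x = y.
Proof.
case: x y => [x hx] [y hy] /= xy; subst y.
by rewrite (Prop_irrelevance hx hy).
Qed.

Hypothesis G : groupoid_on.

Definition restrict_idn p : sig Q :=
  exist Q (e p) (let: And3 h _ _ := on_idn G p in h).
Definition restrict_add (x y : sig Q) : sig Q :=
  restrict x (a (sval x) (sval y)).
Definition restrict_opp (x : sig Q) : sig Q := restrict x (o (sval x)).

Lemma restrict_addE x y : t (sval x) = s (sval y) ->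
  sval (restrict_add x y) = a (sval x) (sval y).
Proof.
move=> h; apply: restrictE.
by have [] := on_add G (svalP x) (svalP y) h.
Qed.

Lemma restrict_oppE x : sval (restrict_opp x) = o (sval x).
Proof. by apply: restrictE; have [] := on_opp G (svalP x). Qed.

#[local] Obligation Tactic := idtac.

Program Definition sub_groupoid : groupoid O :=
  @Groupoid O (sig Q) (fun x => s (sval x)) (fun x => t (sval x))
    restrict_idn restrict_add restrict_opp _ _ _ _ _ _ _ _ _ _ _.
Next Obligation. by move=> p; have [] := on_idn G p. Qed.
Next Obligation. by move=> p; have [] := on_idn G p. Qed.
Next Obligation.
move=> x y /= h; rewrite restrict_addE //.
by have [] := on_add G (svalP x) (svalP y) h.
Qed.
Next Obligation.
move=> x y /= h; rewrite restrict_addE //.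
by have [] := on_add G (svalP x) (svalP y) h.
Qed.
Next Obligation. by move=> x /=; rewrite restrict_oppE;
  have [] := on_opp G (svalP x). Qed.
Next Obligation. by move=> x /=; rewrite restrict_oppE;
  have [] := on_opp G (svalP x). Qed.
Next Obligation.
move=> x y z /= h h'; apply: sval_inj.
have [_ s1 _] := on_add G (svalP y) (svalP z) h'.
have [_ _ t1] := on_add G (svalP x) (svalP y) h.
rewrite !restrict_addE //; try by rewrite ?s1 ?t1.
by apply: on_addA => //; apply: svalP.
Qed.
Next Obligation.
move=> x; apply: sval_inj => /=; have [_ _ h] := on_idn G (s (sval x)).
by rewrite restrict_addE //; have [] := on_add0 G (svalP x).
Qed.
Next Obligation.
move=> x; apply: sval_inj => /=; have [_ h _] := on_idn G (t (sval x)).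
by rewrite restrict_addE //; have [] := on_add0 G (svalP x).
Qed.
Next Obligation.
move=> x; apply: sval_inj => /=; have [_ _ h] := on_opp G (svalP x).
by rewrite restrict_addE restrict_oppE //; have [] := on_addN G (svalP x).
Qed.
Next Obligation.
move=> x; apply: sval_inj => /=; have [_ h _] := on_opp G (svalP x).
by rewrite restrict_addE restrict_oppE //; have [] := on_addN G (svalP x).
Qed.

Lemma restrict_groupoid_addE (x y : sub_groupoid) : tgt x = src y ->
  sval (x + y) = a (sval x) (sval y).
Proof. exact: restrict_addE. Qed.

Lemma restrict_groupoid_oppE (x : sub_groupoid) : sval (- x) = o (sval x).
Proof. exact: restrict_oppE. Qed.

End SubGroupoid.

(** * Consequences of the axioms of an action *)

Section ActionTheory.
Variables (O : Type) (G M : groupoid O) (am : M -> G -> M).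
Hypothesis ha : is_action am.
Implicit Types (x : M) (a : G).

Lemma loop x : src x = tgt x. Proof. exact: (action_loop ha). Qed.

Lemma src_action x a : tgt x = src a -> src (am x a) = tgt a.
Proof. by move=> e; rewrite loop (action_tgt ha). Qed.

Lemma action_idm p a : p = src a -> am (idn p) a = idn (tgt a).
Proof.
move=> e; have e' : tgt (idn p : M) = src a by rewrite tgt_idn.
rewrite -(action_tgt ha e'); apply: idn_idem; last exact: loop.
rewrite -(action_add ha) //.
by rewrite -{1}(src_idn M p) add0.
Qed.

Lemma action_opp x a : tgt x = src a -> am (- x) a = - am x a.
Proof.
move=> e; have e' : tgt (- x) = src a by rewrite tgt_opp loop.
apply: opp_eq; rewrite ?src_action ?(action_tgt ha) //.
by rewrite -(action_add ha) ?tgt_opp ?loop // addrN action_idm ?loop.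
Qed.

Lemma actionK x a : tgt x = src a -> am (am x a) (- a) = x.
Proof.
move=> e; rewrite -(action_comp ha) ?src_opp // addrN -e.
exact: (action_idn ha).
Qed.

End ActionTheory.

(** * Derivations and linear maps on free generators *)

(* Derivations [G -> M] are the functors into the semidirect product of [G] and
   [M] that are the identity on the first component. *)
Section Semidirect.
Variables (O : Type) (G M : groupoid O) (am : M -> G -> M).
Hypothesis ha : is_action am.

Definition sd_groupoid_on :
  @groupoid_on O (G * M) (fun x => tgt x.2 = tgt x.1)
    (fun x => src x.1) (fun x => tgt x.1) (fun p => (idn p, idn p))
    (fun x y => (x.1 + y.1, am x.2 y.1 + y.2))
    (fun x => (- x.1, - am x.2 (- x.1))).
Proof.
have L := loop ha; have T := action_tgt ha; have S := src_action ha.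
split=> /=.
- by move=> p; rewrite !src_idn !tgt_idn.
- move=> [c m] [d n] /= em en e; rewrite src_add // !tgt_add //.
  by rewrite L T //; congruence.
- move=> [c m] /= em.
  by rewrite tgt_opp !src_opp !tgt_opp S ?tgt_opp ?src_opp.
- move=> [c m] [d n] [f k] /= em en ek e e'; rewrite addA //; congr pair.
  have e1 : tgt m = src d by congruence.
  have e2 : tgt n = src f by congruence.
  have e3 : tgt (am m d) = src n by rewrite L T //; congruence.
  rewrite (action_comp ha) // (action_add ha) ?T // -?en //.
  by rewrite addA // ?L ?T // ?T //; congruence.
- move=> [c m] /= em; split; congr pair; rewrite ?add0 ?addr0 //.
    by rewrite (action_idm ha) // -em -L add0.
  by rewrite -em (action_idn ha) addr0.
- move=> [c m] /= em; split; congr pair; rewrite ?addN ?addrN //.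
    rewrite (action_opp ha) ?T ?src_opp ?tgt_opp //.
    by rewrite -{2}(oppK c) (actionK ha) ?src_opp ?addN ?em.
  by rewrite S ?src_opp // tgt_opp.
Qed.

Definition semidirect : groupoid O := sub_groupoid sd_groupoid_on.

End Semidirect.

Record is_derivation (O : Type) (G M : groupoid O) (am : M -> G -> M)
    (h : G -> M) : Prop := IsDerivation {
  derivation_tgt : forall x, tgt (h x) = tgt x;
  derivation_add : forall x y, tgt x = src y -> h (x + y) = am (h x) y + h y
}.

Section DerivationExtension.
Variables (O : Type) (G M : groupoid O) (am : M -> G -> M) (R : set G).
Hypotheses (ha : is_action am) (hR : free_groupoid R).

Let sd (c : G) (m : M) : semidirect ha :=
  restrict (restrict_idn (sd_groupoid_on ha) (tgt c)) (c, m).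

Let sdE c m : tgt m = tgt c -> sval (sd c m) = (c, m).
Proof. exact: restrictE. Qed.

Let derivation_functor h : is_derivation am h ->
  is_functor (H := semidirect ha) id (fun x => sd x (h x)).
Proof.
case=> ht hD; split=> /= [x|x|x y e]; rewrite ?sdE //.
apply: sval_inj; rewrite restrict_groupoid_addE ?sdE //= ?sdE //.
by rewrite hD.
Qed.

Lemma derivation_unique h h' : is_derivation am h -> is_derivation am h' ->
  (forall r, R r -> h r = h' r) -> h =1 h'.
Proof.
move=> dh dh' hh' x.
have [|_ u] := hR (H := semidirect ha) (F0 := id) (phi := fun x => sd x (h x)).
  by move=> r _ /=; rewrite sdE ?(derivation_tgt dh).
have /(_ x)/(congr1 sval) : (fun x => sd x (h x)) =1 (fun x => sd x (h' x)).
  by apply: u; split=> [|r /hh' ->] //; apply: derivation_functor.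
rewrite !sdE ?(derivation_tgt dh) ?(derivation_tgt dh') //.
by case.
Qed.

Lemma derivation_extension (phi : G -> M) :
  (forall r, R r -> tgt (phi r) = tgt r) ->
  exists h, is_derivation am h /\ forall r, R r -> h r = phi r.
Proof.
move=> hphi.
have [|[F [[Fs Ft Fa] FR]] _] :=
    hR (H := semidirect ha) (F0 := id) (phi := fun x => sd x (phi x)).
  by move=> r /hphi h /=; rewrite sdE.
(* The first component is an endofunctor fixing the free generators, hence the identity by
   uniqueness. *)
have F1 x : (sval (F x)).1 = x.
  have [|_ u] := hR (H := G) (F0 := id) (phi := id); first by [].
  apply: (u (fun x => (sval (F x)).1) id); split=> //.
    split=> [y|y|y z e]; [exact: Fs|exact: Ft|].
    by rewrite Fa // restrict_groupoid_addE // Ft Fs.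
  by move=> r rR; rewrite FR // sdE // hphi.
exists (fun x => (sval (F x)).2); split; last first.
  by move=> r rR; rewrite FR // sdE // hphi.
split=> [x|x y e]; first by rewrite (svalP (F x)) F1.
by rewrite Fa // restrict_groupoid_addE ?Ft ?Fs //= F1.
Qed.

End DerivationExtension.

(** * Groupoids of related pairs and actions on them *)

Section PairGroupoid.
Variables (O : Type) (M N : groupoid O) (R : M -> N -> Prop).

Record is_congruence : Prop := IsCongruence {
  congruence_src : forall x y, R x y -> src x = src y;
  congruence_tgt : forall x y, R x y -> tgt x = tgt y;
  congruence_idn : forall p, R (idn p) (idn p);
  congruence_add : forall x y x' y', R x y -> R x' y' -> tgt x = src x' ->
    R (x + x') (y + y');
  congruence_opp : forall x y, R x y -> R (- x) (- y)
}.

Hypothesis hR : is_congruence.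

Definition pair_groupoid_on :
  @groupoid_on O (M * N) (fun x => R x.1 x.2)
    (fun x => src x.1) (fun x => tgt x.1) (fun p => (idn p, idn p))
    (fun x y => (x.1 + y.1, x.2 + y.2)) (fun x => (- x.1, - x.2)).
Proof.
case: hR => S T I A N'; split=> /=.
- by move=> p; rewrite src_idn tgt_idn.
- by move=> [x y] [x' y'] /= r r' e; rewrite src_add // tgt_add //; split=> //;
    apply: A.
- by move=> [x y] /= r; rewrite src_opp tgt_opp; split=> //; apply: N'.
- move=> [x y] [x' y'] [x'' y''] /= r r' r'' e e'.
  have [e1 e2] : tgt y = src y' /\ tgt y' = src y''.
    by rewrite -!(S _ _ r', S _ _ r'', T _ _ r, T _ _ r').
  by rewrite !addA.
- move=> [x y] /= r; rewrite add0 addr0; split; congr pair.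
    by rewrite (S _ _ r) add0.
  by rewrite (T _ _ r) addr0.
- move=> [x y] /= r; rewrite addN addrN; split; congr pair.
    by rewrite (T _ _ r) addN.
  by rewrite (S _ _ r) addrN.
Qed.

Definition pair_groupoid : groupoid O := sub_groupoid pair_groupoid_on.

End PairGroupoid.

Section PairAction.
Variables (O : Type) (G M N : groupoid O) (R : M -> N -> Prop).
Hypothesis hR : is_congruence R.
Variables (am : M -> G -> M) (an : N -> G -> N).
Hypotheses (ham : is_action am) (han : is_action an).
Hypothesis Ract : forall x y a, R x y -> tgt x = src a -> R (am x a) (an y a).

Definition pair_act (x : pair_groupoid hR) (a : G) : pair_groupoid hR :=
  restrict x (am (sval x).1 a, an (sval x).2 a).

Lemma pair_actE x a : tgt x = src a ->
  sval (pair_act x a) = (am (sval x).1 a, an (sval x).2 a).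
Proof. by move=> e; apply: restrictE; apply: Ract => //; apply: (svalP x). Qed.

Lemma pair_tgt2 (x : pair_groupoid hR) : tgt (sval x).2 = tgt x.
Proof. exact/esym/(congruence_tgt hR (svalP x)). Qed.

Lemma pair_action : is_action pair_act.
Proof.
split.
- by move=> x; apply: (action_loop ham).
- by move=> x a e; rewrite [LHS]/= pair_actE //= (action_tgt ham).
- move=> x; apply: sval_inj; rewrite pair_actE ?src_idn //= (action_idn ham).
  by rewrite -[tgt _]/(tgt x) -(pair_tgt2 x) (action_idn han); case: (sval x).
- move=> x a b e e'; apply: sval_inj.
  rewrite !pair_actE ?src_add ?e //=; last first.
    by rewrite pair_actE //= (action_tgt ham).
  by rewrite (action_comp ham) // (action_comp han) // pair_tgt2.
- move=> x y a e e'; apply: sval_inj.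
  have ly : src y = tgt y by apply: (action_loop ham).
  have exy : tgt x = src y by rewrite ly.
  have ey : tgt y = src a by rewrite -e.
  have lya : src (pair_act y a) = tgt (pair_act y a) by apply:
    (action_loop ham).
  rewrite pair_actE; last by rewrite tgt_add.
  rewrite !restrict_groupoid_addE ?pair_actE //=.
    rewrite (action_add ham) // (action_add han) ?pair_tgt2 //.
  by rewrite !pair_actE //= (action_loop ham) !(action_tgt ham).
Qed.

End PairAction.

(* A map [M -> N] to a module is not a morphism of crossed modules; its graph,
   in the crossed module of the pairs related by [Q], is one. *)
Section CrossedExtension.
Variables (O : Type) (G M N : groupoid O) (am : M -> G -> M) (mu : M -> G).
Variables (R : set M) (an : N -> G -> N) (Q : M -> N -> Prop).
Hypotheses (hM : is_crossed_module am mu) (hR : free_crossed_module am mu R).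
Hypotheses (han : is_action an) (hQ : is_congruence Q).
Hypothesis Qact : forall x y a, Q x y -> tgt x = src a -> Q (am x a) (an y a).
(** The boundary of a pair is that of its first component, so this is the second component of the
    Peiffer identity for pairs. *)
Hypothesis Qpeiffer : forall x y x' y', Q x y -> Q x' y' -> tgt x = tgt x' ->
  - y' + y + y' = an y (mu x').

Let P := pair_groupoid hQ.
Let actP : P -> G -> P := @pair_act _ _ _ _ _ hQ am an.
Let muP (x : P) : G := mu (sval x).1.
Let ham := crossed_action hM.

Let pair_crossed : is_crossed_module actP muP.
Proof.
have [ms mt ma] := crossed_functor hM.
split; first exact: pair_action.
- split=> [x|x|x y e]; [exact: ms|exact: mt|].
  by rewrite /muP restrict_groupoid_addE //= ma.
- by move=> x a e; rewrite /muP /actP pair_actE //= (crossed_act hM).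
- move=> x y e; apply: sval_inj.
  have lx : src x = tgt x by apply: (action_loop ham).
  have ly : src y = tgt y by apply: (action_loop ham).
  have e1 : tgt (- y) = src x by rewrite tgt_opp lx ly.
  have e2 : tgt (- y + x) = src y by rewrite tgt_add // e ly.
  have e3 : tgt x = src (muP y) by rewrite e -ly; apply/esym/ms.
  rewrite /actP pair_actE // (restrict_groupoid_addE e2) /=.
  rewrite (restrict_groupoid_addE e1) (restrict_groupoid_oppE y) /=.
  by rewrite (crossed_peiffer hM) // (Qpeiffer (svalP x) (svalP y) e).
Qed.

Let pr (x : M) (y : N) : P :=
  restrict (restrict_idn (pair_groupoid_on hQ) (tgt x)) (x, y).

Let prE x y : Q x y -> sval (pr x y) = (x, y).
Proof. exact: restrictE. Qed.

Let pair_equivariant F : is_equivariant am an F -> (forall x, Q x (F x)) ->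
  is_equivariant am actP (fun x => pr x (F x)).
Proof.
case=> [[Fs Ft Fa] Fc] FQ; split; first split.
- by move=> x; rewrite /= prE.
- by move=> x; rewrite /= prE.
- move=> x y e; apply: sval_inj;
    rewrite restrict_groupoid_addE ?prE //= ?prE //.
  by rewrite Fa.
- move=> x a e; apply: sval_inj.
  by rewrite /actP pair_actE ?prE //= ?prE // Fc.
Qed.

Lemma crossed_unique F F' :
  is_equivariant am an F -> (forall x, Q x (F x)) ->
  is_equivariant am an F' -> (forall x, Q x (F' x)) ->
  (forall r, R r -> F r = F' r) -> F =1 F'.
Proof.
move=> hF FQ hF' FQ' FF' x.
have [|_ u] := hR pair_crossed (phi := fun x => pr x (F x)).
  by move=> r _; rewrite /muP /= prE.
have /(_ x)/(congr1 sval) : (fun x => pr x (F x)) =1 (fun x => pr x (F' x)).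
  apply: u; split.
  - exact: pair_equivariant.
  - by move=> y; rewrite /muP prE.
  - by [].
  - exact: pair_equivariant.
  - by move=> y; rewrite /muP prE.
  - by move=> r /FF' ->.
by rewrite !prE //; case.
Qed.

Lemma crossed_extension (phi : M -> N) : (forall r, R r -> Q r (phi r)) ->
  exists F, [/\ is_equivariant am an F, forall x, Q x (F x)
              & forall r, R r -> F r = phi r].
Proof.
move=> hphi.
have [|[F [[[Fs Ft Fa] Fc] Fmu FR]] _] :=
  hR pair_crossed (phi := fun x => pr x (phi x)).
  by move=> r /hphi h; rewrite /muP /= prE.
(* As for derivations, the first component is an endomorphism of the free crossed module fixing
   [R]. *)
have F1 x : (sval (F x)).1 = x.
  have [//|_ u] := hR hM (phi := id).
  apply: (u (fun x => (sval (F x)).1) id); split=> //.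
    split=> [|y a e]; last by rewrite Fc // /actP pair_actE // Ft.
    split=> [y|y|y z e]; [exact: Fs|exact: Ft|].
    by rewrite Fa // restrict_groupoid_addE // Ft Fs.
  by move=> r rR; rewrite FR // prE //; apply: hphi.
have FQ x : Q x (sval (F x)).2 by rewrite -{1}(F1 x); apply: (svalP (F x)).
exists (fun x => (sval (F x)).2); split=> //; last first.
  by move=> r rR; rewrite FR // prE //; apply: hphi.
split=> [|x a e]; last by rewrite Fc // /actP pair_actE // Ft.
split=> [x|x|x y e].
- by rewrite -(congruence_src hQ (FQ x)).
- by rewrite -(congruence_tgt hQ (FQ x)).
- by rewrite Fa // restrict_groupoid_addE // Ft Fs.
Qed.

End CrossedExtension.

(* A module over [pi1 C], presented by the action of [gpd C 0]. *)
Record is_pi1_module (C : crossedComplex) (N : groupoid (ob C))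
    (an : N -> gpd C 0 -> N) : Prop := IsPi1Module {
  pi1_module_module : is_module an;
  pi1_module_triv : forall x (y : gpd C 1), tgt x = tgt y -> an x (bd y) = x
}.

Lemma cc_pi1_module (C : crossedComplex) n : is_pi1_module (@act C n.+1).
Proof. by split; [apply: cc_module|apply: cc_triv]. Qed.

Section Pi1Module.
Variables (C : crossedComplex) (N : groupoid (ob C)) (an : N -> gpd C 0 -> N).
Hypothesis hN : is_pi1_module an.
Let han : is_action an := module_action (pi1_module_module hN).

Definition induced_act (x : N) (a : pi1 C) : N := an x (grepr a).

Lemma induced_actE x (a : gpd C 0) : tgt x = src a ->
  induced_act x (gproj (bd_range_normal C) a) = an x a.
Proof.
move=> e; rewrite /induced_act.
(* The chosen representative of the class of [a] is [bd y + a] for some [y], and [bd y] acts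
   trivially. *)
have [s t [y _ yE]] := grepr_proj (bd_range_normal C) a.
move: (grepr _) s t yE => b s t yE.
have [bs bt _] := bd_functor C 0.
have ey : tgt x = tgt y.
  by rewrite e -bt yE tgt_add ?tgt_opp // src_opp.
have -> : b = bd y + a by rewrite yE addrNK.
have ly : src y = tgt y := action_loop (act_action C 0) y.
by rewrite (action_comp han) ?(pi1_module_triv hN) // ?bs ?bt ?ly -?ey.
Qed.

Lemma induced_module : is_module induced_act.
Proof.
split; last exact: (module_comm (pi1_module_module hN)).
split.
- exact: (action_loop han).
- move=> x; elim/gq_ind=> a /=; rewrite gq_srcE gq_tgtE => e.
  by rewrite induced_actE // (action_tgt han).
- move=> x; rewrite [idn _]/(gproj _ _) induced_actE ?src_idn //.
  exact: (action_idn han).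
- move=> x; elim/gq_ind=> a; elim/gq_ind=> b /=.
  rewrite !gq_srcE !gq_tgtE => e e'.
  rewrite gq_addE // !induced_actE ?src_add ?(action_tgt han) //.
  exact: (action_comp han).
- move=> x y; elim/gq_ind=> a /=; rewrite gq_srcE => e e'.
  have ey : tgt y = src a by rewrite -e.
  have exy : tgt (x + y) = src a by rewrite tgt_add // (loop han).
  by rewrite !induced_actE // (action_add han).
Qed.

Lemma induced_equivariant n (F : gpd C n.+2 -> N) :
  is_equivariant (@act C n.+1) an F <->
  is_equivariant (@pi1_act C n) induced_act F.
Proof.
split=> -[Ff Fa]; split=> // x a e; first exact: Fa.
by rewrite -pi1_actE // Fa ?induced_actE //= ?(functor_tgt Ff) // gq_srcE.
Qed.

End Pi1Module.

Section LinearExtension.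
Variables (C : crossedComplex) (R : forall n, set (cell C n)).
Arguments R : clear implicits.
Hypothesis hR : free_crossed_complex R.
Variables (N : groupoid (ob C)) (an : N -> gpd C 0 -> N).
Hypothesis hN : is_pi1_module an.
Let han : is_action an := module_action (pi1_module_module hN).

Let Q (x : gpd C 1) (y : N) := tgt x = tgt y.

Let Q_congruence : is_congruence Q.
Proof.
have L := loop han; have L' := loop (act_action C 0).
split; rewrite /Q.
- by move=> x y; rewrite L L'.
- by [].
- by move=> p; rewrite !tgt_idn.
- by move=> x y x' y' e e' e''; rewrite !tgt_add // L; congruence.
- by move=> x y; rewrite !tgt_opp L L'.
Qed.

Let Q_act x y a : Q x y -> tgt x = src a -> Q (act x a) (an y a).
Proof.
rewrite /Q => e e'.
by rewrite (action_tgt (act_action C 0)) // (action_tgt han) // -e.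
Qed.

(** Both sides equal [y]: conjugation is trivial in an abelian group, and boundaries act trivially
    on [N]. So relating cells with the same base point is enough. *)
Let Q_peiffer x y x' y' : Q x y -> Q x' y' -> tgt x = tgt x' ->
  - y' + y + y' = an y (bd x').
Proof.
rewrite /Q => e e' e''; have L := loop han.
have ey : tgt y = tgt y' by congruence.
rewrite (pi1_module_triv hN) -?e //.
rewrite -addA ?tgt_opp ?L //.
rewrite (module_comm (pi1_module_module hN) ey) addA ?src_opp ?tgt_opp ?L //.
by rewrite addN -ey -L add0.
Qed.

(** Dimension two uses the crossed module of pairs, the higher dimensions use freeness over [pi1 C].
    From here on the two cases have the same form. *)
Lemma linear_unique n (F F' : gpd C n.+1 -> N) :
  is_equivariant (@act C n) an F -> is_equivariant (@act C n) an F' ->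
  (forall r, R n.+2 r -> F r = F' r) -> F =1 F'.
Proof.
case: hR => _ _ h2 h3 hF hF' FF'.
case: n F F' hF hF' FF' => [|n] F F' hF hF' FF'.
  have Ft := functor_tgt (equivariant_functor hF).
  have Ft' := functor_tgt (equivariant_functor hF').
  exact: (crossed_unique (cc_crossed C) h2 han Q_congruence Q_act Q_peiffer
    hF (fun x => esym (Ft x)) hF' (fun x => esym (Ft' x)) FF').
have [r _|_ u] := h3 n N _ (induced_module hN) F.
  exact: (functor_tgt (equivariant_functor hF)).
by apply: u; split=> [|r /FF'] //; apply/induced_equivariant.
Qed.

Lemma linear_extension n (phi : gpd C n.+1 -> N) :
  (forall r, R n.+2 r -> tgt (phi r) = tgt r) ->
  exists F, is_equivariant (@act C n) an F /\
    forall r, R n.+2 r -> F r = phi r.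
Proof.
case: hR => _ _ h2 h3.
case: n phi => [|n] phi hphi.
  have [|F [hF _ FR]] := crossed_extension (cc_crossed C) h2 han Q_congruence
    Q_act Q_peiffer (phi := phi); first by move=> r /hphi.
  by exists F.
have [//|[F [hF FR]] _] := h3 n N _ (induced_module hN) phi.
by exists F; split=> //; apply/induced_equivariant.
Qed.

End LinearExtension.

(** * Endomorphisms [1 + h bd + bd h] *)

Lemma bd_src (C : crossedComplex) n (x : gpd C n.+1) : src (bd x) = tgt x.
Proof. by rewrite (functor_src (bd_functor C n)) (loop (act_action C n)). Qed.

Lemma bd_tgt (C : crossedComplex) n (x : gpd C n.+1) : tgt (bd x) = tgt x.
Proof. exact: (functor_tgt (bd_functor C n)). Qed.

Lemma bd_add (C : crossedComplex) n (x y : gpd C n.+1) : tgt x = tgt y ->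
  bd (x + y) = bd x + bd y.
Proof.
by move=> e; rewrite (functor_add (bd_functor C n)) // (loop (act_action C n)).
Qed.

Lemma bd_opp (C : crossedComplex) n (x : gpd C n.+1) : bd (- x) = - bd x.
Proof. exact: (functor_opp (bd_functor C n)). Qed.

Lemma bd_idn (C : crossedComplex) n p : bd (idn p : gpd C n.+1) = idn p.
Proof. exact: (functor_idn (bd_functor C n)). Qed.

Section Deformation.
Variables (C : crossedComplex) (h : forall n, cell C n -> gpd C n).
Arguments h : clear implicits.

(** The conditions on a homotopy ending at the identity morphism and stationary on objects; [deform]
    is what the homotopy formulas then give for its other end. *)
Record is_deformation : Prop := IsDeformation {
  deformation0 : forall p : ob C, h 0 p = idn p;
  deformation1 : is_derivation (@act C 0) (h 1);
  deformation2 : forall n, is_equivariant (@act C n) (@act C n.+1) (h n.+2)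
}.

Definition deform n : cell C n -> cell C n :=
  match n return cell C n -> cell C n with
  | 0 => id
  | 1 => fun x : gpd C 0 => x + bd (h 1 x)
  | m.+2 => fun x : gpd C m.+1 => x + h m.+1 (bd x) + bd (h m.+2 x)
  end.
Arguments deform : clear implicits.

Lemma deformS n (x : gpd C n.+1) :
  deform n.+2 x = x + h n.+1 (bd x) + bd (h n.+2 x) :> gpd C n.+1.
Proof. by []. Qed.

Hypothesis hh : is_deformation.

Let h1t x : tgt (h 1 x) = tgt x.
Proof. exact: derivation_tgt (deformation1 hh) x. Qed.

Lemma deformation_tgt n (x : gpd C n) : tgt (h n.+1 x) = tgt x.
Proof.
case: n x => [|n] x; first exact: h1t.
exact: (functor_tgt (equivariant_functor (deformation2 hh n))).
Qed.

Let L n (x : gpd C n.+1) : src x = tgt x.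
Proof. exact: loop (act_action C n) x. Qed.

Lemma deformation_idn n p : h n.+1 (idn p) = idn p.
Proof.
case: n => [|n]; last exact:
  (functor_idn (equivariant_functor (deformation2 hh n))).
have [ht hD] := deformation1 hh.
have e : tgt (idn p : gpd C 0) = src (idn p : gpd C 0)
  by rewrite src_idn tgt_idn.
have := hD _ _ e; rewrite -{1}(src_idn (gpd C 0) p) add0.
have -> : act (h 1 (idn p)) (idn p) = h 1 (idn p).
  have {2}<- : tgt (h 1 (idn p)) = p by rewrite ht tgt_idn.
  exact: (action_idn (act_action C 0)).
move=> /esym/idn_idem -> //; by rewrite h1t tgt_idn.
Qed.

Lemma derivation_opp (x : gpd C 0) : h 1 (- x) = - act (h 1 x) (- x).
Proof.
have [ht hD] := deformation1 hh.
have e : tgt x = src (- x) by rewrite src_opp.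
have e1 : tgt (h 1 x) = src (- x) by rewrite ht.
have e2 : src (act (h 1 x) (- x)) = src x
  by rewrite (src_action (act_action C 0)) // tgt_opp.
apply: opp_eq; first by rewrite (action_tgt (act_action C 0)) // L ht.
  by rewrite e2 ht tgt_opp.
by rewrite -(hD _ _ e) addrN deformation_idn e2.
Qed.

(** In dimension two, conjugation by [bd w] is the action of [bd (bd w)], an identity; above, the
    groups are abelian. *)
Lemma bd_central n (w : gpd C n.+2) (z : gpd C n.+1) : tgt z = tgt w ->
  bd w + z = z + bd w.
Proof.
have S := bd_src w; have T := bd_tgt w; have lz := L z.
case: n w z S T lz => [|n] w z S T lz e; last first.
  by apply: (module_comm (cc_module C n)); rewrite T.
have := crossed_peiffer (cc_crossed C) (x := z) (y := bd w).
rewrite T => /(_ e); rewrite cc_bdbd -e (action_idn (act_action C 0)).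
move=> zE; rewrite -{1}zE !addA; gside.
by rewrite addrN S -e -lz add0.
Qed.

(** In dimension two the derivation rule gives an action of [bd y], which Peiffer turns into
    conjugation by [y]. In higher dimensions the conjugation is trivial, so one formula covers both
    cases. *)
Lemma deformation_bd_add n (x y : gpd C n.+1) : tgt x = tgt y ->
  h n.+1 (bd (x + y)) = - y + h n.+1 (bd x) + y + h n.+1 (bd y).
Proof.
have S := bd_src; have T := bd_tgt; have ht := deformation_tgt.
move=> e; rewrite bd_add //; case: n x y e => [|n] x y e.
  rewrite (derivation_add (deformation1 hh)) ?T ?S //.
  by rewrite (crossed_peiffer (cc_crossed C)) // h1t T.
rewrite (functor_add (equivariant_functor (deformation2 hh n))) ?T ?S //.
rewrite (module_comm (cc_module C n) (x := - y)) ?tgt_opp ?L ?ht ?T // addrNK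
  //.
by rewrite ht T.
Qed.

(** The conjugation in the correction term of [x + y] is what is needed to move the correction of
    [x] past [y]; from dimension two on, the summands [bd (h x)] are central. *)
Lemma deform_functor n :
  is_functor (id : ob C -> ob C) (deform n.+1 : gpd C n -> gpd C n).
Proof.
case: n => [|n].
  have [ht hD] := deformation1 hh.
  split=> [x|x|x y e]; rewrite /deform.
  - by rewrite src_add // bd_src ht.
  - by rewrite tgt_add ?bd_tgt ?bd_src ht.
  have e1 : tgt (h 1 x) = src y by rewrite ht.
  rewrite hD // bd_add; last by rewrite (action_tgt (act_action C 0)) // ht.
  rewrite (crossed_act (cc_crossed C)) //.
  have su : src (bd (h 1 x)) = tgt x by rewrite bd_src ht.
  have tu : tgt (bd (h 1 x)) = tgt x by rewrite bd_tgt ht.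
  have sv : src (bd (h 1 y)) = tgt y by rewrite bd_src ht.
  move: (bd (h 1 x)) (bd (h 1 y)) su tu sv => u v su tu sv.
  rewrite !addA; gside.
  by rewrite addrK.
have S := bd_src; have T := bd_tgt; have ht := deformation_tgt.
split=> [x|x|x y e]; rewrite /deform.
- by rewrite !src_add ?tgt_add ?L ?S ?T ?ht ?T.
- by rewrite !tgt_add ?tgt_add ?L ?S ?T ?ht ?T.
have e' : tgt x = tgt y by rewrite e L.
rewrite deformation_bd_add //
  (functor_add (equivariant_functor (deformation2 hh n))) ?L //.
rewrite bd_add ?ht //.
have : src (h n.+1 (bd x)) = tgt x by rewrite L ht T.
have : tgt (h n.+1 (bd x)) = tgt x by rewrite ht T.
have : src (h n.+1 (bd y)) = tgt x by rewrite L ht T e'.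
have : tgt (h n.+1 (bd y)) = tgt x by rewrite ht T e'.
have : src (bd (h n.+2 x)) = tgt x by rewrite S ht.
have : tgt (bd (h n.+2 x)) = tgt x by rewrite T ht.
have : src (bd (h n.+2 y)) = tgt x by rewrite S ht e'.
have : tgt (bd (h n.+2 y)) = tgt x by rewrite T ht e'.
have : forall z, tgt z = tgt x -> bd (h n.+2 x) + z = z + bd (h n.+2 x).
  by move=> z ez; rewrite bd_central // ht.
move: (h n.+1 (bd x)) (h n.+1 (bd y)) (bd (h n.+2 x)) (bd (h n.+2 y)).
have := L x; have := L y; move: e => e lx ly u v w z wC *.
have -> : x + u + w + (y + v + z) = x + u + (w + (y + v)) + z.
  by rewrite !addA; gside.
rewrite (wC (y + v)); last by gside.
rewrite !addA; gside.
by rewrite addrK // lx.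
Qed.

Lemma bd_act n (x : gpd C n.+2) a : tgt x = src a ->
  bd (act x a) = act (bd x) a.
Proof. exact: (equivariant_act (cc_bd C n)). Qed.

(** Expand [h 1] on [- a + bd x + a]. The term coming from [- a] ends up acted on by [bd (act x a)],
    that is, conjugated by [act x a]. *)
Lemma derivation_bd_act (x : gpd C 1) (a : gpd C 0) : tgt x = src a ->
  h 1 (bd (act x a)) =
  - act x a - h 1 a + act x a + act (h 1 (bd x)) a + h 1 a.
Proof.
have [ht hD] := deformation1 hh; have A := act_action C 0.
have AT := action_tgt A; move=> e.
have sx := bd_src x; have tx := bd_tgt x.
have h1 : tgt (- a) = src (bd x) by gside.
have h2 : tgt (- a + bd x) = src a by gside.
have h3 : tgt (bd x) = src a by congruence.
rewrite (crossed_act (cc_crossed C)) // (hD _ _ h2) (hD _ _ h1).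
have h4 : tgt (h 1 (- a)) = src (bd x) by rewrite ht; gside.
have h5 : tgt (act (h 1 (- a)) (bd x)) = src a by rewrite AT.
rewrite (action_add A) //; last by rewrite h5 ht h3.
rewrite -(action_comp A (x := h 1 (- a))) //.
have h6 : tgt (h 1 a) = src (- a) by rewrite ht; gside.
have h7 : tgt (- a) = src (bd x + a) by gside.
have h8 : tgt (act (h 1 a) (- a)) = src (bd x + a) by rewrite AT.
rewrite derivation_opp (action_opp A) //.
rewrite -(action_comp A) // addA // -(crossed_act (cc_crossed C)) //.
have h9 : tgt (h 1 a) = tgt (act x a) by rewrite ht AT.
rewrite -(crossed_peiffer (cc_crossed C)) //.
have h10 : src (h 1 a) = tgt (act x a) by rewrite L.
have h11 : src (act x a) = tgt (act x a) by rewrite L.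
rewrite oppD; last by gside.
rewrite oppD; last by gside.
by rewrite oppK; congr (_ + _ + _); rewrite addA; gside.
Qed.

(** The arrow [deform 1 a] is [a + bd (h 1 a)]. In dimension two its second summand acts as
    conjugation by [h 1 a], matching [derivation_bd_act]; above, it acts trivially. *)
Lemma deform_act n (x : gpd C n.+1) (a : gpd C 0) : tgt x = src a ->
  deform n.+2 (act x a) = act (deform n.+2 x : gpd C n.+1) (deform 1 a).
Proof.
have S := bd_src; have T := bd_tgt; have ht := deformation_tgt.
have D := deform_functor.
move=> e; have A := act_action C n; have AT := action_tgt A.
have eT : tgt (deform n.+2 x : gpd C n.+1) = src a.
  by rewrite (functor_tgt (D n.+1)).
rewrite [deform 1 a]/(a + bd (h 1 a)) (action_comp A) //; last by rewrite S ht.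
have e1 : tgt (h n.+1 (bd x)) = src a by rewrite ht T.
have e2 : tgt (bd (h n.+2 x)) = src a by rewrite T ht.
have -> : act (deform n.+2 x : gpd C n.+1) a =
    act x a + act (h n.+1 (bd x)) a + bd (act (h n.+2 x) a).
  rewrite bd_act ?ht // /deform.
  rewrite (action_add A) ?tgt_add ?L ?e1 ?e2 //.
  by rewrite (action_add A) // ?e1.
have hc := equivariant_act (deformation2 hh n) e.
rewrite deformS hc.
have e3 : tgt (act x a) = tgt a by rewrite AT.
have e4 : tgt (act (h n.+1 (bd x)) a) = tgt a by rewrite AT.
have e5 : tgt (act (h n.+2 x) a) = tgt a
  by rewrite (action_tgt (act_action C n.+1)) // ht.
have e6 : tgt (act x a + act (h n.+1 (bd x)) a + bd (act (h n.+2 x) a)) = tgt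
  (h 1 a).
  by rewrite h1t !tgt_add ?S ?T ?L ?e3 ?e4 ?e5.
case: n x e A AT eT e1 e2 hc e3 e4 e5 e6 => [|n] x e A AT eT e1 e2 hc e3 e4 e5
  e6.
  rewrite -(crossed_peiffer (cc_crossed C)) // derivation_bd_act //.
  have wC z : tgt z = tgt a -> bd (act (h 2 x) a) + z = z + bd (act (h 2 x) a).
    by move=> ez; rewrite bd_central // e5.
  have lh := L (h 1 a); have th := h1t a.
  move: e3 e4 (T _ _ (act (h 2 x) a)) (S _ _ (act (h 2 x) a)) wC.
  have := L (act x a); have := L (act (h 1 (bd x)) a); rewrite e5.
  move: (h 1 a) (act x a) (act (h 1 (bd x)) a) (bd (act (h 2 x) a)) lh th.
  move=> u v w z lu tu lw lv tv tw tz sz zC.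
  have -> : - u + (v + w + z) + u = - u + (v + w) + (z + u) by rewrite !addA;
    gside.
  rewrite zC // !addA; gside.
  have -> : v - v - u = - u by rewrite addrN lv tv -tu -src_opp add0.
  by [].
rewrite cc_triv // bd_act // (equivariant_act (deformation2 hh n)) //.
by rewrite T.
Qed.

Lemma deform_bd n (x : gpd C n.+1) :
  deform n.+1 (bd x) = bd (deform n.+2 x : gpd C n.+1).
Proof.
have S := bd_src; have T := bd_tgt; have ht := deformation_tgt.
rewrite deformS.
have e : src (h n.+1 (bd x)) = tgt x by rewrite L ht T.
rewrite !bd_add ?tgt_add ?T ?L ?ht ?T // cc_bdbd.
have -> : tgt (h n.+2 x) = tgt (bd x + bd (h n.+1 (bd x))).
  by rewrite tgt_add ?S ?T ?ht ?T.
rewrite addr0; case: n x e => [|n] x e //.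
by rewrite deformS cc_bdbd deformation_idn -T addr0.
Qed.

Definition deformation : morphism C C :=
  Morphism (mor := deform) deform_functor deform_act deform_bd.

(** Pointwise agreement of [f] with [deform] suffices, so the lemma applies to a composite morphism
    without an equality of records. *)
Lemma deformation_homotopy (f : morphism C C) :
  (forall n x, f n x = deform n x) -> is_homotopy f (morphism_id C) h.
Proof.
have S := bd_src; have T := bd_tgt; have ht := deformation_tgt.
have h0 := deformation0 hh; have [_ hD] := deformation1 hh.
have hE n := equivariant_functor (deformation2 hh n).
move=> fE; split.
- case=> [|n] x; last exact: ht.
  by rewrite h0 tgt_idn.
- exact: hD.
- by move=> n x y e; rewrite (functor_add (hE n)) // L.
- by move=> n x c e; rewrite (equivariant_act (deformation2 hh n)).
- by move=> x; rewrite fE h0 src_idn.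
- move=> x; rewrite fE !h0 /=.
  have -> : - idn (tgt x) = idn (tgt (x + bd (h 1 x))) :> gpd C 0.
    by apply/esym/opp_eq; rewrite ?src_idn ?tgt_idn // tgt_add ?S ?T ?ht //;
      rewrite -{1}(src_idn (gpd C 0) (tgt x)) add0.
  by rewrite add0 addr0.
- move=> n x; rewrite fE h0 /=.
  set y := _ + _ + _.
  have -> : - idn (tgt x) = idn (tgt y) :> gpd C 0.
    have -> : tgt y = tgt x by rewrite (functor_tgt (deform_functor n.+1) x).
    apply/esym/opp_eq; rewrite ?src_idn ?tgt_idn //.
    by rewrite -{1}(src_idn (gpd C 0) (tgt x)) add0.
  by rewrite (action_idn (act_action C n)).
Qed.

End Deformation.

(** * Normal subcrossed complexes *)

Definition identities (C : crossedComplex) (n : nat) : set (cell C n) :=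
  match n with 0 => setT | m.+1 => [set x : gpd C m | x = idn (tgt x)] end.

Lemma idnDidn (O : Type) (G : groupoid O) p : idn p + idn p = idn p :> G.
Proof. by rewrite -{1}(src_idn G p) add0. Qed.

Lemma idnN (O : Type) (G : groupoid O) p : - idn p = idn p :> G.
Proof. by apply/esym/opp_eq; rewrite ?src_idn ?tgt_idn // idnDidn. Qed.

Lemma idn_conj (O : Type) (G : groupoid O) p (c : G) : p = src c ->
  - c + idn p + c = idn (tgt c).
Proof. by move=> ->; rewrite -{1}(tgt_opp c) addr0 addN. Qed.

(** This identifies the bottom stage [G 0] of the filtration, generated by the empty family. *)
Lemma identities_normal (C : crossedComplex) : is_normal (@identities C).
Proof.
split=> //=.
- split=> //=.
  + by move=> n p _; rewrite tgt_idn.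
  + move=> n x y ex ey; rewrite ex ey tgt_idn src_idn => ->.
    by rewrite idnDidn tgt_idn.
  + by move=> n x ->; rewrite idnN !tgt_idn.
  + move=> n x a -> _; rewrite tgt_idn => e.
    by rewrite act_idn // tgt_idn.
  + by move=> n x ->; rewrite bd_idn tgt_idn.
- by move=> x ->; rewrite src_idn tgt_idn.
- by move=> x c ->; rewrite tgt_idn => e; rewrite idn_conj // tgt_idn.
- by move=> n a x ->; rewrite tgt_idn => e; rewrite act_idn // tgt_idn.
- move=> n x a -> e; have [al _ ai _ _] := act_action C n.
  by move: e; rewrite src_idn => <-; rewrite ai addrN al tgt_idn.
Qed.

Section Preimage.
Variables (C D : crossedComplex) (f : morphism C D).
Hypothesis f0 : injective (f 0).
Variable B : forall n, set (cell D n).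
Arguments B : clear implicits.
Hypothesis hB : is_normal B.

(** Injectivity on objects makes an arrow a loop as soon as its image is one. *)
Lemma preimage_normal : is_normal (fun n => f n @^-1` B n).
Proof.
have F n := mor_functor f n.
have Fs n (x : gpd C n) : src (f n.+1 x : gpd D n) = f 0 (src x) :=
  functor_src (F n) x.
have Ft n (x : gpd C n) : tgt (f n.+1 x : gpd D n) = f 0 (tgt x) :=
  functor_tgt (F n) x.
have B0 x : B 0 x by rewrite (normal_ob hB).
split=> /=.
- split=> /=.
  + by move=> n x _; apply: B0.
  + by move=> n x _; apply: B0.
  + by move=> n p _; rewrite (functor_idn (F n));
      apply: (sub_idn (normal_sub hB)).
  + move=> n x y hx hy e; rewrite (functor_add (F n)) //.
    by apply: (sub_add (normal_sub hB)) => //; rewrite Fs Ft e.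
  + by move=> n x hx; rewrite (functor_opp (F n));
      apply: (sub_opp (normal_sub hB)).
  + move=> n x a hx ha e; rewrite (mor_act f) //.
    by apply: (sub_act (normal_sub hB)) => //; rewrite Fs Ft e.
  + by move=> n x hx; rewrite (mor_bd f); apply: (sub_bd (normal_sub hB)).
- by apply/seteqP; split=> // x _; apply: B0.
- by move=> x /(normal_loop hB); rewrite Fs Ft => /f0.
- move=> x c hx e; have lx : src x = tgt x.
    by apply: f0; rewrite -Fs -Ft; apply: (normal_loop hB).
  have e1 : tgt (- c) = src x by rewrite tgt_opp lx e.
  rewrite (functor_add (F 0)); last by rewrite tgt_add.
  rewrite (functor_add (F 0)) // (functor_opp (F 0));
    apply: (normal_conj hB) => //.
  by rewrite Fs Ft e.
- move=> n a x ha e; rewrite (mor_act f) //.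
  by apply: (normal_act hB) => //; rewrite Fs Ft e.
- move=> n x a ha e.
  have la : src a = tgt a by apply: f0; rewrite -Fs -Ft;
    apply: (normal_loop hB).
  rewrite (functor_add (F n.+1)); last first.
    by rewrite src_opp (action_tgt (act_action C n)) // e.
  rewrite (functor_opp (F n.+1)) (mor_act f) //.
  by apply: (normal_diff hB) => //; rewrite Fs Ft e.
Qed.

End Preimage.

Section QuotientImage.
Variables (C : crossedComplex) (E B : forall n, set (cell C n)).
Arguments E : clear implicits.
Arguments B : clear implicits.
Hypotheses (hE : is_normal E) (hB : is_normal B).
Let q := quotient_morphism hE.

Lemma quotient_morphism_surj n (u : cell (quotient hE) n) : exists x, q n x = u.
Proof.
case: n u => [|n] u; first by exists u.
by exists (grepr u); apply: greprK.
Qed.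

Lemma quotient_morphism_src n (x : gpd C n) :
  src (q n.+1 x : gpd (quotient hE) n) = src x.
Proof. exact: (functor_src (mor_functor q n)). Qed.

Lemma quotient_morphism_tgt n (x : gpd C n) :
  tgt (q n.+1 x : gpd (quotient hE) n) = tgt x.
Proof. exact: (functor_tgt (mor_functor q n)). Qed.

(** Normality involves all arrows and cells of the quotient; these lift, with the same endpoints. *)
Lemma quotient_image_normal : is_normal (fun n => q n @` B n).
Proof.
have F n := mor_functor q n.
have Fs := quotient_morphism_src; have Ft := quotient_morphism_tgt.
have B0 x : B 0 x by rewrite (normal_ob hB).
have Q0 (p : ob C) : (q 0 @` B 0) p by exists p.
split.
- split.
  + by move=> n x _; apply: Q0.
  + by move=> n x _; apply: Q0.
  + move=> n p _; exists (idn p : gpd C n); last exact: (functor_idn (F n)).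
    exact: (sub_idn (normal_sub hB)).
  + move=> n _ _ [x hx <-] [y hy <-]; rewrite Fs Ft => e.
    exists (x + y : gpd C n); last exact: (functor_add (F n)).
    exact: (sub_add (normal_sub hB)).
  + move=> n _ [x hx <-]; exists (- x : gpd C n);
      last exact: (functor_opp (F n)).
    exact: (sub_opp (normal_sub hB)).
  + move=> n _ _ [x hx <-] [a ha <-]; rewrite Fs Ft => e.
    exists (act x a); last exact: (mor_act q).
    exact: (sub_act (normal_sub hB)).
  + move=> n _ [x hx <-]; exists (bd x); last exact: (mor_bd q).
    exact: (sub_bd (normal_sub hB)).
- by apply/seteqP; split=> // x _; apply: Q0.
- by move=> _ [x hx <-]; rewrite Fs Ft; apply: (normal_loop hB).
- move=> _ c [x hx <-]; have [d <-] := quotient_morphism_surj (n := 1) c.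
  rewrite Fs Ft => e; exists (- d + x + d : gpd C 0).
    exact: (normal_conj hB).
  have lx := normal_loop hB hx.
  have e1 : tgt (- d) = src x by rewrite tgt_opp lx e.
  rewrite (functor_add (F 0)); last by rewrite tgt_add.
  by rewrite (functor_add (F 0)) // (functor_opp (F 0)).
- move=> n _ c [x hx <-]; have [d <-] := quotient_morphism_surj (n := 1) c.
  rewrite Fs Ft => e; exists (act x d); last exact: (mor_act q).
  exact: (normal_act hB).
- move=> n z _ [a ha <-]; have [x <-] := quotient_morphism_surj (n := n.+2) z.
  rewrite Fs Ft => e; exists (x - act x a : gpd C n.+1).
    exact: (normal_diff hB).
  have la := normal_loop hB ha.
  rewrite (functor_add (F n.+1)); last first.
    by rewrite src_opp (action_tgt (act_action C n)) // e.
  by rewrite (functor_opp (F n.+1)) (mor_act q).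
Qed.

End QuotientImage.

(** * Faces, degeneracies and last edges *)

Section SimplicialIdentities.
Variable K : simplicialSet.

Lemma last_vertex_degen n k (y : K n) : k <= n ->
  last_vertex (degen k y) = last_vertex y.
Proof.
elim: n k y => [|n IH] [|k] y // kn;
  rewrite -[LHS]/(last_vertex (face 0 (degen _ y))) ?face_degen_eq //.
by rewrite face_degen_lt // IH.
Qed.

Lemma last_edge_degen n k (y : K n.+1) : k <= n ->
  last_edge (degen k y) = last_edge y.
Proof.
elim: n k y => [|n IH] [|k] y // kn;
  rewrite -[LHS]/(last_edge (face 0 (degen _ y))) ?face_degen_eq //.
by rewrite face_degen_lt ?IH // ltnW.
Qed.

(** Degenerating at the last vertex repeats it. This is the case where the top face, twisted by the
    last edge, belongs to the cancelling pair of faces. *)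
Lemma last_edge_degen_top n (y : K n) :
  last_edge (degen n y) = degen 0 (last_vertex y).
Proof.
elim: n y => [|n IH] y //; rewrite -[LHS]/(last_edge (face 0 (degen n.+1 y))).
by rewrite face_degen_lt // IH.
Qed.

Lemma last_vertex_face n i (x : K n.+1) : i <= n ->
  last_vertex (face i x) = last_vertex x.
Proof.
elim: n i x => [|n IH] [|i] x // ile.
rewrite -[LHS]/(last_vertex (face 0 (face i.+1 x))) face_face ?IH //.
exact: ltnW.
Qed.

Lemma face0_last_edge n (x : K n.+1) : face 0 (last_edge x) = last_vertex x.
Proof. by elim: n x => [|n IH] x //; rewrite [last_edge _]/= IH. Qed.

Lemma face1_last_edge n (x : K n.+1) :
  face 1 (last_edge x) = last_vertex (face n.+1 x).
Proof.
elim: n x => [|n IH] x //; rewrite -[last_edge x]/(last_edge (face 0 x)) IH.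
by rewrite -[RHS]/(last_vertex (face 0 (face n.+2 x))) (face_face (i := 0)).
Qed.

End SimplicialIdentities.

(** * The normal subcrossed complex generated by degenerate generators *)

Section Degenerate.
Variables (K : simplicialSet) (P : PiUpsilon K).

Lemma gen_tgt n (x : K n.+1) : tgt (gen P x : gpd P n) = gen P (last_vertex x).
Proof. by case: n x => [|n] x; [exact: gen_tgt1|exact: gen_base]. Qed.

Lemma gen_src_last_edge n (x : K n.+1) :
  src (gen P (last_edge x) : gpd P 0) = gen P (last_vertex (face n.+1 x)).
Proof. by rewrite gen_src1 face1_last_edge. Qed.

Lemma gen_tgt_last_edge n (x : K n.+1) :
  tgt (gen P (last_edge x) : gpd P 0) = gen P (last_vertex x).
Proof. by rewrite gen_tgt1 face0_last_edge. Qed.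

(** [I] restricts the degeneracy indices: [setT] gives all degenerate generators, an initial segment
    gives a stage of the filtration. *)
Definition degenerates (I : set nat) n : set (cell P n) :=
  match n with
  | 0 => set0
  | m.+1 => [set u | exists i (y : K m),
    [/\ I i, i <= m & u = gen P (degen i y)]]
  end.

Definition degeneracy (I : set nat) : forall n, set (cell P n) :=
  normal_closure (@degenerates I).
Arguments degeneracy : clear implicits.

Lemma degeneracy_normal I : is_normal (degeneracy I).
Proof.
apply: normal_closureP => _ [[|i] [y [_ ile ->]]] //.
by rewrite gen_src1 gen_tgt1 face_degen_eq ?face_degen_succ.
Qed.

Lemma gen_degeneracy (I : set nat) n i (y : K n) : I i -> i <= n ->
  degeneracy I n.+1 (gen P (degen i y)).
Proof. by move=> Ii ile; apply: normal_closure_sub; exists i, y. Qed.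

Lemma degeneracy_sub (I : set nat) (B : forall n, set (cell P n)) n :
  is_normal B ->
  (forall m i (y : K m), I i -> i <= m -> B m.+1 (gen P (degen i y))) ->
  degeneracy I n `<=` B n.
Proof.
move=> hB IB x; apply=> // -[//|m] _ [i [y [Ii ile ->]]]; exact: IB.
Qed.

Lemma degeneracyS (I J : set nat) n : I `<=` J ->
  degeneracy I n `<=` degeneracy J n.
Proof.
move=> IJ; apply: degeneracy_sub; first exact: degeneracy_normal.
by move=> m i y /IJ Ji ile; apply: gen_degeneracy.
Qed.

(** The two successive quotients defining [Pi] amount to one. Preimages and images of normal
    subcrossed complexes under the first quotient morphism are normal, so each inclusion is checked
    on generators. *)
Lemma DK_quotient n (z : gpd P n) :
  DK (quotient_morphism (E0_normal P) n.+1 z) <-> degeneracy setT n.+1 z.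
Proof.
set q := quotient_morphism (E0_normal P).
have sE m : E0 (n := m) `<=` degeneracy setT m.
  move=> x; apply=> [|[//|k] _ [y _ <-]]; first exact: degeneracy_normal.
  exact: gen_degeneracy.
split=> [|]; last first.
  have N := preimage_normal (f := q) (fun x y e => e) (DK_normal P).
  suff : degeneracy setT n.+1 `<=` q n.+1 @^-1` @DK K P n.+1 by apply.
  apply: (degeneracy_sub N) => -[|m] i y _ ile /=.
    case: i ile => // _; rewrite [X in DK X](gen0N_degen0 P).
    by apply: (sub_idn (normal_sub (DK_normal P)));
      rewrite (normal_ob (DK_normal P)).
  exists i => //; apply: normal_closure_sub; exists i, y; split=> //.
(* [D k] is contained in every normal subcrossed complex containing its generators, here in the
   image of [degeneracy setT]. *)
case=> k _ /(_ _ (quotient_image_normal (E0_normal P) (degeneracy_normal setT)))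
  h.
have {h} [|x hx] := h.
  move=> [//|[//|m]] _ [i [y [_ ile ->]]].
  by exists (gen P (degen i y)) => //; apply: gen_degeneracy.
(* So [z] has the same image as some [x] in [degeneracy setT], and [x - z] lies in [E0], which is
   contained in [degeneracy setT]. *)
move/qprojP => [s t]; rewrite -/(q _) => e.
have -> : z = - (x - z) + x.
  rewrite oppD ?src_opp // oppK -addA ?tgt_opp ?src_opp // ?addN ?t ?addr0 //.
apply: (sub_add (normal_sub (degeneracy_normal setT))) => //.
  by apply: (sub_opp (normal_sub (degeneracy_normal setT))); apply: sE.
by rewrite tgt_opp src_add // src_opp.
Qed.

Lemma Pi_projP n (x y : gpd P n) : Pi_proj P n.+1 x = Pi_proj P n.+1 y <->
  [/\ src x = src y, tgt x = tgt y & degeneracy setT n.+1 (x - y)].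
Proof.
set q := quotient_morphism (E0_normal P).
have Fs := quotient_morphism_src (E0_normal P).
have Ft := quotient_morphism_tgt (E0_normal P).
have F := mor_functor q n.
have E : tgt x = tgt y -> q n.+1 (x - y) = (q n.+1 x : gpd (Pi0N P) n) - q n.+1
  y.
  by move=> e; rewrite (functor_add F) ?(functor_opp F) // src_opp.
split.
  move/qprojP; rewrite !Fs !Ft => -[s t h]; split=> //.
  by apply/DK_quotient; rewrite E.
case=> s t /DK_quotient; rewrite E // => h.
by apply/qprojP; rewrite !Fs !Ft.
Qed.

Lemma Pi_proj_surj n (u : cell (Pi P) n) : exists x, Pi_proj P n x = u.
Proof.
have [v <-] := quotient_morphism_surj (hE := DK_normal P) u.
by have [x <-] := quotient_morphism_surj (hE := E0_normal P) v; exists x.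
Qed.

End Degenerate.

(** * Alternating sums in the vertex groups of a module *)

Lemma tgt_signed (O : Type) (G M : groupoid O) (am : M -> G -> M) m (x : M) :
  is_action am -> tgt (signed m x) = tgt x.
Proof. by move=> ha; rewrite /signed; case: odd;
  rewrite // tgt_opp (loop ha). Qed.

Definition sgn (V : zmodType) (m : nat) (x : V) : V :=
  (if odd m then - x else x)%R.

Section Vertex.
Variables (O : Type) (G N : groupoid O) (an : N -> G -> N).
Hypothesis hN : is_module an.
Let han : is_action an := module_action hN.
Let L := loop han.

Definition vertex_on (p : O) : groupoid_on (fun x : N => tgt x = p)
  (fun _ => tt) (fun _ => tt) (fun _ => idn p) (@add _ N) (@opp _ N).
Proof.
split=> /=.
- by case; rewrite tgt_idn.
- by move=> x y ex ey _; rewrite tgt_add // L; congruence.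
- by move=> x ex; rewrite tgt_opp L.
- by move=> x y z ex ey ez _ _; rewrite addA // L; congruence.
- by move=> x <-; rewrite -{1}L add0 addr0.
- by move=> x <-; rewrite addN addrN L.
Qed.

(** The argument [hN] makes the commutativity proof part of the type, so that a [zmodType] structure
    can be attached to it and sums can be rearranged. *)
Definition vertex (hN : is_module an) (p : O) := {x : N | tgt x = p}.

Variable p : O.
Let V := vertex hN p.
Let vG := sub_groupoid (vertex_on p).

HB.instance Definition _ := gen_eqMixin (vertex hN p).
HB.instance Definition _ := gen_choiceMixin (vertex hN p).

Let vaddA : associative (@add _ vG : V -> V -> V).
Proof. by move=> x y z; apply: (@addA _ vG). Qed.

Let vaddC : commutative (@add _ vG : V -> V -> V).
Proof.
move=> x y; apply: sval_inj; rewrite !restrict_groupoid_addE //.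
by apply: (module_comm hN); rewrite (svalP x) (svalP y).
Qed.

Let vadd0 : left_id (idn tt : vG) (@add _ vG : V -> V -> V).
Proof. by move=> x; apply: (@add0 _ vG). Qed.

Let vaddN : left_inverse (idn tt : vG) (@opp _ vG) (@add _ vG : V -> V -> V).
Proof. by move=> x; apply: (@addN _ vG). Qed.

HB.instance Definition _ :=
  GRing.isZmodule.Build (vertex hN p) vaddA vaddC vadd0 vaddN.

Definition vert (x : N) : V := restrict (idn tt : vG) x.

Lemma vertK x : tgt x = p -> sval (vert x) = x.
Proof. exact: restrictE. Qed.

Lemma vertD x y : tgt x = p -> tgt y = p ->
  vert (x + y) = (vert x + vert y)%R.
Proof.
move=> ex ey; apply: sval_inj.
rewrite vertK; last by rewrite tgt_add // L; congruence.
by rewrite [RHS]restrict_groupoid_addE ?vertK.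
Qed.

Lemma vertN x : tgt x = p -> vert (- x) = (- vert x)%R.
Proof.
move=> ex; apply: sval_inj.
rewrite vertK; last by rewrite tgt_opp L.
by rewrite [RHS]restrict_groupoid_oppE ?vertK.
Qed.

Lemma vert0 : vert (idn p) = 0%R.
Proof. by apply: sval_inj; rewrite vertK // tgt_idn. Qed.

Lemma vert_inj x y : tgt x = p -> tgt y = p -> vert x = vert y -> x = y.
Proof. by move=> ex ey /(congr1 sval); rewrite !vertK. Qed.

Lemma vert_sum n (F : nat -> N) : (forall i, i < n -> tgt (F i) = p) ->
  tgt (\big[@add _ N/idn p]_(0 <= i < n) F i) = p /\
  vert (\big[@add _ N/idn p]_(0 <= i < n) F i) =
    (\sum_(0 <= i < n) vert (F i))%R.
Proof.
elim: n F => [|n IH] F hF; first by rewrite !big_geq // tgt_idn vert0.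
have [//|e eS] := IH (fun i => F i.+1); first by move=> i ilt; apply: hF.
have e0 : tgt (F 0) = p by apply: hF.
rewrite !big_nat_recl // vertD // eS tgt_add ?L //; congruence.
Qed.

Lemma vert_signed m x : tgt x = p -> vert (signed m x) = sgn m (vert x).
Proof. by move=> ex; rewrite /signed /sgn; case: odd => //; rewrite vertN. Qed.

End Vertex.

(** * Boundaries of degenerate generators *)

Lemma functor_sum (O : Type) (G M N : groupoid O) (am : M -> G -> M)
    (an : N -> G -> N) (F : M -> N) p n (f : nat -> M) :
  is_action am -> is_equivariant am an F ->
    (forall i, i < n -> tgt (f i) = p) ->
  tgt (\big[@add _ M/idn p]_(0 <= i < n) f i) = p /\
  F (\big[@add _ M/idn p]_(0 <= i < n) f i) = \big[@add _ N/idn p]_(0 <= i < n)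
    F (f i).
Proof.
move=> hM [hF _]; elim: n f => [|n IH] f hf.
  by rewrite !big_geq // tgt_idn (functor_idn hF).
have [//|e eS] := IH (fun i => f i.+1); first by move=> i ilt; apply: hf.
have e0 : tgt (f 0) = p by apply: hf.
have e1 : tgt (f 0) = src (\big[@add _ M/idn p]_(0 <= i < n) f i.+1).
  by rewrite (loop hM) e.
by rewrite !big_nat_recl // (functor_add hF) // eS tgt_add.
Qed.

Section BoundarySum.
Variables (K : simplicialSet) (P : PiUpsilon K).
Variables (N : groupoid (ob P)) (an : N -> gpd P 0 -> N).
Hypothesis hN : is_module an.
Let han : is_action an := module_action hN.

(** An equivariant map to a module forgets the order of the summands, so the nonabelian formula for
    dimension three and the general one become the same alternating sum. *)
Let bd_sum_last n (F : gpd P n.+1 -> N) (x : K n.+3) :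
  is_equivariant (@act P n) an F ->
  let v := gen P (last_vertex x) in
  vert hN v (F (bd (gen P x : gpd P n.+2))) =
  (\sum_(0 <= i < n.+3) sgn (n.+3 - i) (vert hN v (F (gen P (face i x)))) +
   vert hN v (F (act (gen P (face n.+3 x) : gpd P n.+1)
     (gen P (last_edge x)))))%R.
Proof.
move=> hF v.
have Ft := functor_tgt (equivariant_functor hF).
have Fa := functor_add (equivariant_functor hF).
have Fo := functor_opp (equivariant_functor hF).
have t i : i < n.+3 -> tgt (gen P (face i x) : gpd P n.+1) = v.
  by move=> ilt; rewrite gen_tgt last_vertex_face.
have L := loop (act_action P n).
have tT : tgt (act (gen P (face n.+3 x) : gpd P n.+1) (gen P (last_edge x))) =
  v.
  rewrite (action_tgt (act_action P n)) ?gen_tgt_last_edge //.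
  by rewrite gen_tgt gen_src_last_edge.
have tF y : tgt y = v -> tgt (F y) = v by rewrite Ft.
case: n F hF x @v Ft Fa Fo t L tT tF => [|n] F hF x v Ft Fa Fo t L tT tF.
  have [t0 t1 t2] := And3 (t 0 isT) (t 1 isT) (t 2 isT).
  rewrite gen_bd3 big_nat_recl // big_nat_recl // big_nat_recl // big_geq //.
  have la := L (act (gen P (face 3 x) : gpd P 1) (gen P (last_edge x))).
  move: t0 t1 t2 tT (L (gen P (face 0 x))) (L (gen P (face 1 x)))
    (L (gen P (face 2 x))) la.
  move: (act _ _) (gen P (face 0 x)) (gen P (face 1 x)) (gen P (face 2 x)).
  move=> a b d c tb td tc ta lb ld lc la.
  rewrite !Fa; try by gside.
  rewrite !Fo /sgn /= GRing.addr0.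
  move: (tF _ ta) (tF _ tb) (tF _ tc) (tF _ td).
  move: (loop han (F a)) (loop han (F b)) (loop han (F c)) (loop han (F d)).
  move: (F a) (F b) (F c) (F d) => {ta tb tc td} a' b' c' d' *.
  rewrite !(vertD, vertN); try by gside.
  rewrite [RHS]GRing.addrC !GRing.addrA.
  by rewrite -!GRing.addrA; congr (_ + (_ + _))%R; rewrite GRing.addrC.
rewrite gen_bd -/v -(big_mkord xpredT
  (fun i => signed (n.+4 - i) (gen P (face i x) : gpd P n.+2))).
have ts i : i < n.+4 -> tgt
  (signed (n.+4 - i) (gen P (face i x) : gpd P n.+2)) = v.
  by move=> /t <-; rewrite (tgt_signed _ _ (act_action P n.+1)).
have [tS _] := vert_sum (cc_module P n) ts.
have [_ vS] := functor_sum (act_action P n.+1) hF ts.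
rewrite Fa; last by rewrite tT L tS.
rewrite vertD ?tF // GRing.addrC; congr (_ + _)%R.
rewrite vS (proj2 (vert_sum _ _)); last by move=> i /ts /tF.
apply: eq_big_nat => i /andP[_ /t ti].
rewrite -vert_signed ?tF // /signed; case: odd => //; by rewrite Fo.
Qed.

Variables (n : nat) (F : gpd P n.+1 -> N).
Hypothesis hF : is_equivariant (@act P n) an F.
Let Ft := functor_tgt (equivariant_functor hF).
Let Fa := functor_add (equivariant_functor hF).
Let Fo := functor_opp (equivariant_functor hF).

Definition bd_term (x : K n.+3) (i : nat) : N :=
  if i == n.+3 then an (F (gen P (face i x))) (gen P (last_edge x))
  else F (gen P (face i x)).

Lemma tgt_bd_term x i : i <= n.+3 -> tgt (bd_term x i) = gen P (last_vertex x).
Proof.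
rewrite /bd_term leq_eqVlt ltnS; case: eqP => [-> _|_ /= ile].
  by rewrite (action_tgt han) ?gen_tgt_last_edge // Ft gen_tgt
    gen_src_last_edge.
by rewrite Ft gen_tgt last_vertex_face.
Qed.

Lemma bd_sum (x : K n.+3) :
  vert hN (gen P (last_vertex x)) (F (bd (gen P x : gpd P n.+2))) =
  (\sum_(0 <= i < n.+4) sgn (n.+3 - i)
    (vert hN (gen P (last_vertex x)) (bd_term x i)))%R.
Proof.
set v := gen P (last_vertex x).
rewrite bd_sum_last // [RHS]big_nat_recr // /bd_term eqxx subnn.
rewrite (equivariant_act hF) ?gen_tgt ?gen_src_last_edge //; congr (_ + _)%R.
by apply: eq_big_nat => i /andP[_ ilt]; rewrite ltn_eqF.
Qed.

End BoundarySum.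

Lemma sgnD (V : zmodType) m (x y : V) : sgn m (x + y)%R = (sgn m x + sgn m y)%R.
Proof. by rewrite /sgn; case: odd; rewrite ?GRing.opprD. Qed.

Lemma sgnN (V : zmodType) m (x : V) : sgn m (- x)%R = (- sgn m x)%R.
Proof. by rewrite /sgn; case: odd. Qed.

Lemma sgn0 (V : zmodType) m : sgn m (0 : V)%R = 0%R.
Proof. by rewrite /sgn; case: odd; rewrite ?GRing.oppr0. Qed.

Lemma sgnS (V : zmodType) m (x : V) : sgn m.+1 x = (- sgn m x)%R.
Proof. by rewrite /sgn /=; case: odd => //=; rewrite GRing.opprK. Qed.

Lemma sgnK (V : zmodType) m (x : V) : sgn m (sgn m x) = x.
Proof. by rewrite /sgn; case: odd; rewrite ?GRing.opprK. Qed.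

Lemma sgnC (V : zmodType) m m' (x : V) : sgn m (sgn m' x) = sgn m' (sgn m x).
Proof. by rewrite /sgn; do 2!case: odd. Qed.

Lemma sgn_sum (V : zmodType) m a b (F : nat -> V) :
  sgn m (\sum_(a <= i < b) F i)%R = (\sum_(a <= i < b) sgn m (F i))%R.
Proof. exact: (big_morph _ (sgnD m) (sgn0 V m)). Qed.

(** Isolates the two terms [k] and [k.+1] of opposite sign: the corresponding faces of a simplex
    degenerate at [k] are equal. *)
Lemma alternating_split (V : zmodType) (t : nat -> V) m k : k < m ->
  (\sum_(0 <= i < m.+1) sgn (m - i) (t i) =
   \sum_(0 <= i < k) sgn (m - i) (t i) + sgn (m - k) (t k - t k.+1) +
   \sum_(k.+2 <= i < m.+1) sgn (m - i) (t i))%R.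
Proof.
move=> km; rewrite (big_cat_nat (n := k) (leq0n k) (leqW (ltnW km))).
rewrite (@big_ltn _ _ _ k m.+1 _ (ltnW km)) (@big_ltn _ _ _ k.+1 m.+1 _ km) /=.
rewrite -[RHS]GRing.addrA; congr (_ + _)%R; rewrite GRing.addrA;
  congr (_ + _)%R.
by rewrite sgnD sgnN -(subnSK km) !sgnS GRing.opprK.
Qed.

Section DegenerateBoundary.
Variables (K : simplicialSet) (P : PiUpsilon K).
Variables (N : groupoid (ob P)) (an : N -> gpd P 0 -> N).
Hypothesis hN : is_module an.
Variables (n : nat) (F : gpd P n.+1 -> N).
Hypothesis hF : is_equivariant (@act P n) an F.
Variables (k : nat) (y : K n.+2).
Hypothesis kn : k <= n.+2.

Definition degen_term (i : nat) : N :=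
  let u := F (gen P (degen k (face i.-1 y))) in
  if i == n.+3 then an u (gen P (last_edge (degen k y))) else u.

Lemma bd_term_degen i : k.+1 < i -> i <= n.+3 ->
  bd_term an F (degen k y) i = degen_term i.
Proof. by move=> ki ile; rewrite /bd_term /degen_term face_degen_gt. Qed.

Hypothesis kills : forall j (z : K n.+1), j < k -> j <= n.+1 ->
  F (gen P (degen j z)) = idn (gen P (last_vertex z)).
Hypothesis triv : k = n.+2 ->
  an (F (gen P y)) (gen P (last_edge (degen k y))) = F (gen P y).

(** Faces below [k] are degenerate with index [k.-1] and are killed; faces [k] and [k.+1] cancel,
    [triv] removing the twist if the latter is the top face. Only the faces above, again degenerate
    at [k], survive. *)
Lemma bd_degen :
  vert hN (gen P (last_vertex y)) (F (bd (gen P (degen k y) : gpd P n.+2))) =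
  (\sum_(k.+2 <= i < n.+4) sgn (n.+3 - i)
    (vert hN (gen P (last_vertex y)) (degen_term i)))%R.
Proof.
have vE : last_vertex (degen k y) = last_vertex y by rewrite last_vertex_degen.
have := bd_sum hN hF (degen k y); rewrite vE => ->.
rewrite (alternating_split _ (k := k)) // big_nat_cond big1 ?GRing.add0r;
  last first.
  move=> i /andP[/andP[_ ik] _]; have ilt : i < n.+3 by apply: leq_trans kn;
    apply: ltnW.
  have kS : k.-1.+1 = k by rewrite prednK // (leq_ltn_trans (leq0n i)).
  have k1 : k.-1 <= n.+1 by rewrite -ltnS kS.
  have i1 : i <= n.+1 by rewrite -ltnS; apply: leq_trans kn.
  rewrite /bd_term ltn_eqF // face_degen_lt // kills ?kS //.
  by rewrite last_vertex_face // vert0 sgn0.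
have -> : bd_term an F (degen k y) k = F (gen P y).
  by rewrite /bd_term ltn_eqF // face_degen_eq.
have -> : bd_term an F (degen k y) k.+1 = F (gen P y).
  by rewrite /bd_term face_degen_succ //; case: eqP => [[/triv]|].
rewrite GRing.subrr sgn0 GRing.add0r.
by apply: eq_big_nat => i /andP[ki ile]; rewrite bd_term_degen.
Qed.

End DegenerateBoundary.

(** * Detecting membership in one dimension *)

Section ClosedSets.
Variables (K : simplicialSet) (P : PiUpsilon K).
Local Notation A n := (@degeneracy K P setT n).

(* The normality conditions that involve only the dimension of [S]. *)
Record is_closed n (S : set (gpd P n.+1)) : Prop := IsClosed {
  closed_idn : forall p, S (idn p);
  closed_add : forall x y, S x -> S y -> tgt x = tgt y -> S (x + y);
  closed_opp : forall x, S x -> S (- x);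
  closed_act : forall x a, S x -> tgt x = src a -> S (act x a);
  closed_diff : forall x (a : gpd P 0), A 1 a -> tgt x = src a ->
    S (x - act x a)
}.

Let L n := loop (act_action P n).
Let T n := action_tgt (act_action P n).

Lemma degenerate_edge v : A 1 (gen P (degen 0 v)).
Proof. exact: gen_degeneracy. Qed.

(** The order of the summands matters here, so the three degeneracies are treated by hand. In each,
    the equal pair of faces is brought together by conjugating degenerate terms. *)
Lemma closed_bd2 (S : set (gpd P 1)) : is_closed S ->
  (forall i (y : K 1), i <= 1 -> S (gen P (degen i y))) ->
  forall i (y : K 2), i <= 2 -> S (bd (gen P (degen i y) : gpd P 2)).
Proof.
case=> S0 Sa So Sc Sd Sg k y kn.
(* By Peiffer, conjugation in dimension two is the action of a boundary. *)
have SC x z : S x -> tgt x = tgt z -> S (z + x - z).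
  move=> Sx e; rewrite -{1}(oppK z) (crossed_peiffer (cc_crossed P)).
    by apply: (Sc) => //; rewrite bd_src tgt_opp L.
  by rewrite tgt_opp L.
set x := degen k y.
have vE : last_vertex x = last_vertex y by rewrite last_vertex_degen.
have tE i : i <= 2 -> tgt (gen P (face i x) : gpd P 1) = gen P (last_vertex y).
  by move=> ile; rewrite gen_tgt last_vertex_face // vE.
have su : tgt (gen P (face 3 x) : gpd P 1) = src
  (gen P (last_edge x) : gpd P 0).
  by rewrite gen_tgt gen_src_last_edge.
have t3 : tgt (act (gen P (face 3 x) : gpd P 1) (gen P (last_edge x))) = gen P
  (last_vertex y).
  by rewrite T // gen_tgt_last_edge vE.
have l3 := L (act (gen P (face 3 x) : gpd P 1) (gen P (last_edge x))).
have l0 := L (gen P (face 0 x)); have l1 := L (gen P (face 1 x)).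
have l2 := L (gen P (face 2 x)); have t0 := tE 0 isT.
have t1 := tE 1 isT; have t2 := tE 2 isT.
rewrite gen_bd3.
case: k kn @x vE {tE} su t3 l3 l0 l1 l2 t0 t1 t2 => [|[|[|//]]] _ x vE su t3 l3
  l0 l1 l2 t0 t1 t2.
- have S3 : S (gen P (face 3 x)) by rewrite /x face_degen_gt //; apply: Sg.
  have : S (gen P (face 2 x)) by rewrite /x face_degen_gt //; apply: Sg.
  have := Sc _ _ S3 su.
  have e01 : face 0 x = face 1 x by rewrite /x face_degen_eq ?face_degen_succ.
  move: l0 t0; rewrite e01 => _ _.
  move: (act _ _) (gen P (face 1 x)) (gen P (face 2 x)) t3 l3 l1 l2 t1 t2.
  move=> w z e *.
  have -> : w - z - e + z = w + (- z - e + z) by rewrite !addA; gside.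
  apply: (Sa) => //; last by gside.
  rewrite -{2}(oppK z); apply: (SC); last by gside.
  exact: So.
- have S3 : S (gen P (face 3 x)) by rewrite /x face_degen_gt //; apply: Sg.
  have : S (gen P (face 0 x)) by rewrite /x face_degen_lt //; apply: Sg.
  have := Sc _ _ S3 su.
  have e12 : face 1 x = face 2 x by rewrite /x face_degen_eq ?face_degen_succ.
  move: l1 t1; rewrite e12 => _ _.
  move: (act _ _) (gen P (face 0 x)) (gen P (face 2 x)) t3 l3 l0 l2 t0 t2.
  move=> w e z *.
  have -> : w - e - z + z = w - e by rewrite addrNK //; gside.
  by apply: (Sa); [|exact: So|gside].
(* Faces 2 and 3 are both [y], but the latter is twisted by the last edge. That edge is degenerate,
   so the difference lies in [S] by [closed_diff]. *)
- have := Sd (gen P y) (gen P (last_edge x)).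
  have : S (gen P (face 0 x)) by rewrite /x face_degen_lt //; apply: Sg.
  have : S (gen P (face 1 x)) by rewrite /x face_degen_lt //; apply: Sg.
  have y2 : face 2 x = y by rewrite /x face_degen_eq.
  have y3 : face 3 x = y by rewrite /x face_degen_succ.
  move: su t3 l3 l2 t2; rewrite y2 y3 => su t3 l3 l2 t2 S1 S0' /(_ _ su) Su.
  have {}Su : S (gen P y - act (gen P y) (gen P (last_edge x))).
    by apply: Su; rewrite /x last_edge_degen_top; apply: degenerate_edge.
  move: Su S1 S0'.
  move: (gen P y) (gen P (face 0 x)) (gen P (face 1 x)) (act _ _) t3 l3 l0 l1 l2
    t0 t1 t2.
  move=> z e e' w *.
  have -> : w - e - z + e' = - (z - w) + ((z - e - z) + e').
    by rewrite oppD ?oppK ?addA; gside; rewrite addrNK //; gside.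
  apply: (Sa); [exact: So| |by gside].
  apply: (Sa) => //; last by gside.
  by apply: (SC); [exact: So|gside].
Qed.

Lemma closed_bd n (S : set (gpd P n.+1)) : is_closed S ->
  (forall i (y : K n.+1), i <= n.+1 -> S (gen P (degen i y))) ->
  forall i (y : K n.+2), i <= n.+2 -> S (bd (gen P (degen i y) : gpd P n.+2)).
Proof.
case: n S => [|n] S; first exact: closed_bd2.
move=> [S0 Sa So Sc Sd] Sg k y kn.
have top : k = n.+3 -> last_edge (degen k y) = degen 0 (last_vertex y) /\
    face n.+4 (degen k y) = y.
  by move=> ->; rewrite last_edge_degen_top face_degen_succ.
have hE : is_equivariant (@act P n.+1) (@act P n.+1) id by split.
have hN := cc_module P n.
set v := gen P (last_vertex (degen k y)).
have vE : last_vertex (degen k y) = last_vertex y by rewrite last_vertex_degen.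
pose S' (w : vertex hN v) := S (sval w).
have SD w w' : S' w -> S' w' -> S' (w + w')%R.
  move=> h h'; rewrite /S' [sval _]restrict_groupoid_addE //.
  by apply: (Sa) => //; rewrite (svalP w) (svalP w').
have SN w : S' w -> S' (- w)%R.
  by move=> h; rewrite /S' [sval _]restrict_groupoid_oppE //; apply: So.
have Ss m w : S' w -> S' (sgn m w) by rewrite /sgn; case: odd => //; apply: SN.
have SV x : tgt x = v -> S x -> S' (vert hN v x) by move=> e; rewrite /S' vertK.
have SS m m' (F : nat -> vertex hN v) : (forall i, m <= i < m' -> S' (F i)) ->
    S' (\sum_(m <= i < m') F i)%R.
  move=> SF; rewrite big_nat_cond; apply: big_ind => //.
    by rewrite -(vert0 hN v); apply: (SV); rewrite ?tgt_idn.
  by move=> i /andP[/SF].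
suff : S' (vert hN v (bd (gen P (degen k y) : gpd P n.+3))).
  by rewrite /S' vertK // bd_tgt gen_tgt.
rewrite (bd_sum hN hE (degen k y)) (alternating_split _ (k := k)) //.
have tt i : i <= n.+4 -> tgt (bd_term (@act P n.+1) id (degen k y) i) = v.
  exact: (tgt_bd_term hN hE).
have Sact j (z : K n.+2) : j <= n.+2 ->
    gen P (last_vertex z) = src (gen P (last_edge (degen k y)) : gpd P 0) ->
    S (act (gen P (degen j z) : gpd P n.+2) (gen P (last_edge (degen k y)))).
  move=> jn e; apply: (Sc); first exact: Sg.
  by rewrite gen_tgt last_vertex_degen.
apply: (SD); first apply: SD.
- apply: (SS) => i /andP[_ ik]; have ilt : i < n.+4 by apply: leq_trans kn;
    apply: ltnW.
  apply: (Ss); apply: (SV); first by apply: tt; apply: ltnW.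
  have kS : k.-1.+1 = k by rewrite prednK // (leq_ltn_trans (leq0n i)).
  have k1 : k.-1 <= n.+2 by rewrite -ltnS kS.
  by rewrite /bd_term ltn_eqF // face_degen_lt //; apply: Sg.
- apply: Ss.
  have tk := tt _ (leqW kn); have tk1 := tt k.+1 kn.
  rewrite -vertN // -vertD //; last by rewrite tgt_opp L.
  apply: (SV); first by rewrite tgt_add ?tgt_opp ?src_opp ?L ?tk ?tk1.
  rewrite {1}/bd_term ltn_eqF // face_degen_eq //.
  rewrite /bd_term face_degen_succ //; case: eqP => [[ke]|_]; last first.
    by rewrite addrN.
  have [e1 e2] := top ke.
  apply: (Sd); last by rewrite gen_tgt gen_src_last_edge e2.
  by rewrite e1; apply: degenerate_edge.
- apply: (SS) => i /andP[ki ile]; apply: (Ss); apply: (SV); first exact: tt.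
  have k2 : k <= n.+2 by rewrite -2!ltnS; apply: leq_trans ki ile.
  rewrite /bd_term face_degen_gt //; case: eqP => [ie|_];
    last exact: (Sg _ _ k2).
  apply: (Sact) => //; rewrite gen_src_last_edge.
  by rewrite -[in RHS]ie face_degen_gt // last_vertex_degen.
Qed.

Lemma preimage_bd_closed n (S : set (gpd P n.+1)) : is_closed S ->
  is_closed (@bd P n.+1 @^-1` S).
Proof.
move=> [S0 Sa So Sc Sd]; have hE := cc_bd P n.
split=> /=.
- by move=> p; rewrite bd_idn.
- by move=> x y hx hy e; rewrite bd_add //; apply: Sa; rewrite ?bd_tgt.
- by move=> x hx; rewrite bd_opp; apply: So.
- by move=> x a hx e; rewrite (equivariant_act hE) //; apply: Sc;
    rewrite ?bd_tgt.
- move=> x a ha e; have la := normal_loop (degeneracy_normal P setT) ha.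
  rewrite bd_add ?bd_opp ?(equivariant_act hE) //.
    by apply: Sd; rewrite ?bd_tgt.
  by rewrite tgt_opp L T // e.
Qed.

(* Lets a set of cells of dimension [k] enter the definition of a subcrossed
   complex, whose members are indexed by all dimensions. *)
Definition at_level k (S : set (cell P k)) m (x : cell P m) : Prop :=
  forall e : m = k, S (eq_rect m (cell P) x k e).

Lemma at_levelE k (S : set (cell P k)) (x : cell P k) : at_level S x <-> S x.
Proof. by split=> [/(_ erefl)|Sx e] //; rewrite eq_axiomK. Qed.

Section AtLevel.
Variables (k : nat) (S : set (gpd P k.+1)).
Hypothesis hS : is_closed S.
Notation B m := (@at_level k.+2 S m).

Let level m : (m = k.+1) \/ (forall x : cell P m.+1, B m.+1 x).
Proof.
have [->|mk] := eqVneq m k.+1; [by left|right=> x e].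
by case/eqP: mk; case: e.
Qed.

Lemma at_level_idn m p : B m.+1 (idn p : gpd P m).
Proof. by case: (level m) => [->|//]; apply/at_levelE/(closed_idn hS). Qed.

Lemma at_level_add m (x y : gpd P m) : B m.+1 x -> B m.+1 y -> tgt x = src y ->
  B m.+1 (x + y).
Proof.
case: (level m) => [E|//]; subst m => /at_levelE hx /at_levelE hy e.
by apply/at_levelE/(closed_add hS); rewrite // e L.
Qed.

Lemma at_level_opp m (x : gpd P m) : B m.+1 x -> B m.+1 (- x).
Proof.
case: (level m) => [E|//]; subst m => /at_levelE hx.
exact/at_levelE/(closed_opp hS).
Qed.

Lemma at_level_act m (x : gpd P m.+1) a : B m.+2 x -> tgt x = src a ->
  B m.+2 (act x a).
Proof.
case: (level m.+1) => [[E]|//]; subst m => /at_levelE hx e.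
exact/at_levelE/(closed_act hS).
Qed.

Lemma at_level_diff m (x : gpd P m.+1) (a : gpd P 0) : A 1 a -> tgt x = src a ->
  B m.+2 (x - act x a).
Proof.
case: (level m.+1) => [[E]|//]; subst m => ha e.
exact/at_levelE/(closed_diff hS).
Qed.

End AtLevel.

(** Cut [A] down to [S] in dimension [n.+2] and to the preimage of [S] under [bd] in dimension
    [n.+3]. The result is closed under [bd], since [bd bd] is trivial one dimension further up, and
    contains the generators by [closed_bd]; being normal, it is all of [A]. *)
Lemma degeneracy_closed n (S : set (gpd P n.+1)) : is_closed S ->
  (forall i (y : K n.+1), i <= n.+1 -> S (gen P (degen i y))) ->
  A n.+2 `<=` S.
Proof.
move=> hS Sg; have hS' := preimage_bd_closed hS.
have hA := degeneracy_normal P setT; have sA := normal_sub hA.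
pose B m : set (cell P m) := fun x => [/\ A m x, at_level (k := n.+2) S x
  & at_level (k := n.+3) (@bd P n.+1 @^-1` S) x].
have B0 (p : ob P) : B 0 p by split=> //; rewrite (normal_ob hA).
suff hB : is_normal B.
  move=> x /(degeneracy_sub hB)[|_ /at_levelE //].
  move=> m i y _ ile; split.
  - exact: gen_degeneracy.
  - move=> e; have [em] : m = n.+1 by case: e.
    by move: i y ile e; rewrite em => i y ile e; rewrite eq_axiomK; apply: Sg.
  - move=> e; have [em] : m = n.+2 by case: e.
    move: i y ile e; rewrite em => i y ile e; rewrite eq_axiomK.
    exact: (closed_bd hS Sg).
split; first split.
- by move=> m x _; apply: B0.
- by move=> m x _; apply: B0.
- move=> m p _; split; [|exact: at_level_idn|exact: at_level_idn].
  by apply: (sub_idn sA); rewrite (normal_ob hA).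
- move=> m x y [a b c] [a' b' c'] e; split;
    [|exact: at_level_add|exact: at_level_add].
  exact: (sub_add sA).
- move=> m x [a b c]; split; [|exact: at_level_opp|exact: at_level_opp].
  exact: (sub_opp sA).
- move=> m x a [h b c] _ e; split; [|exact: at_level_act|exact: at_level_act].
  exact: (normal_act hA).
- move=> m x [a b c]; split; first exact: (sub_bd sA).
  + move=> e; have em : m = n.+1 by case: e.
    move: x a b c e; rewrite em => x a b /at_levelE c e; rewrite eq_axiomK //.
  + move=> e; have em : m = n.+2 by case: e.
    move: x a b c e; rewrite em => x a b c e; rewrite eq_axiomK /=.
    by rewrite cc_bdbd; apply: (closed_idn hS).
- by apply/seteqP; split=> // x _; apply: B0.
- by move=> x [h _ _]; apply: (normal_loop hA).
- by move=> x c [h _ _] e; split=> //; apply: (normal_conj hA).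
- move=> m x a [h b c] e; split; [|exact: at_level_act|exact: at_level_act].
  exact: (normal_act hA).
- move=> m x a [h _ _] e; split; [|exact: at_level_diff|exact: at_level_diff].
  exact: (normal_diff hA).
Qed.

(** The same argument one dimension lower. The boundary of a degenerate 2-simplex is a conjugate of
    a degenerate edge, or such an edge itself. *)
Lemma degeneracy_td_normal (S : set (gpd P 0)) : td_normal S ->
  (forall v, S (gen P (degen 0 v))) -> A 1 `<=` S.
Proof.
move=> hS Sg; have [Sl S0 Sa So Sc] := hS.
have hA := degeneracy_normal P setT; have sA := normal_sub hA.
pose B m : set (cell P m) := match m with
  | 1 => fun x => A 1 x /\ S x
  | 2 => fun x => A 2 x /\ S (bd (x : gpd P 1))
  | m => A m end.
have B0 (p : ob P) : B 0 p by rewrite /B (normal_ob hA).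
have BA m : B m `<=` A m by case: m => [|[|[|m]]] // x [].
have bS := bd_src; have bT := bd_tgt.
suff hB : is_normal B.
  move=> x /(degeneracy_sub hB)[|_ //].
  move=> m i y _ ile; have Ag : A m.+1 (gen P (degen i y)) by apply:
    gen_degeneracy.
  case: m y ile Ag => [|[|m]] // y ile Ag; split=> //.
    by case: i ile {Ag} => // _; apply: Sg.
  have vE : last_vertex (degen i y) = last_vertex y
    by rewrite last_vertex_degen.
  have t1 : tgt (gen P (face 1 (degen i y)) : gpd P 0) = gen P (last_vertex y).
    by rewrite gen_tgt last_vertex_face // vE.
  have t0 : tgt (gen P (face 0 (degen i y)) : gpd P 0) = gen P (last_vertex y).
    by rewrite gen_tgt last_vertex_face // vE.
  have s0 : src (gen P (face 0 (degen i y)) : gpd P 0) =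
      tgt (gen P (face 2 (degen i y)) : gpd P 0).
    by rewrite gen_tgt1 gen_src1 (@face_face _ _ 0 2).
  rewrite gen_bd2; case: i ile {Ag vE} t0 t1 s0 => [|[|//]] _ t0 t1 s0.
    have Se : S (gen P (face 2 (degen 0 y))) by rewrite face_degen_gt.
    by move: t0 t1 s0; rewrite face_degen_eq // face_degen_succ // => t0 t1 s0;
      apply: Sc.
  have Se : S (gen P (face 0 (degen 1 y))) by rewrite face_degen_lt.
  move: t0 t1 s0; rewrite face_degen_eq // face_degen_succ // => t0 t1 s0.
  by rewrite addN t1 -t0 -(Sl _ Se) add0.
split; first split.
- by move=> m x _; apply: B0.
- by move=> m x _; apply: B0.
- move=> m p _; have Ap : A m.+1 (idn p : gpd P m).
    by apply: (sub_idn sA); rewrite (normal_ob hA).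
  by case: m Ap => [|[|m]] // Ap; split; rewrite ?bd_idn.
- move=> m x y hx hy e.
  have Axy : A m.+1 (x + y) := sub_add sA (BA _ _ hx) (BA _ _ hy) e.
  case: m x y hx hy e Axy => [|[|m]] // x y [_ hx] [_ hy] e Axy; split=> //.
    exact: Sa.
  have e' : tgt x = tgt y by rewrite e L.
  by rewrite bd_add //; apply: (Sa) => //; rewrite bT bS.
- move=> m x hx; have Ax : A m.+1 (- x) := sub_opp sA (BA _ _ hx).
  by case: m x hx Ax => [|[|m]] // x [_ hx] Ax; split; rewrite ?bd_opp //;
    apply: So.
- move=> m x a hx [_ ha] e.
  have Ax : A m.+2 (act x a) := normal_act hA (BA _ _ hx) e.
  case: m x hx e Ax => [|m] // x [_ hx] e Ax; split=> //.
  by rewrite (crossed_act (cc_crossed P)) //; apply: Sc; rewrite ?bT.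
- move=> m x hx; have Ax : A m.+1 (bd x) := sub_bd sA (BA _ _ hx).
  case: m x hx Ax => [|[|m]] // x hx Ax; split=> //; first by case: hx.
  by rewrite cc_bdbd.
- by apply/seteqP; split=> // x _; apply: B0.
- by move=> x [h _]; apply: (normal_loop hA).
- move=> x c [h h'] e; split; first exact: (normal_conj hA).
  exact: Sc.
- move=> m x a hx e.
  have Ax : A m.+2 (act x a) := normal_act hA (BA _ _ hx) e.
  case: m x hx e Ax => [|m] // x [_ hx] e Ax; split=> //.
  by rewrite (crossed_act (cc_crossed P)) //; apply: Sc; rewrite ?bT.
- move=> m x a [ha ha'] e.
  have Ax : A m.+2 (x - act x a) := normal_diff hA ha e.
  case: m x e Ax => [|m] // x e Ax; split=> //.
  have la := Sl _ ha'.
  rewrite bd_add ?bd_opp ?(crossed_act (cc_crossed P)) //; last first.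
    by rewrite tgt_opp L T // e.
  have := bS _ _ x; have := bT _ _ x; move: (bd x) => u tu su.
  (* The boundary of [x - act x a] is a commutator of [bd x] and [a]: a conjugate of [- a] followed
     by [a], both in [S]. *)
  have -> : u - (- a + u + a) = (- - u - a - u) + a.
    rewrite oppK oppD ?oppD ?oppK; gside.
    by rewrite !addA; gside.
  apply: (Sa) => //; last by gside.
  by apply: Sc; [exact: So|gside].
Qed.

End ClosedSets.

(** * Maps that are trivial on degenerate generators *)

Section Kernels.
Variables (K : simplicialSet) (P : PiUpsilon K).
Local Notation A n := (@degeneracy K P setT n).

(** The kernel of [F] is a closed set: [closed_diff] holds because the loops in [A 1] fix the values
    of [F]. *)
Lemma degeneracy_kernel n (N : groupoid (ob P)) (an : N -> gpd P 0 -> N)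
    (F : gpd P n.+1 -> N) :
  is_action an -> is_equivariant (@act P n) an F ->
  (forall x (a : gpd P 0), A 1 a -> tgt x = src a -> an (F x) a = F x) ->
  (forall i (y : K n.+1), i <= n.+1 ->
     F (gen P (degen i y)) = idn (gen P (last_vertex y))) ->
  forall x, A n.+2 x -> F x = idn (tgt x).
Proof.
move=> han [hF Fact] triv Fg x.
have L := loop (act_action P n).
suff hS : is_closed (P := P) [set x | F x = idn (tgt x)].
  apply: (degeneracy_closed hS) => i y ile /=.
  by rewrite Fg // gen_tgt last_vertex_degen.
split=> /=.
- by move=> p; rewrite (functor_idn hF) tgt_idn.
- move=> y z ey ez e; have e' : tgt y = src z by rewrite e L.
  by rewrite (functor_add hF) // ey ez e idnDidn tgt_add.
- by move=> y ey; rewrite (functor_opp hF) ey idnN tgt_opp L.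
- move=> y a ey e; rewrite Fact // ey (action_idm han) //.
  by rewrite (action_tgt (act_action P n)).
- move=> y a ha e; have la := normal_loop (degeneracy_normal P setT) ha.
  have e' : tgt y = src (- act y a).
    by rewrite src_opp (action_tgt (act_action P n)) // -la.
  rewrite (functor_add hF) // (functor_opp hF) Fact // triv // addrN.
  by rewrite (functor_src hF) tgt_add // tgt_opp (src_action (act_action P n))
    // -la -e L.
Qed.

Lemma degeneracy_kernel1 (O : Type) (H : groupoid O) (F0 : ob P -> O)
    (F : gpd P 0 -> H) :
  is_functor F0 F -> (forall v, F (gen P (degen 0 v)) = idn (F0 (gen P v))) ->
  forall x, A 1 x -> F x = idn (F0 (tgt x)).
Proof.
move=> hF Fg x.
suff hS : td_normal [set x : gpd P 0 | src x = tgt x /\ F x = idn (F0 (tgt x))].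
  move=> /(degeneracy_td_normal hS) h; apply h => v /=.
  by rewrite gen_src1 gen_tgt1 face_degen_eq // face_degen_succ.
split=> /=.
- by move=> y [].
- by move=> p; rewrite (functor_idn hF) src_idn tgt_idn.
- move=> y z [ly ey] [lz ez] e;
    rewrite src_add // tgt_add // (functor_add hF) //.
  by rewrite ly ey ez e lz idnDidn.
- by move=> y [ly ey]; rewrite src_opp tgt_opp (functor_opp hF) ey idnN ly.
- move=> y c [ly ey] e; have e1 : tgt (- c) = src y by rewrite tgt_opp ly.
  have e2 : tgt (- c + y) = src c by rewrite tgt_add.
  rewrite src_add // src_add // src_opp tgt_add //; split=> //.
  rewrite (functor_add hF) // (functor_add hF) // (functor_opp hF) ey.
  by rewrite idn_conj ?(functor_tgt hF) // (functor_src hF) e.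
Qed.

End Kernels.

(** * Maps prescribed on the free generators *)

Section ExtensionFromGenerators.
Variables (K : simplicialSet) (P : PiUpsilon K).

Lemma gen_inj n : injective (@gen _ P n).
Proof. by move=> x y; case: (gen_free P) => h _; apply: h. Qed.

(** Freeness takes its data as a function on all cells. Injectivity of [gen] makes the chosen
    simplex the right one. *)
Definition on_gens n (T : Type) (d : gpd P n -> T) (f : K n.+1 -> T)
    (c : gpd P n) : T :=
  if pselect (exists x : K n.+1, (gen P x : gpd P n) = c) is left e then f
    (sval (cid e)) else d c.

Lemma on_gensE n T (d : gpd P n -> T) f (x : K n.+1) :
  on_gens d f (gen P x) = f x.
Proof.
rewrite /on_gens; case: pselect => [e|[]]; last by exists x.
by congr f; apply: gen_inj; case: cid.
Qed.

Lemma gen_free_complex : free_crossed_complex (fun n => @gen _ P n @` setT).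
Proof. by case: (gen_free P). Qed.

Lemma gen_functor (O : Type) (H : groupoid O) (F0 : ob P -> O) (f : K 1 -> H) :
  (forall x, src (f x) = F0 (gen P (face 1 x)) /\ tgt (f x) = F0
    (gen P (face 0 x))) ->
  exists F : gpd P 0 -> H, is_functor F0 F /\ forall x : K 1, F (gen P x) = f x.
Proof.
move=> hf; have [_ h1 _ _] := gen_free_complex.
have [|[F [hF FR]] _] :=
    h1 _ H F0 (on_gens (fun c => idn (F0 (tgt c))) f).
  by move=> _ [x _ <-]; rewrite on_gensE gen_src1 gen_tgt1.
by exists F; split=> // x; rewrite FR ?on_gensE.
Qed.

Lemma functor_unique (O : Type) (H : groupoid O) (F0 : ob P -> O)
  (F F' : gpd P 0 -> H) :
  is_functor F0 F -> is_functor F0 F' ->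
  (forall x : K 1, F (gen P x) = F' (gen P x)) -> F =1 F'.
Proof.
move=> hF hF' FF'; have [_ h1 _ _] := gen_free_complex.
have [|_ u] := h1 _ H F0 F.
  by move=> r _; rewrite (functor_src hF) (functor_tgt hF).
by apply: u; split=> // _ [x _ <-].
Qed.

Lemma gen_derivation (N : groupoid (ob P)) (an : N -> gpd P 0 -> N)
  (f : K 1 -> N) :
  is_action an -> (forall x, tgt (f x) = gen P (last_vertex x)) ->
  exists h : gpd P 0 -> N, is_derivation an h /\ forall x :
    K 1, h (gen P x) = f x.
Proof.
move=> han hf; have [_ h1 _ _] := gen_free_complex.
have [|F [hF FR]] := derivation_extension han h1
    (phi := on_gens (fun c => idn (tgt c)) f).
  by move=> _ [x _ <-]; rewrite on_gensE hf gen_tgt.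
by exists F; split=> // x; rewrite FR ?on_gensE.
Qed.

Lemma derivation_gen_unique (N : groupoid (ob P)) (an : N -> gpd P 0 -> N)
    (h h' : gpd P 0 -> N) :
  is_action an -> is_derivation an h -> is_derivation an h' ->
  (forall x : K 1, h (gen P x) = h' (gen P x)) -> h =1 h'.
Proof.
move=> han dh dh' hh'; have [_ h1 _ _] := gen_free_complex.
by apply: (derivation_unique han h1) => // _ [x _ <-].
Qed.

Lemma gen_linear n (N : groupoid (ob P)) (an : N -> gpd P 0 -> N)
  (f : K n.+2 -> N) :
  is_pi1_module an -> (forall x, tgt (f x) = gen P (last_vertex x)) ->
  exists F : gpd P n.+1 -> N,
    is_equivariant (@act P n) an F /\ forall x : K n.+2, F (gen P x) = f x.
Proof.
move=> hN hf.
have [|F [hF FR]] := linear_extension gen_free_complex hN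
    (phi := on_gens (n := n.+1) (fun c => idn (tgt c)) f).
  by move=> _ [x _ <-]; rewrite on_gensE hf gen_tgt.
by exists F; split=> // x; rewrite FR ?on_gensE.
Qed.

Lemma linear_gen_unique n (N : groupoid (ob P)) (an : N -> gpd P 0 -> N)
    (F F' : gpd P n.+1 -> N) :
  is_pi1_module an -> is_equivariant (@act P n) an F ->
  is_equivariant (@act P n) an F' ->
  (forall x : K n.+2, F (gen P x) = F' (gen P x)) -> F =1 F'.
Proof.
move=> hN hF hF' FF'.
by apply: (linear_unique gen_free_complex hN) => // _ [x _ <-].
Qed.

Definition is_linear n (h : gpd P n -> gpd P n.+1) : Prop :=
  match n return (gpd P n -> gpd P n.+1) -> Prop with
  | 0 => is_derivation (@act P 0)
  | m.+1 => is_equivariant (@act P m) (@act P m.+1)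
  end h.

Lemma gen_is_linear n (f : K n.+1 -> gpd P n.+1) :
  (forall x, tgt (f x) = gen P (last_vertex x)) ->
  exists h : gpd P n -> gpd P n.+1, is_linear h /\ forall x :
    K n.+1, h (gen P x) = f x.
Proof.
case: n f => [|n] f hf; first exact: (gen_derivation (act_action P 0)).
exact: (gen_linear (cc_pi1_module P n)).
Qed.

(** A total choice of extension, so that [contraction] and [filling] can be defined by equations;
    the default occurs only if no linear extension of [f] exists. *)
Definition extend n (f : K n.+1 -> gpd P n.+1) : gpd P n -> gpd P n.+1 :=
  if pselect (exists h : gpd P n -> gpd P n.+1, is_linear h /\ forall x :
    K n.+1, h (gen P x) = f x) is left e
  then sval (cid e) else fun c => idn (tgt c).

Lemma extendP n (f : K n.+1 -> gpd P n.+1) :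
  (forall x, tgt (f x) = gen P (last_vertex x)) ->
  is_linear (extend f) /\ forall x : K n.+1, extend f (gen P x) = f x.
Proof.
move=> hf; rewrite /extend; case: pselect => [e|[]]; last exact: gen_is_linear.
by case: cid.
Qed.

Lemma is_deformationP (h : forall n, cell P n -> gpd P n) :
  (forall p, h 0 p = idn p) -> (forall n, is_linear (h n.+1)) ->
  is_deformation h.
Proof. by move=> h0 hS; split=> // [|n]; [exact: (hS 0)|exact: (hS n.+1)]. Qed.

End ExtensionFromGenerators.

(** * Restriction of an action along a functor *)

Section RestrictedAction.
Variables (O : Type) (G G' M : groupoid O) (am : M -> G' -> M) (f : G -> G').
Hypothesis hf : is_functor id f.

Definition restricted_act (x : M) (a : G) : M := am x (f a).

Lemma restricted_action : is_action am -> is_action restricted_act.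
Proof.
case: hf => fs ft fa; case=> al at_ ai ac aa; rewrite /restricted_act;
  split=> //.
- by move=> x a e; rewrite at_ ?fs ?ft.
- by move=> x; rewrite (functor_idn hf).
- by move=> x a b e e'; rewrite fa // ac ?fs ?ft.
- by move=> x y a e e'; rewrite aa ?fs.
Qed.

Lemma restricted_module : is_module am -> is_module restricted_act.
Proof. by case=> ha hc; split=> //; apply: restricted_action. Qed.

End RestrictedAction.

Lemma quotient_idn (C : crossedComplex) (E : forall n, set (cell C n))
    (hE : is_normal E) n (x : gpd C n) :
  (quotient_morphism hE n.+1 x : gpd (quotient hE) n) = idn (tgt x) -> E n.+1 x.
Proof.
rewrite -(functor_idn (mor_functor (quotient_morphism hE) n)) => /qprojP [_ _].
by rewrite idnN addr0.
Qed.

Lemma signed_functor (O : Type) (G H : groupoid O) (F : G -> H) m x :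
  is_functor id F -> F (signed m x) = signed m (F x).
Proof. by move=> hF; rewrite /signed; case: odd => //;
  apply: functor_opp hF _. Qed.

(** * A deformation lowering the degeneracy filtration *)

Section Contraction.
Variables (K : simplicialSet) (P : PiUpsilon K).
Local Notation G k n := (@degeneracy K P [set i | i < k] n).
Local Notation A n := (@degeneracy K P setT n).
Local Notation Q k := (quotient_morphism (degeneracy_normal P [set i | i < k])).

Definition degenerate_at n (x : K n.+1) (k : nat) : bool :=
  `[< k <= n /\ exists y, x = degen k y >].

(* The least degeneracy index makes [shift] compatible with the filtration. *)
Definition shift n (x : K n.+1) : gpd P n.+1 :=
  if pselect (exists k, degenerate_at x k) is left e then
    signed (n.+1 - ex_minn e) (gen P (degen (ex_minn e) x))
  else idn (gen P (last_vertex x)).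

Let L n := loop (act_action P n).

Lemma shift_degen n k (z : K n) : k <= n -> exists j w,
  [/\ j <= k, degen k z = degen j w &
      shift (degen k z) = signed (n.+1 - j) (gen P (degen j (degen k z)))].
Proof.
move=> kn; have d : degenerate_at (degen k z) k by apply/asboolP; split=> //;
  exists z.
rewrite /shift; case: pselect => [e|[]]; last by exists k.
case: ex_minnP => j /asboolP[_ [w zw]] jmin.
by exists j, w; split=> //; apply: jmin.
Qed.

Lemma shift_tgt n (x : K n.+1) : tgt (shift x) = gen P (last_vertex x).
Proof.
rewrite /shift; case: pselect => [e|_]; last by rewrite tgt_idn.
case: ex_minnP => j /asboolP[jn _] _.
rewrite (tgt_signed _ _ (act_action P n)) gen_tgt last_vertex_degen //.
exact: leqW.
Qed.

Lemma shift_degen0 n (z : K n) :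
  shift (degen 0 z) = signed n.+1 (gen P (degen 0 (degen 0 z))).
Proof.
have [j [w [j0 zw ->]]] := shift_degen z (leq0n n).
by move: j0 zw; rewrite leqn0 => /eqP -> _; rewrite subn0.
Qed.

Lemma degeneracy_idn k n p : G k n.+1 (idn p : gpd P n).
Proof.
apply: (sub_idn (normal_sub (degeneracy_normal P _))).
by rewrite (normal_ob (degeneracy_normal P _)).
Qed.

Lemma signed_degeneracy k n m (x : gpd P n) : G k n.+1 x ->
  G k n.+1 (signed m x).
Proof.
move=> hx; rewrite /signed; case: odd => //.
exact: (sub_opp (normal_sub (degeneracy_normal P _))).
Qed.

Lemma shift_degeneracy k n j (z : K n) : j < k -> j <= n ->
  G k n.+2 (shift (degen j z)).
Proof.
move=> jk jn; have [i [w [ij _ ->]]] := shift_degen z jn.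
apply: signed_degeneracy; apply: gen_degeneracy => /=;
  first exact: leq_ltn_trans jk.
by apply: leq_trans ij _; apply: leqW.
Qed.

(** Modulo [G k] the choice of the least index is invisible: if that index [j] is below [k], both
    sides lie in [G k]. *)
Lemma shift_quotient k n (z : K n) : k <= n ->
  Q k n.+2 (shift (degen k z)) =
  signed (n.+1 - k) (Q k n.+2 (gen P (degen k (degen k z))) :
    gpd (quotient _) n.+1).
Proof.
move=> kn; rewrite -(signed_functor _ _ (mor_functor (Q k) n.+1)).
have [j [w [jk zw hz]]] := shift_degen z kn.
move: jk; rewrite leq_eqVlt => /orP[/eqP jk|jk]; first by rewrite hz jk.
have E1 : G k n.+2 (shift (degen k z)).
  rewrite hz; apply: signed_degeneracy; apply: gen_degeneracy => //=.
  by apply: ltnW; apply: leq_trans jk _; apply: leqW.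
have E2 : G k n.+2 (signed (n.+1 - k)
  (gen P (degen k (degen k z)) : gpd P n.+1)).
  apply: signed_degeneracy.
  have kS : k.-1.+1 = k by rewrite prednK // (leq_ltn_trans (leq0n j)).
  (* Rewriting the inner degeneracy as [degen j w] and exchanging the two brings the smaller index
     outside. *)
  have -> : degen k (degen k z) = degen j (degen k.-1 w).
    rewrite zw [RHS]degen_degen ?kS //; first by rewrite -ltnS kS.
    exact: leq_trans (leq_pred k) kn.
  apply: gen_degeneracy => //=.
  by apply: ltnW; apply: leq_trans jk _; apply: leqW.
have [e1 e2] := (qproj_idn (degeneracy_normal P [set i | i < k]) E1,
  qproj_idn (degeneracy_normal P [set i | i < k]) E2).
rewrite [LHS]e1 [RHS]e2 shift_tgt (tgt_signed _ _ (act_action P n)) gen_tgt.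
by rewrite [in RHS]last_vertex_degen // leqW.
Qed.

Definition contraction n : cell P n -> gpd P n :=
  match n with 0 => fun p => idn p | m.+1 => extend (@shift m) end.
Arguments contraction : clear implicits.

Lemma contraction_deformation : is_deformation contraction.
Proof. by apply: is_deformationP => // n; case: (extendP (@shift_tgt n)). Qed.

Lemma contraction_gen n (x : K n.+1) : contraction n.+1 (gen P x) = shift x.
Proof. by have [_] := extendP (@shift_tgt n); apply. Qed.

Let T := deformation contraction_deformation.

Let T1 (c : gpd P 0) : T 1 c = c + bd (contraction 1 c) :> gpd P 0.
Proof. by []. Qed.

Let TS n (c : gpd P n.+1) :
  T n.+2 c = c + contraction n.+1 (bd c) + bd (contraction n.+2 c) :> gpd P
    n.+1.
Proof. by []. Qed.

Let lower1 (y : K 0) : T 1 (gen P (degen 0 y)) = idn (gen P y).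
Proof.
have s : src (gen P (degen 0 y) : gpd P 0) = gen P y
  by rewrite gen_src1 face_degen_succ.
have t : tgt (gen P (degen 0 y) : gpd P 0) = gen P y
  by rewrite gen_tgt1 face_degen_eq.
rewrite T1 contraction_gen shift_degen0 /signed [odd 1]/= bd_opp gen_bd2.
rewrite face_degen_eq // face_degen_succ // face_degen_gt // face_degen_succ //.
by rewrite addN t -{1}s add0 addrN s.
Qed.

(** [G 0] has only identities, so the value must vanish exactly. The value [H] of the contraction on
    [gen P y] enters by conjugation and drops out because [W - g], the boundary of
    [degen 0 (degen 0 y)], is central. *)
Let lower2_0 (y : K 1) : T 2 (gen P (degen 0 y)) = idn (gen P (last_vertex y)).
Proof.
set v := gen P (last_vertex y).
pose E := gen P (degen 0 (face 1 y)) : gpd P 0.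
have [ht hD] := deformation1 contraction_deformation.
have sy : src (gen P y : gpd P 0) = gen P (face 1 y) by rewrite gen_src1.
have ty : tgt (gen P y : gpd P 0) = v by rewrite gen_tgt.
have sE : src E = gen P (face 1 y) by rewrite gen_src1 face_degen_succ.
have tE : tgt E = gen P (face 1 y) by rewrite gen_tgt1 face_degen_eq.
have b2 : bd (gen P (degen 0 y) : gpd P 1) = - gen P y + E + gen P y.
  by rewrite gen_bd2 face_degen_eq // face_degen_succ // face_degen_gt.
pose W := act (gen P (degen 0 (degen 0 (face 1 y))) : gpd P 1) (gen P y).
have b3 : bd (gen P (degen 0 (degen 0 y)) : gpd P 2) =
    W - gen P (degen 0 y) - gen P (degen 0 y) + gen P (degen 0 y).
  have f3 : face 3 (degen 0 (degen 0 y)) = degen 0 (degen 0 (face 1 y)).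
    by rewrite !face_degen_gt.
  have f2 : face 2 (degen 0 (degen 0 y)) = degen 0 y.
    by rewrite face_degen_gt // [2.-1]/= face_degen_succ.
  rewrite gen_bd3 f3 f2 face_degen_eq // face_degen_succ //.
  by rewrite !last_edge_degen.
have AL := act_action P 0.
have hE : contraction 1 E = - gen P (degen 0 (degen 0 (face 1 y))) :> gpd P 1.
  by rewrite contraction_gen shift_degen0.
set H := contraction 1 (gen P y).
have tH : tgt H = v by rewrite ht gen_tgt.
have tW0 : tgt (gen P (degen 0 (degen 0 (face 1 y))) : gpd P 1) = gen P
  (face 1 y).
  by rewrite gen_tgt !last_vertex_degen.
have tW : tgt W = v by rewrite (action_tgt AL) ?tW0.
set g := gen P (degen 0 y) : gpd P 1.
have tg : tgt g = v by rewrite gen_tgt last_vertex_degen.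
(* The derivation rule applied to [- gen P y + E + gen P y]; the action of [bd g] on [H] becomes
   conjugation by [g]. *)
have hb : contraction 1 (bd g) = - g - H + g - W + H.
  rewrite b2 hD; last by gside.
  rewrite hD; last by gside.
  have t1 : tgt (contraction 1 (- gen P y)) = src E by rewrite ht; gside.
  rewrite (action_add AL); first last.
  - by rewrite (action_tgt AL) // tE sy.
  - by rewrite (action_tgt AL) // ht.
  rewrite -(action_comp AL) //; last by gside.
  rewrite (derivation_opp contraction_deformation) (action_opp AL); last first.
    by rewrite (action_tgt AL) ?ht; gside.
  rewrite -(action_comp AL) ?ht; [|by gside|by gside].
  rewrite addA; [|by gside|by gside].
  rewrite -b2 -(crossed_peiffer (cc_crossed P)) ?ht ?ty //.
  rewrite hE (action_opp AL) ?tW0 //.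
  have lg : src g = tgt g by apply: L.
  have lH : src H = tgt H by apply: L.
  rewrite -/g -/H -/W oppD; last by gside.
  rewrite oppD; last by gside.
  by rewrite oppK addA; gside.
have hg : contraction 2 g = gen P (degen 0 (degen 0 y)) :> gpd P 2.
  by rewrite contraction_gen shift_degen0.
rewrite TS hb hg b3 -/g.
have wC z : tgt z = v -> z + (W - g) = (W - g) + z.
  move=> tz; have -> : W - g = bd (gen P (degen 0 (degen 0 y)) : gpd P 2).
    rewrite b3 -/g; have lg : src g = tgt g by apply: L.
    by rewrite addrNK //; gside.
  by rewrite bd_central // gen_tgt !last_vertex_degen.
have := L g; have := L H; have := L W.
move: H g W {hE hb hg b3 b2} tH tg tW wC => u g w tu tg tw wC lw lu lg.
have -> : w - g - g + g = w - g by rewrite addrNK //; gside.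
have -> : g + (- g - u + g - w + u) + (w - g) = - u + g - w + (u + (w - g)).
  by rewrite !addA; gside; rewrite addrN lg tg -tu -[tgt u]src_opp add0.
rewrite wC // !addA; gside.
by rewrite addrNK; gside; rewrite addrK; gside; rewrite addN tu.
Qed.

Let Q_idn k n (x : gpd P n) : G k n.+1 x ->
  (Q k n.+1 x : gpd (quotient _) n) = idn (tgt x).
Proof. exact: qproj_idn. Qed.

Let Q_act_degenerate k n (x : gpd P n.+1) v : 0 < k ->
  tgt x = src (gen P (degen 0 v) : gpd P 0) ->
  Q k n.+2 (act x (gen P (degen 0 v))) = Q k n.+2 x.
Proof.
move=> k0 e; have Gv : G k 1 (gen P (degen 0 v)) by apply: gen_degeneracy.
have lv := normal_loop (degeneracy_normal P _) Gv.
apply/esym/qprojP; split.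
- by rewrite (src_action (act_action P n)) // -lv -e L.
- by rewrite (action_tgt (act_action P n)) // -lv -e.
- exact: (normal_diff (degeneracy_normal P _)).
Qed.

(** Modulo [G 1] the term from [bd g] vanishes, being a shifted degenerate edge, and the boundary of
    [degen 1 (degen 1 y)] is [g]; the sign of [shift] makes it cancel [g]. *)
Let lower2_1 (y : K 1) : G 1 2 (T 2 (gen P (degen 1 y))).
Proof.
apply: (quotient_idn (hE := degeneracy_normal P [set i | i < 1]));
  set v := gen P (last_vertex y).
set q := Q 1; have qF n := mor_functor q n.
set g := gen P (degen 1 y) : gpd P 1.
have tg : tgt g = v by rewrite gen_tgt last_vertex_degen.
have lg : src g = tgt g by apply: L.
set w := gen P (degen 1 (degen 1 y)) : gpd P 2.
have tw : tgt w = v by rewrite gen_tgt !last_vertex_degen.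
have hb : contraction 1 (bd g) = shift (degen 0 (face 0 y)) :> gpd P 1.
  rewrite gen_bd2 face_degen_eq // face_degen_succ // face_degen_lt // addN.
  have -> : tgt (gen P y : gpd P 0) = src
    (gen P (degen 0 (face 0 y)) : gpd P 0).
    by rewrite gen_tgt1 gen_src1 face_degen_succ.
  by rewrite add0 contraction_gen.
have qhb : q 2 (contraction 1 (bd g)) = idn v :> gpd (quotient _) 1.
  rewrite hb [LHS]Q_idn; last exact: shift_degeneracy.
  by rewrite shift_tgt last_vertex_degen.
have qhg : q 3 (contraction 2 g) = - (q 3 w : gpd (quotient _) 2) :> gpd
  (quotient _) 2.
  by rewrite contraction_gen shift_quotient.
have qbw : bd (q 3 w : gpd (quotient _) 2) = q 2 g.
  have f3 : face 3 (degen 1 (degen 1 y)) = degen 1 y.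
    by rewrite face_degen_gt // [3.-1]/= face_degen_succ.
  have u : last_edge (degen 1 (degen 1 y)) = degen 0 (last_vertex y).
    by rewrite last_edge_degen // last_edge_degen_top.
  rewrite -(mor_bd q) gen_bd3 u f3 (face_degen_eq (j := 1)) //.
  rewrite (face_degen_succ (j := 1)) // (face_degen_lt (i := 0)) // -/g.
  set e' := gen P (degen 0 (face 0 (degen 1 y)));
    have Ge : G 1 2 e' by apply: gen_degeneracy.
  have te : tgt (e' : gpd P 1) = v.
    by rewrite gen_tgt last_vertex_degen // last_vertex_face //
      last_vertex_degen.
  have su : tgt g = src (gen P (degen 0 (last_vertex y)) : gpd P 0).
    by rewrite tg gen_src1 face_degen_succ.
  have tu : tgt (act g (gen P (degen 0 (last_vertex y)))) = v.
    by rewrite (action_tgt (act_action P 0)) // gen_tgt1 face_degen_eq.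
  have lu := L (act g (gen P (degen 0 (last_vertex y)))).
  have le := L (e' : gpd P 1).
  have e1 : tgt (act g (gen P (degen 0 (last_vertex y)))) = src
    (- (e' : gpd P 1)).
    by rewrite src_opp te tu.
  rewrite addrNK; last by rewrite tgt_add // tgt_opp le te tg.
  rewrite (functor_add (qF 1)) // (functor_opp (qF 1)).
  rewrite [q 2 e']Q_idn // te idnN [q 2 (act _ _)]Q_act_degenerate //.
  by rewrite -tg -(quotient_morphism_tgt (degeneracy_normal P [set i | i < 1])
    g) addr0.
have thb : tgt (contraction 1 (bd g)) = v.
  by rewrite (deformation_tgt contraction_deformation) bd_tgt.
have lhb : src (contraction 1 (bd g)) = tgt (contraction 1 (bd g)) by apply: L.
have thg : tgt (contraction 2 g) = v
  by rewrite (deformation_tgt contraction_deformation).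
have sb : src (bd (contraction 2 g)) = v by rewrite bd_src.
rewrite TS -/q (functor_add (qF 1)); last by rewrite tgt_add ?lhb ?thb ?sb.
rewrite (functor_add (qF 1)); last by rewrite lhb thb.
rewrite qhb (mor_bd q) qhg bd_opp qbw.
have tqg : tgt (q 2 g : gpd (quotient _) 1) = v
  by rewrite quotient_morphism_tgt.
have lqg : src (q 2 g : gpd (quotient _) 1) = v
  by rewrite quotient_morphism_src lg.
rewrite -{1}tqg addr0 addrN lqg; congr idn.
by rewrite !tgt_add ?bd_tgt ?thg ?sb ?thb ?lhb ?thb.
Qed.

(** Modulo [G k], [bd_degen] expands [h bd g] and [bd h g] into faces above [k.+1]. The second
    expansion is [- g] followed by the negatives of the terms of the first. *)
Let lower3 n k (y : K n.+2) : k <= n.+2 ->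
  G k n.+3 (T n.+3 (gen P (degen k y))).
Proof.
move=> kn; apply: (quotient_idn (hE := degeneracy_normal P [set i | i < k])).
set q := Q k; set D := quotient _; have qF m := mor_functor q m.
pose an := restricted_act (@act D n.+1) (q 1 : gpd P 0 -> gpd D 0).
have hN : is_module an := restricted_module (qF 0) (cc_module D n).
pose F2 (c : gpd P n.+1) : gpd D n.+2 := q n.+3 (contraction n.+2 c).
pose F3 (c : gpd P n.+2) : gpd D n.+2 := q n.+3 c.
have cT := deformation_tgt contraction_deformation.
have qT m (c : gpd P m) : tgt (q m.+1 c : gpd D m) = tgt c.
  exact: quotient_morphism_tgt.
have hF2 : is_equivariant (@act P n) an F2.
  have [[cs ct ca] cact] := deformation2 contraction_deformation n.
  split; first split.
  - by move=> c; rewrite /F2 (functor_src (qF n.+2)) cs.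
  - by move=> c; rewrite /F2 (functor_tgt (qF n.+2)) ct.
  - by move=> c d e; rewrite /F2 ca // (functor_add (qF n.+2)) // ct cs.
  - by move=> c a e; rewrite /F2 cact // (mor_act q) // ct.
have hF3 : is_equivariant (@act P n.+1) an F3.
  by split; [exact: qF|move=> c a e; exact: (mor_act q)].
have vE : last_vertex (degen k y) = last_vertex y by rewrite last_vertex_degen.
set v := gen P (last_vertex y).
have kills2 j (z : K n.+1) : j < k -> j <= n.+1 ->
    F2 (gen P (degen j z)) = idn (gen P (last_vertex z)).
  move=> jk jn; rewrite /F2 contraction_gen [LHS]Q_idn;
    last exact: shift_degeneracy.
  by rewrite shift_tgt last_vertex_degen.
have kills3 j (z : K n.+2) : j < k -> j <= n.+2 ->
    F3 (gen P (degen j z)) = idn (gen P (last_vertex z)).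
  move=> jk jn; rewrite [LHS]Q_idn; last exact: gen_degeneracy.
  by rewrite gen_tgt last_vertex_degen.
have top : k = n.+2 -> last_edge (degen k y) = degen 0 (last_vertex y).
  by move=> ->; apply: last_edge_degen_top.
have s0 (u : K 0) : src (gen P (degen 0 u) : gpd P 0) = gen P u.
  by rewrite gen_src1 face_degen_succ.
have k0 : k = n.+2 -> 0 < k by move->.
have triv2 : k = n.+2 ->
    an (F2 (gen P y)) (gen P (last_edge (degen k y))) = F2 (gen P y).
  move=> ke; rewrite (top ke) /an /restricted_act /F2 -(mor_act q).
    by rewrite [LHS]Q_act_degenerate ?k0 // s0 cT gen_tgt.
  by rewrite s0 cT gen_tgt.
have triv3 : k = n.+3 ->
    an (F3 (gen P (degen k y))) (gen P (last_edge (degen k (degen k y)))) =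
    F3 (gen P (degen k y)).
  by move=> ke; move: kn; rewrite ke ltnn.
have S2 := bd_degen hN hF2 kn kills2 triv2.
have S3 := bd_degen hN hF3 (leqW kn) kills3 triv3.
rewrite vE -/v in S3; rewrite -/v in S2.
have vD := vertD hN (p := v); have vN := vertN hN (p := v).
set g := gen P (degen k y) : gpd P n.+2.
have tg : tgt g = v by rewrite gen_tgt vE.
have qhg : F3 (bd (contraction n.+3 g)) =
    signed (n.+3 - k) (F3 (bd (gen P (degen k (degen k y)) : gpd P n.+3))).
  rewrite /F3 (mor_bd q) contraction_gen shift_quotient //.
  by rewrite (signed_functor _ _ (bd_functor D n.+2)) -(mor_bd q).
have lE : last_edge (degen k (degen k y)) = last_edge (degen k y).
  by rewrite last_edge_degen.
(* Face [i.+1] of [degen k (degen k y)] is [degen k] of face [i] of [degen k y]; the remaining sign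
   is that of [shift] on a simplex of dimension [n.+2]. *)
have term i : k.+2 <= i < n.+4 -> degen_term an F2 k y i =
    signed (n.+2 - k) (degen_term an F3 k (degen k y) i.+1).
  case/andP=> ki ile; have kn1 : k <= n.+1 := leq_trans ki (ile : i <= n.+3).
  have uE : F2 (gen P (degen k (face i.-1 y))) =
      signed (n.+2 - k) (F3 (gen P (degen k (face i (degen k y))))).
    by rewrite /F2 contraction_gen shift_quotient // face_degen_gt.
  rewrite /degen_term -[i.+1.-1]/i uE lE -[n.+1.+3]/n.+4 eqSS;
    case: eqP => // ie.
  set u := F3 _; set e := gen P _.
  have te : tgt u = src (e : gpd P 0).
    rewrite (functor_tgt (qF n.+2)) gen_tgt gen_src_last_edge ie
      last_vertex_degen //.
  by rewrite /signed; case: odd => //; rewrite (action_opp (module_action hN)).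
(* If [k = n.+2] this is the top face, twisted by a degenerate edge, which acts trivially modulo
   [G k] since [0 < k]. *)
have head : degen_term an F3 k (degen k y) k.+2 = F3 g.
  rewrite /degen_term -[k.+2.-1]/k.+1 face_degen_succ // lE;
    case: eqP => // -[ke].
  rewrite (top ke) /an /restricted_act /F3 -(mor_act q); last by rewrite s0 tg.
  by rewrite Q_act_degenerate ?k0 // s0 tg.
pose t i := vert hN v (degen_term an F3 k (degen k y) i).
have tdt i : k.+2 <= i -> i <= n.+4 ->
  tgt (degen_term an F3 k (degen k y) i) = v.
  move=> ki ile; rewrite -(bd_term_degen an F3) //.
  by rewrite (tgt_bd_term hN hF3) // last_vertex_degen ?vE // leqW.
pose m := (n.+2 - k)%N; pose s :=
  (\sum_(k.+2 <= i < n.+4) sgn (n.+3 - i) (t i.+1))%R.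
have {}S2 : vert hN v (F2 (bd g)) = sgn m s.
  rewrite S2 sgn_sum; apply: eq_big_nat => i /[dup] /term -> /andP[ki ile].
  by rewrite vert_signed ?tdt // 1?leqW // sgnC.
have {}S3 : vert hN v (F3 (bd (gen P (degen k (degen k y)) : gpd P n.+3))) =
    (sgn m (vert hN v (F3 g)) + s)%R.
  rewrite S3 big_ltn; last by rewrite !ltnS.
  by rewrite head subSS subSS -/m big_add1; congr (_ + _)%R.
have tb : tgt (bd (gen P (degen k (degen k y)) : gpd P n.+3)) = v.
  by rewrite bd_tgt gen_tgt last_vertex_degen ?vE // leqW.
have e1 : tgt (contraction n.+2 (bd g)) = v by rewrite cT bd_tgt.
have e2 : tgt (bd (contraction n.+3 g)) = v by rewrite bd_tgt cT.
have [t1 t2 t3] : [/\ tgt (F3 g) = v, tgt (F2 (bd g)) = v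
    & tgt (F3 (bd (contraction n.+3 g))) = v].
  by rewrite /F3 /F2 !qT e1 e2.
have tT : tgt (T n.+3 g : gpd P n.+2) = v.
  by rewrite (functor_tgt (mor_functor T n.+2)) tg.
have qTE : q n.+3 (T n.+3 g) = F3 g + F2 (bd g) + F3 (bd (contraction n.+3 g))
  :> gpd D n.+2.
  rewrite TS (functor_add (qF n.+2)) ?(functor_add (qF n.+2)) //.
    by rewrite tg L e1.
  by rewrite tgt_add ?L ?e1 ?e2 ?tg.
have lD := loop (act_action D n.+1).
have tsum : tgt (F3 g + F2 (bd g)) = v by rewrite tgt_add // lD t1 t2.
rewrite -/D tT; apply: (vert_inj (hN := hN) (p := v)); rewrite ?tgt_idn //.
  by rewrite qT tT.
rewrite vert0 qTE vD // vD // qhg vert_signed ?S2 ?S3; last by rewrite /F3 qT.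
(* This extra sign change, from raising the dimension by one, produces the cancellation. *)
have -> : (n.+3 - k = m.+1)%N by rewrite subSn.
by rewrite sgnS sgnD sgnK GRing.subrr.
Qed.

Lemma contraction_lower k n (x : cell P n) : G k.+1 n x -> G k n (T n x).
Proof.
have N := preimage_normal (f := T) (fun x y e => e)
  (degeneracy_normal P [set i | i < k]).
suff : G k.+1 n `<=` T n @^-1` G k n by apply.
apply: (degeneracy_sub N) => m j y jk jm.
have sub l : G j l `<=` G k l.
  by apply: degeneracyS => i /= ij; apply: leq_trans ij _.
apply: sub; case: m j y jm {jk} => [|[|m]] j y jm.
- case: j jm => // _; rewrite [T 1 _]lower1; exact: degeneracy_idn.
- case: j jm => [|[|//]] _; last exact: lower2_1.
  rewrite [T 2 _]lower2_0; exact: degeneracy_idn.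
- exact: lower3.
Qed.

Let Pi_act n := restricted_act (@act (Pi P) n)
  (Pi_proj P 1 : gpd P 0 -> gpd (Pi P) 0).

(** After projection to [Pi P], [h] and the trivial map are linear over the restricted action and
    agree on generators, so uniqueness identifies them. *)
Lemma linear_degeneracy n (h : gpd P n -> gpd P n.+1) : is_linear h ->
  (forall x : K n.+1, A n.+2 (h (gen P x))) -> forall c, A n.+2 (h c).
Proof.
move=> hh hA c; have pF m := mor_functor (Pi_proj P) m.
suff pE : Pi_proj P n.+2 (h c) = Pi_proj P n.+2 (idn (tgt (h c)) : gpd P n.+1).
  by have /Pi_projP[_ _] := pE; rewrite idnN addr0.
have tgtE x : tgt (h x) = tgt x.
  case: n h hh {hA} x {c} => [|n] h hh x; first exact: (derivation_tgt hh).
  exact: (functor_tgt (equivariant_functor hh)).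
have gE (x : K n.+1) : Pi_proj P n.+2 (h (gen P x)) = Pi_proj P n.+2
  (idn (tgt (gen P x : gpd P n)) : gpd P n.+1).
  have lh : src (h (gen P x)) = tgt (h (gen P x)) by apply: L.
  apply/Pi_projP; rewrite src_idn tgt_idn -tgtE lh; split=> //.
  by rewrite idnN addr0.
have id_tgt m p : tgt (Pi_proj P m.+1 (idn p : gpd P m) : gpd (Pi P) m) = p.
  by rewrite (functor_tgt (pF m)) tgt_idn.
have idE m p : Pi_proj P m.+1 (idn p : gpd P m) = idn p :> gpd (Pi P) m.
  exact: (functor_idn (pF m)).
rewrite tgtE; case: n h hh {hA} c tgtE gE => [|n] h hh c tgtE gE.
  have aA : is_action (@Pi_act 0) :=
    restricted_action (pF 0) (act_action (Pi P) 0).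
  have [ht hD] := hh.
  apply: (derivation_gen_unique (h := fun c => Pi_proj P 2 (h c))
    (h' := fun c => Pi_proj P 2 (idn (tgt c) : gpd P 1)) aA) => //.
    split=> [x|x y e]; first by rewrite (functor_tgt (pF 1)) ht.
    rewrite hD // (functor_add (pF 1));
      last by rewrite (action_tgt (act_action P 0)) // ?L ht.
    by rewrite (mor_act (Pi_proj P)) // ht.
  split=> [x|x y e]; first by rewrite (functor_tgt (pF 1)) tgt_idn.
  rewrite !idE tgt_add // /Pi_act /restricted_act act_idn.
    by rewrite (functor_tgt (pF 0)) idnDidn.
  by rewrite (functor_src (pF 0)).
have aM : is_pi1_module (C := P) (N := gpd (Pi P) n.+2) (@Pi_act n.+1).
  split; first exact: (restricted_module (pF 0) (cc_module (Pi P) n)).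
  move=> x y e; rewrite /Pi_act /restricted_act (mor_bd (Pi_proj P)) cc_triv //.
  by rewrite (functor_tgt (pF 1)).
have [hf ha] := hh.
apply: (linear_gen_unique (F := fun c => Pi_proj P n.+3 (h c))
  (F' := fun c => Pi_proj P n.+3 (idn (tgt c) : gpd P n.+2)) aM) => //.
  split=> [|x a e]; last by rewrite ha // (mor_act (Pi_proj P)) //
    (functor_tgt hf).
  split=> [x|x|x y e].
  - by rewrite (functor_src (pF n.+2)) (functor_src hf).
  - by rewrite (functor_tgt (pF n.+2)) (functor_tgt hf).
  - by rewrite (functor_add hf) // (functor_add (pF n.+2)) // (functor_tgt hf)
      (functor_src hf).
split=> [|x a e]; last first.
  rewrite !idE (action_tgt (act_action P n)) // /Pi_act /restricted_act act_idn.
    by rewrite (functor_tgt (pF 0)).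
  by rewrite (functor_src (pF 0)).
split=> [x|x|x y e].
- by rewrite (functor_src (pF n.+2)) src_idn L.
- by rewrite (functor_tgt (pF n.+2)) tgt_idn.
- by rewrite !idE tgt_add // e L idnDidn.
Qed.

(** Dimension one carries no condition: every element of [A 1] turns out to be a boundary. *)
Definition is_cycle n (z : gpd P n) : Prop :=
  match n return gpd P n -> Prop with
  | 0 => fun _ => True
  | m.+1 => fun z : gpd P m.+1 => bd z = idn (tgt z)
  end z.

(** For a cycle [z], [T z] is [z + bd (h z)], again a cycle but one stage lower. If it bounds [w]
    then [z] bounds [w - h z], and the induction stops at identities. *)
Lemma degeneracy_boundary_filtered k n (z : gpd P n) :
  G k n.+1 z -> is_cycle z -> exists2 w : gpd P n.+1, A n.+2 w & bd w = z.
Proof.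
have hA := degeneracy_normal P setT; have sA := normal_sub hA.
have cT := deformation_tgt contraction_deformation.
elim: k z => [|k IH] z Gz cz.
  have : z = idn (tgt z).
    move: Gz; have : G 0 n.+1 `<=` @identities P n.+1.
      exact: (degeneracy_sub (@identities_normal P)).
    by move=> h /h.
  move=> ->; exists (idn (tgt z)); last exact: bd_idn.
  by apply: (sub_idn sA); rewrite (normal_ob hA).
have Tt : tgt (T n.+1 z : gpd P n) = tgt z := functor_tgt (mor_functor T n) z.
have lz : src z = tgt z := td_loop (normal_td (degeneracy_normal P _) n) Gz.
have TE : T n.+1 z = z + bd (contraction n.+1 z) :> gpd P n.
  case: n z Gz cz {Tt lz IH} => [|n] z Gz cz //.
  by rewrite TS cz (deformation_idn contraction_deformation) addr0.
have cTz : is_cycle (T n.+1 z : gpd P n).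
  case: n z cz Tt {lz IH Gz TE} => [|n] z cz Tt //.
  rewrite /is_cycle.
  by rewrite -(mor_bd T) cz (functor_idn (mor_functor T n)) Tt.
have [w Aw bw] := IH (T n.+1 z) (contraction_lower Gz) cTz.
have Ah : A n.+2 (contraction n.+1 z).
  apply: linear_degeneracy.
    by have [] := extendP (@shift_tgt n).
  move=> x; rewrite contraction_gen /shift; case: pselect => [e|_]; last first.
    by apply: (sub_idn sA); rewrite (normal_ob hA).
  case: ex_minnP => j /asboolP[jn _] _.
  have Ag : A n.+2 (gen P (degen j x)) by apply: gen_degeneracy => //;
    apply: leqW.
  by rewrite /signed; case: odd => //; apply: (sub_opp sA).
have tw : tgt w = tgt z by rewrite -bd_tgt bw.
exists (w - contraction n.+1 z).
  apply: (sub_add sA) => //; first exact: (sub_opp sA).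
  by rewrite tw src_opp cT.
rewrite bd_add ?tgt_opp ?L ?cT // bd_opp bw TE addrK //.
by rewrite bd_src cT.
Qed.

(** Degeneracies onto dimension [n.+1] have index at most [n]. Generators of [A] in other dimensions
    add nothing here, by the criteria for a single dimension. *)
Lemma degeneracy_filtered n (z : gpd P n) : A n.+1 z -> G n.+1 n.+1 z.
Proof.
have hG k := degeneracy_normal P [set i | i < k].
have A1 : A 1 `<=` G 1 1.
  apply: (degeneracy_td_normal (normal_td (hG 1) 0)) => v.
  exact: gen_degeneracy.
case: n z => [|n] z; first exact: A1.
suff hS : is_closed (P := P) (G n.+2 n.+2).
  by apply: (degeneracy_closed hS) => i y ile; apply: gen_degeneracy.
have sG := normal_sub (hG n.+2); split.
- by move=> p; apply: (sub_idn sG); rewrite (normal_ob (hG n.+2)).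
- by move=> x y hx hy e; apply: (sub_add sG) => //; rewrite L.
- by move=> x hx; apply: (sub_opp sG).
- by move=> x a hx e; apply: (normal_act (hG n.+2)).
- move=> x a /A1 ha e; apply: (normal_diff (hG n.+2)) => //.
  by move: ha; apply: degeneracyS => i /=; rewrite ltnS leqn0 => /eqP ->.
Qed.

Lemma degeneracy_boundary n (z : gpd P n) : A n.+1 z -> is_cycle z ->
  exists2 w : gpd P n.+1, A n.+2 w & bd w = z.
Proof. by move/degeneracy_filtered; apply: degeneracy_boundary_filtered. Qed.

End Contraction.

(** * Factorisation through the normalised complex and the section *)

Lemma functor_diff (O O' : Type) (G : groupoid O) (H : groupoid O')
    (F0 : O -> O') (F : G -> H) (x y : G) p : is_functor F0 F ->
  src x = src y -> tgt x = tgt y -> F (x - y) = idn p -> F x = F y.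
Proof.
move=> hF s t; have e : tgt x = src (- y) by rewrite src_opp.
rewrite (functor_add hF) // (functor_opp hF) => E.
have tF : tgt (F x) = tgt (F y) by rewrite !(functor_tgt hF) t.
have pE : p = src (F y).
  rewrite -[p](src_idn H) -E src_add ?src_opp //.
  by rewrite !(functor_src hF) s.
by rewrite -(addrNK tF) E pE add0.
Qed.

Lemma homotopic_id (C : crossedComplex) (f : morphism C C) :
  (forall n x, f n x = x) -> homotopic f (morphism_id C).
Proof.
move=> fE; pose h n (x : cell C n) : gpd C n := idn (base x).
have hh : is_deformation h.
  split=> // [|n]; first split=> [x|x y e].
  - by rewrite tgt_idn.
  - by rewrite /h /base tgt_add // act_idn // idnDidn.
  have L := loop (act_action C n); split; first split=> [x|x|x y e].
  - by rewrite src_idn L.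
  - by rewrite tgt_idn.
  - by rewrite /h /base tgt_add // e L idnDidn.
  - by move=> x a e; rewrite /h /base (action_tgt (act_action C n)) // act_idn.
exists h; apply: (deformation_homotopy hh) => n x; rewrite fE.
case: n x => [|[|n]] x //; rewrite /deform /h /base ?bd_tgt !bd_idn ?addr0 //.
Qed.

Section Normalisation.
Variables (K : simplicialSet) (P : PiUpsilon K).
Local Notation A n := (@degeneracy K P setT n).
Let hA := degeneracy_normal P setT.
Let sA := normal_sub hA.

Lemma Pi_factor (D : crossedComplex) (f : morphism P D) :
  (forall n (x : gpd P n), A n.+1 x ->
     f n.+1 x = idn (f 0 (tgt x)) :> gpd D n) ->
  exists g : morphism (Pi P) D, forall n (x : cell P n), g n (Pi_proj P n x) = f
    n x.
Proof.
move=> fA; have fF n := mor_functor f n; have pF n := mor_functor (Pi_proj P) n.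
pose lift n (u : cell (Pi P) n) := sval (cid (Pi_proj_surj u)).
have liftK n (u : cell (Pi P) n) : Pi_proj P n (lift n u) = u.
  by rewrite /lift; case: cid.
pose g n (u : cell (Pi P) n) := f n (lift n u).
have gE n (x : cell P n) : g n (Pi_proj P n x) = f n x.
  rewrite /g; have := liftK n (Pi_proj P n x); move: (lift _ _) => y.
  case: n x y => [|n] x y; first by move=> /= ->.
  by case/Pi_projP=> [s t /fA /(functor_diff (fF n))]; apply.
have gs n (u : gpd (Pi P) n) : src (g n.+1 u : gpd D n) = g 0 (src u).
  have [x <-] := Pi_proj_surj (n := n.+1) u.
  by rewrite gE (functor_src (fF n)) (functor_src (pF n))
    -[src x]/(Pi_proj P 0 (src x)) gE.
have gt n (u : gpd (Pi P) n) : tgt (g n.+1 u : gpd D n) = g 0 (tgt u).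
  have [x <-] := Pi_proj_surj (n := n.+1) u.
  by rewrite gE (functor_tgt (fF n)) (functor_tgt (pF n))
    -[tgt x]/(Pi_proj P 0 (tgt x)) gE.
have gF n : is_functor (g 0) (g n.+1 : gpd (Pi P) n -> gpd D n).
  split=> [u|u|u v]; [exact: gs|exact: gt|].
  have [x <-] := Pi_proj_surj (n := n.+1) u;
    have [y <-] := Pi_proj_surj (n := n.+1) v.
  rewrite (functor_tgt (pF n)) (functor_src (pF n)) => e.
  by rewrite -(functor_add (pF n)) // !gE (functor_add (fF n)).
have ga n (u : gpd (Pi P) n.+1) (v : gpd (Pi P) 0) : tgt u = src v ->
    g n.+2 (act u v) = act (g n.+2 u : gpd D n.+1) (g 1 v).
  have [x <-] := Pi_proj_surj (n := n.+2) u;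
    have [y <-] := Pi_proj_surj (n := 1) v.
  rewrite (functor_tgt (pF n.+1)) (functor_src (pF 0)) => e.
  by rewrite -(mor_act (Pi_proj P)) // !gE (mor_act f).
have gb n (u : gpd (Pi P) n.+1) : g n.+1 (bd u) = bd (g n.+2 u : gpd D n.+1).
  have [x <-] := Pi_proj_surj (n := n.+2) u.
  by rewrite -(mor_bd (Pi_proj P)) !gE (mor_bd f).
by exists (Morphism (mor := g) gF ga gb).
Qed.

(* The part of [deform h] in dimension [m.+1] that does not involve [h m.+1]. *)
Definition pre_deform m : (cell P m -> gpd P m) -> gpd P m -> gpd P m :=
  match m with
  | 0 => fun _ c => c
  | k.+1 => fun h c => c + h (bd c)
  end.

(** Solves, inside [A] whenever possible, the equation saying that [deform] is trivial at [gen P x].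
    For degenerate [x] a solution exists by acyclicity; membership in [A] keeps the correction
    invisible in [Pi P]. *)
Definition filler m (h : cell P m -> gpd P m) (x : K m.+1) : gpd P m.+1 :=
  if pselect (exists w : gpd P m.+1, [/\ tgt w = gen P (last_vertex x),
                 A m.+2 w & bd w = - pre_deform h (gen P x)]) is left e
  then sval (cid e) else idn (gen P (last_vertex x)).

Fixpoint filling m : cell P m -> gpd P m :=
  match m with 0 => fun p => idn p | k.+1 => extend (filler (@filling k)) end.
Arguments filling : clear implicits.

Lemma filler_tgt m (h : cell P m -> gpd P m) x :
  tgt (filler h x) = gen P (last_vertex x).
Proof.
rewrite /filler; case: pselect => [e|_]; last exact: tgt_idn.
by case: cid => w [].
Qed.

Lemma filling_deformation : is_deformation filling.
Proof.
apply: is_deformationP => // n.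
by have [] := extendP (filler_tgt (filling n)).
Qed.

Lemma filling_gen n (x : K n.+1) :
  filling n.+1 (gen P x) = filler (filling n) x.
Proof. by have [_] := extendP (filler_tgt (filling n)); apply. Qed.

Lemma filling_degeneracy n (c : gpd P n) : A n.+2 (filling n.+1 c).
Proof.
apply: linear_degeneracy; first by have [] := extendP (filler_tgt (filling n)).
move=> x; rewrite filling_gen /filler; case: pselect => [e|_]; last first.
  by apply: (sub_idn sA); rewrite (normal_ob hA).
by case: cid => w [].
Qed.

Let r := deformation filling_deformation.

Let rE n (c : gpd P n) :
  r n.+1 c = pre_deform (filling n) c + bd (filling n.+1 c) :> gpd P n.
Proof. by case: n c. Qed.

Let L n := loop (act_action P n).
Let rF n := mor_functor r n.
Let ht := deformation_tgt filling_deformation.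

Let pre_tgt n (c : gpd P n) : tgt (pre_deform (filling n) c) = tgt c.
Proof. by case: n c => [|n] c //=;
  rewrite tgt_add ?ht ?bd_tgt // L ht bd_tgt. Qed.

Let retract_gen n (x : K n.+1) :
  A n.+1 (pre_deform (filling n) (gen P x)) ->
  is_cycle (pre_deform (filling n) (gen P x)) ->
  r n.+1 (gen P x) = idn (gen P (last_vertex x)) :> gpd P n.
Proof.
set z := pre_deform _ _ => Az cz.
have tz : tgt z = gen P (last_vertex x) by rewrite pre_tgt gen_tgt.
have lz : src z = tgt z := td_loop (normal_td hA n) Az.
have [|w Aw bw] := degeneracy_boundary (sub_opp sA Az).
  case: n x z cz tz lz {Az} => [|n] x z cz tz lz //.
  by rewrite /is_cycle bd_opp cz idnN tgt_opp lz.
have tw : tgt w = gen P (last_vertex x) by rewrite -bd_tgt bw tgt_opp lz.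
rewrite rE filling_gen /filler; case: pselect => [e|[]]; last by exists w.
by case: cid => w' [_ _ ->] /=; rewrite addrN lz tz.
Qed.

Let retract1 (x : gpd P 0) : A 1 x -> r 1 x = idn (tgt x).
Proof.
apply: (degeneracy_kernel1 (rF 0)) => v.
have vE : last_vertex (degen 0 v) = v by exact: last_vertex_degen.
by rewrite -[in RHS]vE; apply: retract_gen => //; apply: gen_degeneracy.
Qed.

(** Induction on the dimension: triviality of [r] on the boundary of a degenerate generator makes
    the element to be filled a cycle of [A], so [filler] succeeds there. *)
Let retractS n (x : gpd P n) : A n.+1 x -> r n.+1 x = idn (tgt x).
Proof.
elim: n x => [|n IH] x; first exact: retract1.
pose ar := restricted_act (@act P n) (r 1 : gpd P 0 -> gpd P 0).
have har : is_action ar := restricted_action (rF 0) (act_action P n).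
apply: (degeneracy_kernel (F := r n.+2) har).
- split; first exact: (rF n.+1).
  by move=> y a e; apply: (mor_act r).
- move=> y a ha e; rewrite /ar /restricted_act retract1 //.
  have la := normal_loop hA ha.
  have ty : tgt (r n.+2 y : gpd P n.+1) = tgt y := functor_tgt (rF n.+1) y.
  by rewrite -la -e -ty (action_idn (act_action P n)).
- move=> i y ile; set x' := degen i y.
  have vE : last_vertex x' = last_vertex y by apply: last_vertex_degen.
  have Ax : A n.+2 (gen P x') by apply: gen_degeneracy.
  have tx : tgt (gen P x' : gpd P n.+1) = gen P (last_vertex y)
    by rewrite gen_tgt vE.
  rewrite -vE; apply: retract_gen.
    apply: (sub_add sA) => //; first exact: filling_degeneracy.
    by rewrite L ht bd_tgt.
  (* The boundary of [pre_deform] at [gen P x'] is [r] of [bd (gen P x')], because the term with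
     [bd bd] vanishes. *)
  have := IH _ (sub_bd sA Ax); rewrite rE => rb.
  rewrite /is_cycle pre_tgt /pre_deform bd_add; last by rewrite ht bd_tgt.
  rewrite bd_tgt in rb; rewrite -{}rb; congr (_ + _).
  case: (n) x' {vE Ax tx} => [|m] x' //.
  by rewrite /pre_deform cc_bdbd (deformation_idn filling_deformation) -bd_tgt
    addr0.
Qed.

Lemma Pi_section : exists2 q : morphism (Pi P) P,
    forall n (x : cell (Pi P) n), Pi_proj P n (q n x) = x &
    homotopic (morphism_comp q (Pi_proj P)) (morphism_id P).
Proof.
have [q qE] := Pi_factor retractS; exists q; last first.
  exists filling; apply: (deformation_homotopy filling_deformation) => n x.
  exact: qE.
move=> n u; have [x <-] := Pi_proj_surj u; rewrite qE.
case: n x {u} => [|n] x //; apply/Pi_projP.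
have tr : tgt (r n.+1 x : gpd P n) = tgt x := functor_tgt (rF n) x.
have sr : src (r n.+1 x : gpd P n) = src x := functor_src (rF n) x.
split=> //; rewrite rE.
have Ab : A n.+1 (bd (filling n.+1 x)) := sub_bd sA (filling_degeneracy x).
have tb : tgt (bd (filling n.+1 x)) = tgt x by rewrite bd_tgt ht.
have sb : src (bd (filling n.+1 x)) = tgt x by rewrite bd_src ht.
(* [r x - x] is a conjugate by [x] of a correction lying in [A]. *)
have Ac (y b : gpd P n) : A n.+1 b -> tgt y = src b -> A n.+1 (y + b - y).
  move=> hb e; rewrite -{1}(oppK y); apply: (td_conj (normal_td hA n)) => //.
  by rewrite src_opp -(td_loop (normal_td hA n) hb).
case: n x tr sr Ab tb sb Ac => [|n] x tr sr Ab tb sb Ac; first exact: Ac.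
have Ah := filling_degeneracy (bd x).
have tf : tgt (filling n.+1 (bd x)) = tgt x by rewrite ht bd_tgt.
have sf : src (filling n.+1 (bd x)) = tgt x by rewrite L.
rewrite /pre_deform -(@addA _ _ x); rewrite ?tf ?sf ?sb //.
by apply: Ac; [apply: (sub_add sA);
  rewrite ?tf ?sb|rewrite src_add ?tf ?sf ?sb].
Qed.

End Normalisation.

(* Freeness on the nondegenerate generators *)
#[local] Obligation Tactic := idtac.

(** The group of order two at every object: a target for indicator functions of a single
    generator. *)
Program Definition bool_groupoid (O : Type) : groupoid O :=
  @Groupoid O (O * bool) fst fst (fun p => (p, false))
    (fun x y => (x.1, x.2 (+) y.2)) id _ _ _ _ _ _ _ _ _ _ _.
Next Obligation. by []. Qed.
Next Obligation. by []. Qed.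
Next Obligation. by []. Qed.
Next Obligation. by []. Qed.
Next Obligation. by []. Qed.
Next Obligation. by []. Qed.
Next Obligation. by move=> O x y z _ _ /=; rewrite addbA. Qed.
Next Obligation. by move=> O [x b] /=. Qed.
Next Obligation. by move=> O [x b] /=; rewrite addbF. Qed.
Next Obligation. by move=> O [x b] /=; rewrite addbb. Qed.
Next Obligation. by move=> O [x b] /=; rewrite addbb. Qed.

Lemma bool_module (C : crossedComplex) :
  is_pi1_module (fun (x : bool_groupoid (ob C)) (a : gpd C 0) =>
    ((tgt a, x.2) : bool_groupoid (ob C))).
Proof.
split; first split; first split=> //=.
- by move=> [x b] /=; rewrite tgt_idn.
- by move=> x a b _ e; rewrite tgt_add.
- by move=> [x b] [y b'] /= ->; rewrite addbC.
- by move=> [x b] y /= ->; rewrite bd_tgt.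
Qed.

Section Freeness.
Variables (K : simplicialSet) (P : PiUpsilon K).
Local Notation A n := (@degeneracy K P setT n).
Local Notation p := (Pi_proj P).
Let pF n := mor_functor p n.

Lemma Pi_proj_degeneracy n (x : gpd P n) : A n.+1 x ->
  p n.+1 x = idn (tgt x) :> gpd (Pi P) n.
Proof.
move=> Ax; rewrite -(functor_idn (pF n) (tgt x)); apply/Pi_projP.
have lx := td_loop (normal_td (degeneracy_normal P setT) n) Ax.
by rewrite src_idn tgt_idn idnN addr0.
Qed.

Lemma Pi_proj_degenerate n (x : K n.+1) : ~ nondegenerate x ->
  p n.+1 (gen P x) = idn (gen P (last_vertex x)) :> gpd (Pi P) n.
Proof.
move=> /contrapT[i [y [ile ->]]]; rewrite Pi_proj_degeneracy ?gen_tgt //.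
exact: gen_degeneracy.
Qed.

Lemma level_factor n (O : Type) (H : groupoid O) (F0 : ob P -> O)
    (F : gpd P n -> H) :
  is_functor F0 F -> (forall x, A n.+1 x -> F x = idn (F0 (tgt x))) ->
  exists G : gpd (Pi P) n -> H,
    is_functor F0 G /\ forall x, G (p n.+1 x) = F x.
Proof.
move=> hF FA.
pose lift (u : gpd (Pi P) n) := sval (cid (Pi_proj_surj (n := n.+1) u)).
have liftK u : p n.+1 (lift u) = u by rewrite /lift; case: cid.
have GE x : F (lift (p n.+1 x)) = F x.
  by case/Pi_projP: (liftK (p n.+1 x)) => s t /FA /(functor_diff hF); apply.
exists (fun u => F (lift u)); split=> //.
split=> [u|u|u v].
- by have [x <-] := Pi_proj_surj (n := n.+1) u;
    rewrite GE (functor_src hF) (functor_src (pF n)).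
- by have [x <-] := Pi_proj_surj (n := n.+1) u;
    rewrite GE (functor_tgt hF) (functor_tgt (pF n)).
have [x <-] := Pi_proj_surj (n := n.+1) u;
  have [y <-] := Pi_proj_surj (n := n.+1) v.
rewrite (functor_tgt (pF n)) (functor_src (pF n)) => e.
by rewrite -(functor_add (pF n)) // !GE (functor_add hF).
Qed.

Definition on_nondegenerate n (T : Type) (d f : K n -> T) (x : K n) : T :=
  if pselect (nondegenerate x) then f x else d x.

Lemma on_nondegenerateE n T (d f : K n -> T) x :
  nondegenerate x -> on_nondegenerate d f x = f x.
Proof. by rewrite /on_nondegenerate; case: pselect. Qed.

Lemma on_degenerateE n T (d f : K n.+1 -> T) i (y : K n) : i <= n ->
  on_nondegenerate d f (degen i y) = d (degen i y).
Proof.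
by move=> ile; rewrite /on_nondegenerate; case: pselect => // -[]; exists i, y.
Qed.

Let R n := (fun x : K n => p n (gen P x)) @` nondegenerate (n := n).
Arguments R : clear implicits.

(** The map to the group of order two that is nontrivial exactly on the generator [x] kills
    degenerate generators, so it is constant on the fibres of the projection and separates [x] from
    every other generator. *)
Lemma Pi_gen_inj n (x y : K n) : nondegenerate x -> nondegenerate y ->
  p n (gen P x) = p n (gen P y) -> x = y.
Proof.
case: n x y => [|n] x y nx ny e; first by apply: (gen_inj (P := P)).
suff [F FE] : exists F : gpd P n -> bool,
    (forall z : K n.+1, F (gen P z) = `[< z = x >]) /\
    (forall c d, p n.+1 c = p n.+1 d -> F c = F d).
  have := proj2 FE _ _ e; rewrite !(proj1 FE) => E.
  by apply/esym/asboolP; rewrite -E; apply/asboolP.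
have nxd i (z : K n) : i <= n -> `[< degen i z = x >] = false.
  by move=> ile; apply/asboolP => E; apply: nx; exists i, z.
case: n x y nx ny e nxd => [|n] x y nx ny e nxd.
  have [|F [hF FE]] := gen_functor (P := P) (H := bool_groupoid unit)
    (F0 := fun _ => tt)
      (f := fun z : K 1 => ((tt, `[< z = x >]) : bool_groupoid unit)).
    by [].
  have FA : forall c, A 1 c -> F c = idn tt.
    by apply: (degeneracy_kernel1 hF) => v; rewrite FE nxd.
  exists (fun c => (F c).2); split=> [z|c d /Pi_projP[s t /FA]];
    first by rewrite FE.
  by move=> /(functor_diff hF s t) ->.
have bM := bool_module P.
have [|F [hF FE]] := gen_linear (f := fun z : K n.+2 =>
  ((gen P (last_vertex z), `[< z = x >]) : bool_groupoid (ob P))) bM;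
    first by [].
have hf := equivariant_functor hF.
have FA c : A n.+2 c -> F c = idn (tgt c).
  apply: (degeneracy_kernel (module_action (pi1_module_module bM)) hF).
    move=> z a ha e'; have la := normal_loop (degeneracy_normal P setT) ha.
    by have := functor_tgt hf z; case: (F z) => q b /= ->; rewrite e' la.
  by move=> i z ile; rewrite FE nxd // last_vertex_degen.
exists (fun c => (F c).2); split=> [z|c d /Pi_projP[s t /FA]];
  first by rewrite FE.
by move=> /(functor_diff hf s t) ->.
Qed.

Lemma Pi_free0 : R 0 = setT.
Proof.
have [h0 _ _ _] := gen_free_complex P; rewrite -h0; apply/seteqP;
  split=> u [x _ <-].
  by exists x.
by exists x.
Qed.

(** Sending degenerate edges to identities respects endpoints because such edges are loops; both
    halves then reduce to the freeness of [P]. *)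
Lemma Pi_free1 : free_groupoid (R 1 : set (gpd (Pi P) 0)).
Proof.
move=> O H F0 phi hphi ext.
have vE (x : K 1) : ~ nondegenerate x -> face 0 x = face 1 x.
  by move=> /contrapT[[|i] [y [ile ->]]] //;
    rewrite face_degen_eq ?face_degen_succ.
split.
  pose f := on_nondegenerate (fun x : K 1 => idn (F0 (gen P (face 0 x))) : H)
    (fun x => phi (p 1 (gen P x))).
  have [|F [hF FE]] := gen_functor (F0 := F0) (f := f).
    move=> x; rewrite /f /on_nondegenerate; case: pselect => nx.
      have [|-> ->] := hphi (p 1 (gen P x)); first by exists x.
      rewrite (functor_src (pF 0)) (functor_tgt (pF 0)).
      by rewrite gen_src1 gen_tgt1.
    by rewrite src_idn tgt_idn vE.
  have FA x : A 1 x -> F x = idn (F0 (tgt x)).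
    apply: (degeneracy_kernel1 hF) => v.
    by rewrite FE /f on_degenerateE // face_degen_eq.
  have [G [hG GE]] := level_factor hF FA.
  exists G; split=> // _ [x nx <-].
  by rewrite GE FE /f on_nondegenerateE.
move=> F F' [hF FR] [hF' FR'] u; have [c <-] := Pi_proj_surj (n := 1) u.
have comp (E : gpd (Pi P) 0 -> H) : is_functor F0 E ->
  is_functor F0 (fun c => E (p 1 c)).
  case=> Es Et Ea; split=> [x|x|x y e].
  - by rewrite Es (functor_src (pF 0)).
  - by rewrite Et (functor_tgt (pF 0)).
  - by rewrite (functor_add (pF 0)) // Ea // (functor_tgt (pF 0))
      (functor_src (pF 0)) e.
apply: (functor_unique (comp _ hF) (comp _ hF')) => x.
have [nx|dx] := pselect (nondegenerate x).
  by rewrite FR ?FR' //; exists x.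
by rewrite Pi_proj_degenerate // (functor_idn hF) (functor_idn hF').
Qed.

(** The action on [M] is restricted along the projection, which makes every element of [A 1] an
    identity; hence [degeneracy_kernel] applies. *)
Lemma level_factor_equivariant n (M : groupoid (ob P))
  (am : M -> gpd (Pi P) 0 -> M)
    (F : gpd P n.+1 -> M) :
  is_action am ->
  is_equivariant (@act P n) (restricted_act am (p 1 : gpd P 0 -> gpd (Pi P) 0))
    F ->
  (forall i (y : K n.+1), i <= n.+1 ->
     F (gen P (degen i y)) = idn (gen P (last_vertex y))) ->
  exists G : gpd (Pi P) n.+1 -> M,
    is_equivariant (@act (Pi P) n) am G /\ forall x, G (p n.+2 x) = F x.
Proof.
move=> ham hF Fd; have hf := equivariant_functor hF.
have FA x : A n.+2 x -> F x = idn (tgt x).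
  apply: (degeneracy_kernel (restricted_action (pF 0) ham) hF) => // z a ha e.
  rewrite /restricted_act Pi_proj_degeneracy //.
  have la := normal_loop (degeneracy_normal P setT) ha.
  by rewrite -la -e -(functor_tgt hf z) (action_idn ham).
have [G [hG GE]] := level_factor hf FA.
exists G; split=> //; split=> // u v.
have [x <-] := Pi_proj_surj (n := n.+2) u;
  have [a <-] := Pi_proj_surj (n := 1) v.
rewrite (functor_tgt (pF n.+1)) (functor_src (pF 0)) => e.
by rewrite -(mor_act p) // !GE (equivariant_act hF).
Qed.

Lemma equivariant_comp_proj n (M : groupoid (ob P))
  (am : M -> gpd (Pi P) 0 -> M)
    (G : gpd (Pi P) n.+1 -> M) :
  is_equivariant (@act (Pi P) n) am G ->
  is_equivariant (@act P n) (restricted_act am (p 1 : gpd P 0 -> gpd (Pi P) 0))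
    (fun x => G (p n.+2 x)).
Proof.
case=> [[Gs Gt Ga] Gc]; split; first split=> [x|x|x y e].
- by rewrite Gs (functor_src (pF n.+1)).
- by rewrite Gt (functor_tgt (pF n.+1)).
- by rewrite (functor_add (pF n.+1)) // Ga // (functor_tgt (pF n.+1))
    (functor_src (pF n.+1)) e.
- move=> x a e; rewrite (mor_act p) // Gc //.
  by rewrite (functor_tgt (pF n.+1)) (functor_src (pF 0)) e.
Qed.

Section FreeCrossedModule.
Variables (M : groupoid (ob P)) (am : M -> gpd (Pi P) 0 -> M)
  (mu : M -> gpd (Pi P) 0).
Hypothesis hM : is_crossed_module am mu.
Let ham := crossed_action hM.
Let ra := restricted_act am (p 1 : gpd P 0 -> gpd (Pi P) 0).

(** Freeness of [P] concerns crossed modules over its own groupoid, whereas [M] lives over that of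
    [Pi P]. Pairs with compatible boundaries give a crossed module over the former. *)
Let Q (x : gpd P 1) (m : M) := tgt x = tgt m /\ mu m = p 1 (bd x).

Let Q_congruence : is_congruence Q.
Proof.
have L := loop (act_action P 0); have LM := loop ham.
have muF := crossed_functor hM.
split.
- by move=> x m [e _]; rewrite L LM.
- by move=> x m [].
- move=> q; rewrite /Q !tgt_idn bd_idn (functor_idn muF); split=> //.
- move=> x m x' m' [e e1] [e' e1'] e''.
  have tm : tgt m = src m' by rewrite LM -e -e' e'' L.
  rewrite /Q !tgt_add // (functor_add muF) // bd_add ?e'' ?L //; split=> //.
  by rewrite (functor_add (pF 0)) ?e1 ?e1' // bd_tgt bd_src e'' L.
- move=> x m [e e1]; rewrite /Q !tgt_opp L LM; split=> //.
  by rewrite (functor_opp muF) e1 bd_opp (functor_opp (pF 0)).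
Qed.

Let Q_act x m a : Q x m -> tgt x = src a -> Q (act x a) (ra m a).
Proof.
move=> [e e1] ea; have tp : tgt m = src (p 1 a : gpd (Pi P) 0).
  by rewrite (functor_src (pF 0)) -e ea.
split; first by rewrite (action_tgt (act_action P 0)) // (action_tgt ham) //
  (functor_tgt (pF 0)).
rewrite /ra /restricted_act (crossed_act hM) // e1 (crossed_act (cc_crossed P))
  //.
have e2 : tgt (- a) = src (bd x) by rewrite tgt_opp bd_src.
by rewrite (functor_add (pF 0)) ?tgt_add ?bd_tgt // (functor_add (pF 0)) //
  (functor_opp (pF 0)).
Qed.

Let Q_peiffer x m x' m' : Q x m -> Q x' m' -> tgt x = tgt x' ->
  - m' + m + m' = ra m (bd x').
Proof.
move=> [e _] [e' e1'] ex; rewrite (crossed_peiffer hM) ?e1' //.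
by rewrite -e -e'.
Qed.

Let Q_degenerate (x : K 2) : ~ nondegenerate x ->
  Q (gen P x) (idn (gen P (last_vertex x))).
Proof.
move=> dx; split; first by rewrite tgt_idn gen_tgt.
rewrite (functor_idn (crossed_functor hM)) (mor_bd p).
by rewrite Pi_proj_degenerate // bd_idn.
Qed.

Lemma Pi_crossed_extension (phi : gpd (Pi P) 1 -> M) :
  (forall r, R 2 r -> tgt (phi r) = tgt r /\ mu (phi r) = bd r) ->
  exists F : gpd (Pi P) 1 -> M,
    [/\ is_equivariant (@act (Pi P) 0) am F, forall x, mu (F x) = bd x
      & forall r, R 2 r -> F r = phi r].
Proof.
move=> hphi; have [_ _ h2 _] := gen_free_complex P.
pose f := on_nondegenerate (fun x : K 2 => idn (gen P (last_vertex x)) : M)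
  (fun x => phi (p 2 (gen P x))).
have fQ (x : K 2) : Q (gen P x) (f x).
  rewrite /f /on_nondegenerate; case: pselect => nx; last exact: Q_degenerate.
  have [|t m] := hphi (p 2 (gen P x)); first by exists x.
  by split; rewrite ?t ?m ?(functor_tgt (pF 1)) // -(mor_bd p).
have [|F [hF FQ FR]] := crossed_extension (cc_crossed P) h2
    (restricted_action (pF 0) ham) Q_congruence Q_act Q_peiffer
    (phi := on_gens (n := 1) (fun c => idn (tgt c)) f).
  by move=> _ [x _ <-]; rewrite on_gensE.
have FE (x : K 2) : F (gen P x) = f x by rewrite FR ?on_gensE.
have [|G [hG GE]] := level_factor_equivariant ham hF.
  by move=> i y ile; rewrite FE /f on_degenerateE // last_vertex_degen.
exists G; split=> //.
  move=> u; have [x <-] := Pi_proj_surj (n := 2) u.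
  by rewrite GE -(mor_bd p); case: (FQ x).
by move=> _ [x nx <-]; rewrite GE FE /f on_nondegenerateE.
Qed.

Lemma Pi_crossed_unique (F F' : gpd (Pi P) 1 -> M) :
  is_equivariant (@act (Pi P) 0) am F -> (forall x, mu (F x) = bd x) ->
  is_equivariant (@act (Pi P) 0) am F' -> (forall x, mu (F' x) = bd x) ->
  (forall r, R 2 r -> F r = F' r) -> F =1 F'.
Proof.
move=> hF Fmu hF' Fmu' FF' u; have [_ _ h2 _] := gen_free_complex P.
have [c <-] := Pi_proj_surj (n := 2) u.
have compQ (E : gpd (Pi P) 1 -> M) : is_equivariant (@act (Pi P) 0) am E ->
    (forall x, mu (E x) = bd x) -> forall x, Q x (E (p 2 x)).
  move=> hE Emu x; rewrite /Q Emu (mor_bd p).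
  by rewrite (functor_tgt (equivariant_functor hE)) (functor_tgt (pF 1)).
apply: (crossed_unique (cc_crossed P) h2 (restricted_action (pF 0) ham)
  Q_congruence Q_act Q_peiffer (equivariant_comp_proj hF) (compQ _ hF Fmu)
  (equivariant_comp_proj hF') (compQ _ hF' Fmu')).
move=> _ [x _ <-]; have [nx|dx] := pselect (nondegenerate x).
  by apply: FF'; exists x.
rewrite Pi_proj_degenerate // (functor_idn (equivariant_functor hF)).
by rewrite (functor_idn (equivariant_functor hF')).
Qed.

End FreeCrossedModule.

Section FreeModule.
Variables (M : groupoid (ob P)) (am : M -> pi1 (Pi P) -> M).
Hypothesis hM : is_module am.

Let toPi1 := gproj (bd_range_normal (Pi P)) : gpd (Pi P) 0 -> pi1 (Pi P).
Let toPi1F : is_functor id toPi1. Proof. exact: gproj_functor. Qed.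
Let ac := restricted_act am toPi1.
Let hac : is_module ac := restricted_module toPi1F hM.
Let ra := restricted_act ac (p 1 : gpd P 0 -> gpd (Pi P) 0).

(** Boundaries in [P] project to boundaries in [Pi P], which are identities in its fundamental
    groupoid. *)
Let hra : is_pi1_module ra.
Proof.
split; first exact: (restricted_module (pF 0) hac).
move=> x y e; rewrite /ra /ac /restricted_act (mor_bd p).
have -> : toPi1 (bd (p 2 y : gpd (Pi P) 1)) = idn (tgt x).
  have ty : tgt (p 2 y : gpd (Pi P) 1) = tgt x by rewrite e;
    apply: (functor_tgt (pF 1)).
  rewrite -(functor_idn toPi1F); apply/gprojP; split.
  - by rewrite bd_src ty src_idn.
  - by rewrite bd_tgt ty tgt_idn.
  - by rewrite idnN -ty -bd_tgt addr0; exists (p 2 y).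
exact: (action_idn (module_action hM)).
Qed.

Let pi1_equivariant n (F : gpd (Pi P) n.+2 -> M) :
  is_equivariant (@act (Pi P) n.+1) ac F <->
  is_equivariant (@pi1_act (Pi P) n) am F.
Proof.
split=> -[Ff Fa]; split=> // x a; last first.
  by move=> e; rewrite -pi1_actE // Fa // (functor_src toPi1F).
elim/gq_ind: a => a; rewrite [src _]gq_srcE => e.
by rewrite pi1_actE // Fa.
Qed.

Lemma Pi_module_extension n (phi : gpd (Pi P) n.+2 -> M) :
  (forall r, R n.+3 r -> tgt (phi r) = tgt r) ->
  exists F : gpd (Pi P) n.+2 -> M,
    is_equivariant (@pi1_act (Pi P) n) am F /\ forall r, R n.+3 r ->
      F r = phi r.
Proof.
move=> hphi.
pose f := on_nondegenerate (fun x : K n.+3 => idn (gen P (last_vertex x)) : M)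
  (fun x => phi (p n.+3 (gen P x))).
have [|F [hF FE]] := gen_linear (f := f) hra.
  move=> x; rewrite /f /on_nondegenerate; case: pselect => nx;
    last exact: tgt_idn.
  rewrite hphi; last by exists x.
  by rewrite (functor_tgt (pF n.+2)) gen_tgt.
have [|G [hG GE]] := level_factor_equivariant (module_action hac) hF.
  by move=> i y ile; rewrite FE /f on_degenerateE // last_vertex_degen.
exists G; split; first exact/pi1_equivariant.
by move=> _ [x nx <-]; rewrite GE FE /f on_nondegenerateE.
Qed.

Lemma Pi_module_unique n (F F' : gpd (Pi P) n.+2 -> M) :
  is_equivariant (@pi1_act (Pi P) n) am F ->
  is_equivariant (@pi1_act (Pi P) n) am F' ->
  (forall r, R n.+3 r -> F r = F' r) -> F =1 F'.
Proof.
move=> /pi1_equivariant hF /pi1_equivariant hF' FF' u.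
have [c <-] := Pi_proj_surj (n := n.+3) u.
apply: (linear_gen_unique hra (equivariant_comp_proj hF)
  (equivariant_comp_proj hF')) => x.
have [nx|dx] := pselect (nondegenerate x); first by apply: FF'; exists x.
rewrite Pi_proj_degenerate // (functor_idn (equivariant_functor hF)).
by rewrite (functor_idn (equivariant_functor hF')).
Qed.

End FreeModule.

Lemma Pi_free : free_generators (C := Pi P)
  (fun n => nondegenerate (K := K) (n := n))
  (fun n (x : K n) => Pi_proj P n (gen P x)).
Proof.
split; first exact: Pi_gen_inj.
split.
- exact: Pi_free0.
- exact: Pi_free1.
- move=> M am mu hM phi hphi; split; first exact: Pi_crossed_extension.
  move=> F F' [hF Fmu FR] [hF' Fmu' FR'].
  by apply: (Pi_crossed_unique hM) => // r rR; rewrite FR ?FR'.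
- move=> n M am hM phi hphi; split; first exact: Pi_module_extension.
  move=> F F' [hF FR] [hF' FR'].
  by apply: (Pi_module_unique hM) => // r rR; rewrite FR ?FR'.
Qed.

End Freeness.

Theorem theorem11p7 (K : simplicialSet) (P : PiUpsilon K) :
  [/\ homotopy_equivalence (Pi_proj P),
      exists q : morphism (Pi P) P,
        forall n (x : cell (Pi P) n), Pi_proj P n (q n x) = x
    & free_generators (C := Pi P) (fun n => nondegenerate (K := K) (n := n))
        (fun n (x : K n) => Pi_proj P n (gen P x))].
Proof.
have [q pq qp] := Pi_section P; split; last exact: Pi_free.
(* The composite of [q] followed by the projection is pointwise the identity, so a constant homotopy
   suffices on that side. *)
- by exists q; split=> //; apply: homotopic_id.
- by exists q.
Qed.
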